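(* Let $N\ge3$ with $N=2n$, let $\alpha>2$, and suppose $1\le p<\frac{2N+2\alpha-4}{N-2}$. Then $K_+\subset\subset L^p(B_1)$; that is, $K_+\subset L^p(B_1)$ and every sequence in $K_+$ that is bounded in $H$ has a subsequence converging in $L^p(B_1)$.
   Context: $B_1$ is the unit ball of $\mathbb{R}^N=\mathbb{R}^n\times\mathbb{R}^n$ centered at the origin. Set $s=(x_1^2+\cdots+x_n^2)^{1/2}$, $t=(x_{n+1}^2+\cdots+x_N^2)^{1/2}$, with polar coordinates $s=r\cos\theta$, $t=r\sin\theta$, $r=|x|$, $0<\theta<\frac{\pi}{2}$. $H$ is the completion of $\{u\in C_c^\infty(B_1\setminus\{0\}):u=u(s,t)\}$ (functions depending only on $(s,t)$) under the norm $\|u\|_H^2=\int_{B_1}\left(|\nabla u|^2+\frac{u^2}{|x|^\alpha}\right)dx$. $K_+$ is the set of $0\le u\in H$ with $u(r,\theta)=u(r,\frac{\pi}{2}-\theta)$ and $u_\theta\ge0$ a.e. for $0<r<1$, $0<\theta<\frac{\pi}{4}$. *)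

(* Defs.v *)
From HB Require Import structures.
From mathcomp Require Import all_boot all_order all_algebra.
From mathcomp Require Import all_classical all_reals all_analysis.
From mathcomp Require Import measurable_realfun.

Set Implicit Arguments.
Unset Strict Implicit.
Unset Printing Implicit Defensive.

Import Order.TTheory GRing.Theory Num.Theory.
Import numFieldNormedType.Exports.

Local Open Scope classical_set_scope.
Local Open Scope ring_scope.

Section measurable_rV.
Context {d} {T : measurableType d} {n : nat}.

(* The sigma-algebra generated by the coordinate projections, exactly as the
   library does for n.-tuple T; it is the Borel one when T is the real line. *)
Definition rV_coord (i : 'I_n) (x : 'rV[T]_n) : T := x ord0 i.

Let rV_set0 : g_sigma_preimage rV_coord set0.
Proof. exact: sigma_algebra0. Qed.

Let rV_setC A : g_sigma_preimage rV_coord A -> g_sigma_preimage rV_coord (~` A).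
Proof. exact: sigma_algebraC. Qed.

Let rV_bigcup (F : _^nat) : (forall i, g_sigma_preimage rV_coord (F i)) ->
  g_sigma_preimage rV_coord (\bigcup_i (F i)).
Proof. exact: sigma_algebra_bigcup. Qed.

HB.instance Definition _ := @isMeasurable.Build (measure_tuple_display d)
  'rV[T]_n (g_sigma_preimage rV_coord) rV_set0 rV_setC rV_bigcup.

End measurable_rV.

Lemma measurable_rV_coord d (T : measurableType d) n (i : 'I_n) :
  measurable_fun [set: 'rV[T]_n] (fun x => x ord0 i).
Proof.
move=> _ Y mY; rewrite setTI; apply: sub_sigma_algebra.
rewrite -bigcup_seq/=; exists i => /=; first by rewrite mem_index_enum.
by exists Y => //; rewrite setTI.
Qed.

Lemma measurable_fun_rVP d d' (S : measurableType d) (T : measurableType d')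
    n (f : S -> 'rV[T]_n) :
  (forall i, measurable_fun [set: S] (fun s => f s ord0 i)) ->
  measurable_fun [set: S] f.
Proof.
move=> mf; apply: (@measurability _ _ _ _ _ _
  (\big[setU/set0]_(i < n) preimage_set_system setT (@rV_coord _ T n i)
      measurable)) => //.
move=> _ [A + <-]; rewrite -bigcup_seq => -[i _ [B mB <-]].
by rewrite setTI; exact: (mf i _ B mB).
Qed.

Section lebesgue_rV.
Context {R : realType}.

Definition rV_cons n (p : measurableTypeR R * 'rV[R]_n) : 'rV[R]_n.+1 :=
  row_mx (p.1 : R)%:M p.2.

Definition rV_uncons n (x : 'rV[R]_n.+1) : measurableTypeR R * 'rV[R]_n :=
  (x ord0 ord0, \row_i x ord0 (lift ord0 i)).

Lemma rV_cons0 n (p : measurableTypeR R * 'rV[R]_n) :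
  rV_cons p ord0 ord0 = p.1.
Proof.
rewrite /rV_cons (_ : ord0 = lshift n (ord0 : 'I_1)); last exact: val_inj.
by rewrite (@row_mxEl _ 1 1 n) mxE eqxx mulr1n.
Qed.

Lemma rV_consS n (p : measurableTypeR R * 'rV[R]_n) i :
  rV_cons p ord0 (lift ord0 i) = p.2 ord0 i.
Proof.
rewrite /rV_cons (_ : lift ord0 i = rshift 1 i); last exact: val_inj.
by rewrite (@row_mxEr _ 1 1 n).
Qed.

Lemma rV_consK n : cancel (@rV_cons n) (@rV_uncons n).
Proof.
case=> a v; rewrite /rV_uncons rV_cons0; congr pair.
by apply/rowP => i; rewrite mxE rV_consS.
Qed.

Lemma rV_unconsK n : cancel (@rV_uncons n) (@rV_cons n).
Proof.
move=> x; apply/rowP => i; case: (unliftP ord0 i) => [j ->|->].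
  by rewrite rV_consS mxE.
by rewrite rV_cons0.
Qed.

Lemma measurable_rV_cons n : measurable_fun setT (@rV_cons n).
Proof.
apply: measurable_fun_rVP => i; case: (unliftP ord0 i) => [j ->|->].
  under eq_fun do rewrite rV_consS.
  exact: (measurableT_comp (measurable_rV_coord j) measurable_snd).
under eq_fun do rewrite rV_cons0.
exact: measurable_fst.
Qed.

Lemma measurable_rV_uncons n : measurable_fun setT (@rV_uncons n).
Proof.
apply/measurable_fun_pairP; split => /=.
  exact: measurable_rV_coord.
apply: measurable_fun_rVP => i /=; under eq_fun do rewrite mxE.
exact: measurable_rV_coord.
Qed.

Section step.
Variables (n : nat) (mu : {sigma_finite_measure set 'rV[R]_n -> \bar R}).

Definition lebesgue_rV_step : set 'rV[R]_n.+1 -> \bar R :=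
  pushforward (lebesgue_measure \x mu)%E (@rV_cons n).

Let step_measure : {measure set 'rV[R]_n.+1 -> \bar R} :=
  measure_function_pushforward__canonical__measure_function_Measure
    (lebesgue_measure \x mu)%E (@measurable_rV_cons n).

Let step0 : lebesgue_rV_step set0 = 0%E.
Proof. exact: (measure0 step_measure). Qed.

Let step_ge0 A : (0 <= lebesgue_rV_step A)%E.
Proof. exact: (measure_ge0 step_measure). Qed.

Let step_sigma_additive : semi_sigma_additive lebesgue_rV_step.
Proof. exact: (@measure_semi_sigma_additive _ _ _ step_measure). Qed.

HB.instance Definition _ := isMeasure.Build _ _ _ lebesgue_rV_step
  step0 step_ge0 step_sigma_additive.

Let step_sigma_finite : sigma_finite setT lebesgue_rV_step.
Proof.
have /sigma_finiteP[F [TF ndF Foo]] := sigma_finiteT (@lebesgue_measure R).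
have /sigma_finiteP[G [TG ndG Goo]] := sigma_finiteT mu.
exists (fun k => @rV_uncons n @^-1` (F k `*` G k)).
  rewrite -preimage_bigcup; apply/esym/seteqP; split=> // x _ /=.
  have [i _ Fi] : (\bigcup_i F i) (rV_uncons x).1 by rewrite -TF.
  have [j _ Gj] : (\bigcup_i G i) (rV_uncons x).2 by rewrite -TG.
  exists (maxn i j) => //; split.
    by move: Fi; exact/subsetPset/ndF/leq_maxl.
  by move: Gj; exact/subsetPset/ndG/leq_maxr.
move=> k; have [mF Fkoo] := Foo k; have [mG Gkoo] := Goo k.
have mFG : measurable (F k `*` G k) by exact: measurableX.
split.
  by rewrite -[X in measurable X]setTI; exact: measurable_rV_uncons.
rewrite /lebesgue_rV_step /pushforward -comp_preimage (_ : _ \o _ = id).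
  rewrite preimage_id product_measure1E// lte_mul_pinfty// ge0_fin_numE//.
by apply/funext => p /=; rewrite rV_consK.
Qed.

HB.instance Definition _ := Measure_isSigmaFinite.Build _ _ _ lebesgue_rV_step
  step_sigma_finite.

End step.

Fixpoint lebesgue_rV n : {sigma_finite_measure set 'rV[R]_n -> \bar R} :=
  if n is n'.+1 then lebesgue_rV_step (lebesgue_rV n')
  else dirac (0 : 'rV[R]_0).

Lemma lebesgue_rV_box n (A : 'I_n -> set (measurableTypeR R)) :
  (forall i, measurable (A i)) ->
  lebesgue_rV n [set x : 'rV[R]_n | forall i, A i (x ord0 i)] =
  (\prod_(i < n) lebesgue_measure (A i))%E.
Proof.
elim: n A => [|n IHn] A mA.
  rewrite big_ord0 /= /dirac indicE mem_set //=; by case.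
rewrite big_ord_recl -IHn; last by move=> i; exact: mA.
rewrite -product_measure1E //; last first.
  rewrite (_ : [set x | _] = \bigcap_(i in [set: 'I_n])
      ((fun x : 'rV[R]_n => x ord0 i) @^-1` A (lift ord0 i))); last first.
    by apply/seteqP; split => x /= + i => /(_ i); exact.
  apply: fin_bigcap_measurable => // i _; rewrite -[X in measurable X]setTI.
  exact: (measurable_rV_coord i measurableT (mA (lift ord0 i))).
rewrite /= /lebesgue_rV_step /pushforward; congr (_ _).
apply/seteqP; split => -[a v] /=.
  move=> h; split; first by have := h ord0; rewrite rV_cons0.
  by move=> i; have := h (lift ord0 i); rewrite rV_consS.
move=> [ha hv] i; case: (unliftP ord0 i) => [j ->|->].
  by rewrite rV_consS.
by rewrite rV_cons0.
Qed.

Definition enorm n (x : 'rV[R]_n) : R := Num.sqrt (\sum_(i < n) x ord0 i ^+ 2).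

Definition unit_ball n : set 'rV[R]_n := [set x | enorm x < 1].

Lemma measurable_unit_ball n : measurable (@unit_ball n).
Proof.
rewrite (_ : @unit_ball n = setT `&` (fun x : 'rV[R]_n =>
    \sum_(i < n) x ord0 i ^+ 2) @^-1` `]-oo, 1[); last first.
  apply/seteqP; split => x /=; rewrite /unit_ball /= /enorm in_itv /=.
    by rewrite -{1}sqrtr1 ltr_sqrt.
  by move=> [_]; rewrite -{2}sqrtr1 ltr_sqrt.
suff mf : measurable_fun setT (fun x : 'rV[R]_n => \sum_(i < n) x ord0 i ^+ 2).
  exact: mf.
apply: measurable_sum => i; apply: measurable_funX; exact: measurable_rV_coord.
Qed.

(* Lebesgue measure of R^n restricted to the unit ball. *)
Definition ball_measure n : {measure set 'rV[R]_n -> \bar R} :=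
  mrestr (lebesgue_rV n) (@measurable_unit_ball n).

End lebesgue_rV.

Section smooth_functions.
Context {R : realType} {m : nat}.
Implicit Types phi : 'rV[R]_m -> R.

Fixpoint is_Ck (k : nat) phi : Prop :=
  if k is k'.+1 then
    (forall x, differentiable phi x) /\
    (forall i, is_Ck k' ('D_(delta_mx 0 i) phi))
  else continuous phi.

Definition is_smooth phi : Prop := forall k, is_Ck k phi.

Definition gradient phi (x : 'rV[R]_m) : 'rV[R]_m :=
  \row_i 'D_(delta_mx 0 i) phi x.

Definition tsupport phi : set 'rV[R]_m := closure [set x | phi x != 0].

End smooth_functions.

Section H_functions.
Context {R : realType} {n : nat}.
Local Notation RN := 'rV[R]_(n + n).
Local Notation mu := (@ball_measure R (n + n)).
Implicit Types (u phi : RN -> R) (G : RN -> RN) (x : RN).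

Definition s_coord x : R := enorm (lsubmx x).

Definition t_coord x : R := enorm (rsubmx x).

(* s = r cos theta and t = r sin theta off the null set s = 0. *)
Definition theta x : R := atan (t_coord x / s_coord x).

Definition depends_on_st phi : Prop :=
  exists g : R -> R -> R, forall x, phi x = g (s_coord x) (t_coord x).

(* Elements of C_c^oo(B_1 \ {0}) depending only on (s, t), extended by zero
   to the whole space. *)
Definition H_test : set (RN -> R) :=
  [set phi | [/\ is_smooth phi, compact (tsupport phi),
    tsupport phi `<=` @unit_ball R (n + n) `\ 0 & depends_on_st phi]].

Definition H_pair_norm (alpha : R) u G : \bar R :=
  ((\int[mu]_x (enorm (G x) ^+ 2 + u x ^+ 2 / enorm x `^ alpha)%:E) `^ 2^-1)%E.

(* The completion of H_test is realized as the closure of its image under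
   phi |-> (phi, gradient phi) in L^2(|x|^-alpha) x L^2: [H_gradient alpha u] is
   the set of all G such that (u, G) belongs to this closure.  Since
   |x|^-alpha >= 1 on B_1, such a G is the weak gradient of u on B_1; it is
   unique up to a null set, so that u alone determines the element of H.
   Functions are Borel on R^N and only their values almost everywhere on B_1
   matter. *)
Definition H_gradient (alpha : R) u : set (RN -> RN) :=
  [set G | measurable_fun setT G /\
    exists2 phi : nat -> RN -> R, (forall k, H_test (phi k)) &
      H_pair_norm alpha (phi k \- u) (gradient (phi k) \- G) @[k --> \oo] --> 0%E].

Definition H_space (alpha : R) : set (RN -> R) :=
  [set u | measurable_fun setT u /\ H_gradient alpha u !=set0].

Definition H_grad (alpha : R) u : RN -> RN := xget (fun=> 0) (H_gradient alpha u).

Definition H_norm (alpha : R) u : \bar R := H_pair_norm alpha u (H_grad alpha u).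

(* The derivative of x = (s omega, t eta) = (r cos theta omega,
   r sin theta eta) in theta, for fixed r and unit vectors omega, eta. *)
Definition dx_dtheta x : RN :=
  row_mx (- (t_coord x / s_coord x) *: lsubmx x)
         ((s_coord x / t_coord x) *: rsubmx x).

Definition u_theta (alpha : R) u x : R :=
  \sum_(i < n + n) H_grad alpha u x 0 i * dx_dtheta x 0 i.

(* For u = u(s, t), exchanging the two factors of R^n x R^n exchanges s and t,
   i.e. maps (r, theta) to (r, pi / 2 - theta). *)
Definition swap_st x : RN := row_mx (rsubmx x) (lsubmx x).

Definition K_plus (alpha : R) : set (RN -> R) :=
  [set u | [/\ H_space alpha u,
    {ae mu, forall x, 0 <= u x},
    {ae mu, forall x, u (swap_st x) = u x} &
    {ae mu, forall x, 0 < theta x < pi / 4 -> 0 <= u_theta alpha u x}]].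

End H_functions.

(* Main.v *)
Require Import Defs.
From HB Require Import structures.
From mathcomp Require Import all_boot all_order all_algebra.
From mathcomp Require Import all_classical all_reals all_analysis.
From mathcomp Require Import measurable_realfun ring lra zify.
Set Implicit Arguments.
Unset Strict Implicit.
Unset Printing Implicit Defensive.
Import Order.TTheory GRing.Theory Num.Theory.
Import numFieldNormedType.Exports.
Local Open Scope classical_set_scope.
Local Open Scope ring_scope.

(** The theorem is a two-dimensional estimate in disguise. A function of (s, t)
is a function of r = |x| and z = t / s = tan theta, and the integral over the
ball of such a function is, up to a constant factor, its integral over
0 < r < 1, z > 0 against r^(N-1) z^(n-1) / (1 + z^2)^n ([polar_formula],
[ball_polar]). On the strip 1/2 <= z <= 1 the angular weight is bounded below,
so that the H norm controls there an energy of two variables with power weights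
in r.

In two variables an integral of F^2 is at most the product of the integral of
|F_r| and that of |F_z|, up to boundary terms. Applied to a weighted power of
psi, this bounds the integral of r^(b+N-2) psi^(2q) by that of r^b psi^(2q-2)
and the energy ([gn_step]). Starting from the term psi^2 / r^alpha of the
energy, induction controls every moment psi^(2q), with a power of r that grows
linearly in q ([gn_bound]). Interpolating between psi^2 / r^alpha and a moment
of high order, one finds the powers psi^p whose integral needs no weight: they
are those with (N - 2) (p / 2 - 1) <= alpha ([power_interpolation]), and
equality is the critical exponent p* = (2 N + 2 alpha - 4) / (N - 2).

Near z = 0 the weight z^(n-1) degenerates, and for large alpha such bounds fail
in H. Here K_+ enters: its elements increase with z on z < 1, so that their
values below the strip do not exceed their values on it, and the symmetry
between s and t takes care of z > 1. An element of H being a limit of test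
functions phi_k, one works with the total decrease of phi_k over a <= z < 1,
which tends to 0 because the angular derivative of the limit is nonnegative
([zdrop_small]). Below the strip phi_k is compared with its average over the
strip ([core_power_le]), and Fatou's lemma gives a bound of the integral of
|u|^p* over the ball by the H norm of u in K_+ ([K_plus_power_bound]).

Since p < p*, that bound turns convergence in L^1 into convergence in L^p
([Lnorm_cvg0]). Convergence in L^1 of a subsequence holds in the whole of H. It
suffices to treat test functions, by density. Those bounded in H are bounded in
W^{1,1} of each rectangle a <= r < 1, a <= z < 1/a, where they are nearly
constant on small cells; a pigeonhole argument on these constants selects a
subsequence of small oscillation ([W11_compact]). The rest of the ball has small
measure and is handled by the L^2 bound ([rellich_step]), and a diagonal
extraction concludes ([rellich]). *)

(** * Integrals of real-valued integrands *)

Section real_integrands.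
Context d (T : measurableType d) (R : realType).
Variable mu : {measure set T -> \bar R}.
Implicit Types (D : set T) (f g : T -> R).
Local Open Scope ereal_scope.

Lemma measurable_fun_EFin D f : measurable_fun setT f -> measurable_fun D (fun x => (f x)%:E).
Proof. by move=> mf; apply/measurable_EFinP; exact: measurable_funTS. Qed.

Lemma rint_ge0 D f : (forall x, D x -> 0 <= f x)%R ->
  0 <= \int[mu]_(x in D) (f x)%:E.
Proof. by move=> f0; apply: integral_ge0 => x Dx; rewrite lee_fin; exact: f0. Qed.

Lemma rint_le D f g : measurable D ->
  measurable_fun setT f -> measurable_fun setT g ->
  (forall x, D x -> 0 <= f x)%R -> (forall x, D x -> f x <= g x)%R ->
  \int[mu]_(x in D) (f x)%:E <= \int[mu]_(x in D) (g x)%:E.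
Proof.
move=> mD mf mg f0 fg; apply: (@ge0_le_integral _ _ _ mu D mD).
- by move=> x Dx; rewrite lee_fin; exact: f0.
- exact: measurable_fun_EFin.
- exact: measurable_fun_EFin.
- by move=> x Dx; rewrite lee_fin; exact: fg.
Qed.

Lemma rintD D f g : measurable D ->
  measurable_fun setT f -> measurable_fun setT g ->
  (forall x, D x -> 0 <= f x)%R -> (forall x, D x -> 0 <= g x)%R ->
  \int[mu]_(x in D) (f x + g x)%:E =
  \int[mu]_(x in D) (f x)%:E + \int[mu]_(x in D) (g x)%:E.
Proof.
move=> mD mf mg f0 g0; rewrite -(@ge0_integralD _ _ _ mu D mD (fun x => (f x)%:E) (fun x => (g x)%:E)).
- by apply: eq_integral => x _; rewrite EFinD.
- by move=> x Dx; rewrite lee_fin; exact: f0.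
- exact: measurable_fun_EFin.
- by move=> x Dx; rewrite lee_fin; exact: g0.
- exact: measurable_fun_EFin.
Qed.

Lemma rintZ D (k : R) f : measurable D ->
  measurable_fun setT f -> (0 <= k)%R -> (forall x, D x -> 0 <= f x)%R ->
  \int[mu]_(x in D) (k * f x)%:E = k%:E * \int[mu]_(x in D) (f x)%:E.
Proof.
move=> mD mf k0 f0; rewrite -(@ge0_integralZl_EFin _ _ _ mu D mD (fun x => (f x)%:E)) //.
exact: measurable_fun_EFin.
Qed.

Lemma rint_subset A B f : measurable A -> measurable B ->
  measurable_fun setT f -> (forall x, B x -> 0 <= f x)%R -> A `<=` B ->
  \int[mu]_(x in A) (f x)%:E <= \int[mu]_(x in B) (f x)%:E.
Proof.
move=> mA mB mf f0 AB; apply: ge0_subset_integral => //; exact: measurable_fun_EFin.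
Qed.

Lemma rint_cst D (c : R) : measurable D ->
  \int[mu]_(x in D) c%:E = c%:E * mu D.
Proof. by move=> mD; rewrite -integral_cst. Qed.

End real_integrands.

(** * Measures with a density, and iterated integration over rows *)

Lemma ge0_integral_mrestr d (T : measurableType d) (R : realType)
    (mu : {measure set T -> \bar R}) (D : set T) (mD : measurable D)
    (f : T -> \bar R) :
  measurable_fun setT f -> (forall x, 0 <= f x)%E ->
  (\int[mrestr mu mD]_x f x = \int[mu]_(x in D) f x)%E.
Proof.
move=> mf f0; rewrite -(setUv D) ge0_integral_setU//; last 3 first.
- exact: measurableC.
- by rewrite setUv.
- exact/disj_setPCl.
rewrite (eq_measure_integral mu); last first.
  by move=> A mA AD; rewrite /= /mrestr setIidl.
rewrite [X in (_ + X)%E](eq_measure_integral mzero); last first.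
  move=> A mA AD; rewrite /= /mrestr /mzero.
  by rewrite (_ : A `&` D = set0) ?measure0//; apply/seteqP; split => // x [/AD].
by rewrite integral_measure_zero adde0.
Qed.

Section density.
Context {R : realType}.
Local Notation leb := (@lebesgue_measure R).
Local Notation mR := (measurableTypeR R).
Local Open Scope ereal_scope.

(** The measure is the image, under the first projection, of the planar Lebesgue
measure of the region 0 <= y < w s under the graph of [w]; both formulas are
then Tonelli's theorem. *)
Lemma density_measure (w : R -> R) : measurable_fun setT w ->
  (forall s, 0 <= w s)%R ->
  exists m : {measure set mR -> \bar R},
    (forall A : set mR, measurable A ->
       m A = \int[leb]_(s in A) (w s)%:E) /\
    (forall g : mR -> \bar R, measurable_fun setT g ->
       (forall s, 0 <= g s) ->
       \int[m]_s g s = \int[leb]_s (g s * (w s)%:E)).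
Proof.
move=> mw w0.
pose D := [set p : mR * mR |
           (0 <= p.2 < w p.1)%R].
have mw1 : measurable_fun setT
    (fun p : mR * mR => w p.1).
  exact: (measurableT_comp mw measurable_fst).
have mD : measurable D.
  rewrite (_ : D = (fun p : mR * mR =>
    (0 <= p.2)%R && (p.2 < w p.1)%R) @^-1` [set true]); last first.
    by apply/seteqP; split => p /=.
  rewrite -[X in measurable X]setTI; apply: measurable_and => //.
  - apply: measurable_fun_ler => //; exact: measurable_snd.
  - apply: measurable_fun_ltr => //; exact: measurable_snd.
have mfst : measurable_fun setT (@fst mR mR).
  exact: measurable_fst.
pose mu := mrestr (leb \x leb) mD.
pose m : {measure set mR -> \bar R} :=
  measure_function_pushforward__canonical__measure_function_Measure mu mfst.
have sec s : leb [set y | D (s, y)] = (w s)%:E.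
  rewrite (_ : [set y | D (s, y)] = `[0%R, w s[%classic).
    rewrite lebesgue_measure_itv/= lte_fin.
    case: ltP; first by rewrite sube0.
    by move=> h; congr (_%:E); apply/eqP; rewrite eq_le w0 h.
  by apply/seteqP; split => y; rewrite /D/= in_itv.
have H g : measurable_fun setT g ->
       (forall s, 0 <= g s) ->
       \int[m]_s g s = \int[leb]_s (g s * (w s)%:E).
  move=> mg g0.
  have mg1 : measurable_fun setT
     (fun p : mR * mR => g p.1).
    exact: measurableT_comp.
  rewrite ge0_integral_pushforward//= preimage_setT ge0_integral_mrestr//.
  rewrite integral_mkcond fubini_tonelli1//; last 2 first.
  - by apply/(measurable_restrictT _ _).1 => //; exact: measurable_funTS.
  - by move=> p; apply: erestrict_ge0.
  apply: eq_integral => s _; rewrite /fubini_F.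
  rewrite (_ : (fun y => _) = (cst (g s)) \_ [set y | D (s, y)]); last first.
    apply/funext => y; rewrite !patchE; congr (if _ then _ else _).
  have mDs : measurable [set y : mR | D (s, y)].
    rewrite (_ : [set y | D (s, y)] = `[0%R, w s[%classic).
      exact: (@measurable_itv R).
    by apply/seteqP; split => y; rewrite /D/= in_itv.
  by rewrite -integral_mkcond integral_cst//; congr (_ * _); exact: sec.
exists m; split => // A mA.
rewrite -(@setIT _ A) -integral_indic// H//; last exact/measurable_EFinP.
rewrite [RHS]integral_mkcond setIT; apply: eq_integral => s _.
by rewrite patchE indicE; case: (s \in A); rewrite ?mul1e ?mul0e.
Qed.
End density.

Section rV_integral.
Context {R : realType}.
Local Notation leb := (@lebesgue_measure R).
Local Notation mR := (measurableTypeR R).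
Local Open Scope ereal_scope.

Lemma ge0_integral_rVS n (f : 'rV[R]_n.+1 -> \bar R) :
  measurable_fun setT f -> (forall x, 0 <= f x) ->
  \int[lebesgue_rV n.+1]_x f x =
  \int[leb]_a \int[lebesgue_rV n]_v f (rV_cons (a, v)).
Proof.
move=> mf f0; rewrite /= /lebesgue_rV_step ge0_integral_pushforward//; last first.
  exact: measurable_rV_cons.
rewrite preimage_setT fubini_tonelli1//.
- by apply: measurableT_comp => //; exact: measurable_rV_cons.
- by move=> p; exact: f0.
Qed.

Lemma ge0_integral_rV0 (f : 'rV[R]_0 -> \bar R) :
  measurable_fun setT f -> (forall x, 0 <= f x) ->
  \int[lebesgue_rV 0]_x f x = f 0%R.
Proof.
move=> mf f0 /=; rewrite integral_dirac// diracE in_setT mul1e//.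
Qed.

Lemma measurable_row_mx m n :
  measurable_fun setT (fun p : 'rV[R]_m * 'rV[R]_n => row_mx p.1 p.2).
Proof.
apply: measurable_fun_rVP => i; rewrite -(splitK i).
case: (fintype.split i) => j /=.
  under eq_fun do rewrite row_mxEl.
  exact: (measurableT_comp (measurable_rV_coord j) measurable_fst).
under eq_fun do rewrite row_mxEr.
exact: (measurableT_comp (measurable_rV_coord j) measurable_snd).
Qed.

Lemma rV_cons_row_mx m n a (x : 'rV[R]_m) (y : 'rV[R]_n) :
  row_mx (rV_cons (a, x)) y = rV_cons (a, row_mx x y) :> 'rV[R]_(m.+1 + n).
Proof.
apply/rowP => i; rewrite -(splitK i).
case: (fintype.split i) => j /=.
  rewrite row_mxEl; case: (unliftP ord0 j) => [k ->|->].
    rewrite rV_consS /=.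
    have -> : lshift n (lift ord0 k) =
        lift (ord0 : 'I_(m + n).+1) (lshift n (k : 'I_m)) :> 'I_(m.+1 + n).
      exact/val_inj.
    by rewrite rV_consS row_mxEl.
  have -> : lshift n (ord0 : 'I_m.+1) = (ord0 : 'I_(m + n).+1) :> 'I_(m.+1 + n).
    exact/val_inj.
  by rewrite !rV_cons0.
rewrite row_mxEr.
have -> : rshift m.+1 j = lift (ord0 : 'I_(m + n).+1) (rshift m j) :> 'I_(m.+1 + n).
  exact/val_inj.
by rewrite rV_consS /= row_mxEr.
Qed.

(** [lebesgue_rV] is built one coordinate at a time, without reference to blocks:
hence an induction that peels off the coordinates of the first block. *)
Lemma ge0_integral_rVD m n (f : 'rV[R]_(m + n) -> \bar R) :
  measurable_fun setT f -> (forall x, 0 <= f x) ->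
  \int[lebesgue_rV (m + n)]_x f x =
  \int[lebesgue_rV m]_x \int[lebesgue_rV n]_y f (row_mx x y).
Proof.
elim: m f => [|m IH] f mf f0.
  rewrite ge0_integral_rV0//; last 2 first.
  - apply: (measurable_fun_fubini_tonelli_F (fun p : 'rV[R]_0 * 'rV[R]_n => f (row_mx p.1 p.2))) => //.
    exact: (measurableT_comp mf (@measurable_row_mx 0 n)).
  - by move=> x; apply: integral_ge0.
  apply: eq_integral => y _; congr f; apply/rowP => i.
  rewrite (_ : i = rshift 0 i); last exact/val_inj.
  by rewrite row_mxEr; congr (y _ _); exact/val_inj.
have mfr : measurable_fun setT
   (fun p : mR * 'rV[R]_m => \int[lebesgue_rV n]_y f (row_mx (rV_cons p) y)).
  apply: (measurable_fun_fubini_tonelli_F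
   (fun q : (mR * 'rV[R]_m) * 'rV[R]_n => f (row_mx (rV_cons q.1) q.2))) => //.
  apply: (measurableT_comp mf).
  apply: (@measurableT_comp _ _ _ _ _ _ (fun p : 'rV[R]_m.+1 * 'rV[R]_n => row_mx p.1 p.2)
    _ (fun q : (mR * 'rV[R]_m) * 'rV[R]_n => (rV_cons q.1, q.2))).
    exact: measurable_row_mx.
  apply/measurable_fun_pairP; split => /=.
    by apply: (measurableT_comp (@measurable_rV_cons _ _)); exact: measurable_fst.
  exact: measurable_snd.
rewrite (ge0_integral_rVS mf)// (@ge0_integral_rVS m) //; last 2 first.
- apply: (measurable_fun_fubini_tonelli_F
   (fun q : ('rV[R]_m.+1) * 'rV[R]_n => f (row_mx q.1 q.2))) => //.
  exact: (measurableT_comp mf (@measurable_row_mx m.+1 n)).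
- by move=> x; exact: integral_ge0.
apply: eq_integral => a _.
rewrite (IH (fun v => f (rV_cons (a, v)))) //; last first.
  apply: (measurableT_comp mf).
  apply: (measurableT_comp (@measurable_rV_cons _ _)).
  by apply: measurable_pair1.
by apply: eq_integral => x _; apply: eq_integral => y _; rewrite rV_cons_row_mx.
Qed.

End rV_integral.

(** * Dilations, and the law of the Euclidean norm *)

Section scaling.
Context {R : realType}.
Local Notation leb := (@lebesgue_measure R).
Local Notation mR := (measurableTypeR R).
Local Open Scope ereal_scope.

(** Lebesgue measure is characterized by the length of intervals, and c times
the image measure under the dilation gives them the same length. *)
Lemma ge0_integral_scale (c : R) (f : R -> \bar R) : (0 < c)%R ->
  measurable_fun setT f -> (forall x, 0 <= f x) ->
  \int[leb]_x f x = c%:E * \int[leb]_x f (c * x)%R.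
Proof.
move=> c0 mf f0.
have mc : measurable_fun setT (fun x : mR => (c * x)%R : mR).
  exact: mulrl_measurable.
have c0' : (0 <= c)%R by exact: ltW.
pose k := NngNum c0'.
pose pf : {measure set mR -> \bar R} :=
  measure_function_pushforward__canonical__measure_function_Measure leb mc.
have e A : measurable A -> leb A = mscale k pf A.
  apply: lebesgue_measure_unique => _ [[a b] _ <-].
  rewrite /= /mscale /pf /= /pushforward.
  rewrite (_ : _ @^-1` _ = `](a / c)%R, (b / c)%R]%classic); last first.
    apply/seteqP; split => x /=; rewrite !in_itv/= ltr_pdivrMr// ler_pdivlMr//
      ![(c * _)%R]mulrC //.
  rewrite !lebesgue_measure_itv/= !lte_fin ltr_pM2r ?invr_gt0//.
  case: ifPn => _; last by rewrite mule0.
  by rewrite -EFinD -EFinM mulrBr ![(c * _)%R]mulrC !divfK ?gt_eqF.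
rewrite (eq_measure_integral (mscale k pf)); last by move=> A mA _; exact: e.
rewrite ge0_integral_mscale// ge0_integral_pushforward//= preimage_setT//.
Qed.

Lemma scale_rV_cons n (c : R) (p : mR * 'rV[R]_n) :
  (c *: rV_cons p)%R = rV_cons ((c * p.1)%R, (c *: p.2)%R).
Proof.
apply/rowP => i; rewrite mxE; case: (unliftP ord0 i) => [j ->|->].
  by rewrite !rV_consS /= mxE.
by rewrite !rV_cons0.
Qed.

Lemma measurable_scale_rV n (c : R) :
  measurable_fun setT (fun x : 'rV[R]_n => (c *: x)%R).
Proof.
apply: measurable_fun_rVP => i; under eq_fun do rewrite mxE.
by apply: measurable_funM => //; exact: measurable_rV_coord.
Qed.

Lemma measurable_subrV n d (T : measurableType d) (f g : T -> 'rV[R]_n) :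
  measurable_fun setT f -> measurable_fun setT g -> measurable_fun setT (f \- g)%R.
Proof.
move=> mf mg; apply: measurable_fun_rVP => i.
rewrite (_ : (fun x => _) = (fun x => f x ord0 i - g x ord0 i)%R); last first.
  by apply/funext => x; rewrite !mxE.
by apply: measurable_funB; apply: (measurableT_comp (measurable_rV_coord i)).
Qed.

Lemma ge0_integral_scale_rV n (c : R) (f : 'rV[R]_n -> \bar R) : (0 < c)%R ->
  measurable_fun setT f -> (forall x, 0 <= f x) ->
  \int[lebesgue_rV n]_x f x =
  (c ^+ n)%:E * \int[lebesgue_rV n]_x f (c *: x)%R.
Proof.
move=> c0; elim: n f => [|n IH] f mf f0.
  rewrite expr0 mul1e !ge0_integral_rV0//; last first.
    by apply: (measurableT_comp mf); exact: measurable_scale_rV.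
  by rewrite scaler0.
have mfc : measurable_fun setT (fun p : mR * 'rV[R]_n => f (rV_cons p)).
  by apply: measurableT_comp => //; exact: measurable_rV_cons.
rewrite !ge0_integral_rVS//; last first.
  by apply: (measurableT_comp mf); exact: measurable_scale_rV.
rewrite (ge0_integral_scale c0); last 2 first.
- exact: (measurable_fun_fubini_tonelli_F
    (fun p : mR * 'rV[R]_n => f (rV_cons p))).
- by move=> a; apply: integral_ge0.
under eq_integral => a _.
  rewrite (IH (fun v => f (rV_cons (_, v))))//; last first.
    by apply: (measurableT_comp mfc); apply: measurable_pair1.
  over.
rewrite ge0_integralZl//; last 3 first.
- apply: (measurable_fun_fubini_tonelli_F
    (fun p : mR * 'rV[R]_n => f (rV_cons (c * p.1, c *: p.2)%R))) => //.
  under eq_fun do rewrite -scale_rV_cons.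
  apply: (measurableT_comp mf).
  apply: (measurableT_comp (@measurable_scale_rV n.+1 c)).
  exact: measurable_rV_cons.
- by move=> a _; apply: integral_ge0.
- by rewrite lee_fin exprn_ge0// ltW.
rewrite muleA -EFinM -exprS; congr (_ * _).
by apply: eq_integral => a _; apply: eq_integral => v _; rewrite scale_rV_cons.
Qed.

End scaling.

Section radial.
Context {R : realType}.
Local Notation leb := (@lebesgue_measure R).
Local Notation mR := (measurableTypeR R).
Local Open Scope ereal_scope.

Lemma measurable_enorm n : measurable_fun setT (@enorm R n).
Proof.
apply: (measurableT_comp (f := @Num.sqrt R)).
  by apply: continuous_measurable_fun; exact: sqrt_continuous.
by apply: measurable_sum => i; apply: measurable_funX; exact: measurable_rV_coord.
Qed.

Lemma measurable_enorm_le n (c : R) :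
  measurable [set x : 'rV[R]_n | (enorm x <= c)%R].
Proof.
rewrite -[X in measurable X]setTI.
rewrite (_ : [set x | _] = @enorm R n @^-1` `]-oo, c]%classic).
  by apply: measurable_enorm => //; exact: measurable_itv.
by apply/seteqP; split => x /=; rewrite in_itv.
Qed.

Lemma enorm_ge0 n (x : 'rV[R]_n) : (0 <= enorm x)%R.
Proof. exact: sqrtr_ge0. Qed.

Lemma enorm_sqr n (x : 'rV[R]_n) : (enorm x ^+ 2 = \sum_(i < n) x ord0 i ^+ 2)%R.
Proof. by rewrite sqr_sqrtr// sumr_ge0// => i _; exact: sqr_ge0. Qed.

Lemma enormZ n (c : R) (x : 'rV[R]_n) : enorm (c *: x) = (`|c| * enorm x)%R.
Proof.
rewrite /enorm -sqrtr_sqr -sqrtrM ?sqr_ge0//; congr Num.sqrt.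
by rewrite mulr_sumr; apply: eq_bigr => i _; rewrite mxE exprMn.
Qed.

Lemma le_coord_enorm n (x : 'rV[R]_n) i : (`|x ord0 i| <= enorm x)%R.
Proof.
rewrite -(@ler_pXn2r _ 2)// ?nnegrE ?enorm_ge0//.
rewrite enorm_sqr real_normK ?num_real// (bigD1 i)//= lerDl.
by rewrite sumr_ge0// => j _; exact: sqr_ge0.
Qed.

Lemma enorm_le n (x : 'rV[R]_n) b : (0 <= b)%R -> (forall i, `|x ord0 i| <= b)%R ->
  (enorm x ^+ 2 <= n%:R * b ^+ 2)%R.
Proof.
move=> b0 xb; rewrite enorm_sqr -[X in (_ <= X%:R * _)%R]card_ord -sum1_card natr_sum mulr_suml.
apply: ler_sum => i _; rewrite mul1r -(@real_normK _ (x ord0 i)) ?num_real//.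
by rewrite ler_pXn2r ?nnegrE.
Qed.

(** A half-open interval is a difference of two rays; finiteness on rays gives
a meaning to the difference of their measures. *)
Lemma eq_measure_rays (m1 m2 : {measure set mR -> \bar R}) :
  (forall b : R, m1 `]-oo, b]%classic = m2 `]-oo, b]%classic) ->
  (forall b : R, m1 `]-oo, b]%classic < +oo) ->
  forall A, measurable A -> m1 A = m2 A.
Proof.
move=> m12 moo.
have E (m : {measure set mR -> \bar R}) (a b : R) : (a <= b)%R ->
    m `]-oo, b]%classic < +oo ->
    m `]a, b]%classic = m `]-oo, b]%classic - m `]-oo, a]%classic.
  move=> ab mo; rewrite (_ : `]a, b]%classic = `]-oo, b] `\` `]-oo, a]); last first.
    apply/seteqP; split => x /=; rewrite !in_itv/=.
      by move=> /andP[h1 ->]; split => //; apply/negP; rewrite -ltNge.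
    by move=> [-> /negP]; rewrite -ltNge => ->.
  rewrite measureD//=.
  by rewrite setIidr//; apply: subset_itvl; rewrite bnd_simp.
pose g k : set R := `](- k%:R)%R, k%:R]%classic.
move=> A mA; apply: (@measure_unique _ R mR (@ocitv R) g) => //.
- exact: ocitvI.
- by move=> k; exact: is_ocitv.
- apply/seteqP; split => // x _; exists (Num.bound `|x : R|) => //=.
  have /andP[x1 x2] : (- (Num.bound `|x : R|)%:R < x < (Num.bound `|x : R|)%:R)%R.
    by rewrite -ltr_norml; exact: archi_boundP.
  by rewrite /g /= in_itv/= x1 ltW.
- move=> B /ocitvP[->|[[a b]] /= ab ->]; first by rewrite !measure0.
  by rewrite !E ?m12 -?m12 ?moo ?ltW.
- move=> k; rewrite E ?moo//; last by rewrite (@le_trans _ _ 0%R) ?oppr_le0.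
  rewrite lte_add_pinfty ?moo// lteNl/= -[ltLHS]/(-oo); apply: (@lt_le_trans _ _ 0).
    by rewrite ltNyr.
  exact: measure_ge0.
Qed.

Lemma lebesgue_rV_enorm0 n : (0 < n)%N ->
  lebesgue_rV n [set x : 'rV[R]_n | (enorm x <= 0)%R] = 0.
Proof.
case: n => // n _.
rewrite (_ : [set x | _] = [set x : 'rV[R]_n.+1 | forall i, [set 0%R] (x ord0 i)]).
  rewrite (lebesgue_rV_box (A := fun=> [set 0%R]))//.
  by rewrite big_ord_recl lebesgue_measure_set1 mul0e.
apply/seteqP; split => x /=.
  move=> x0 i; apply/eqP; rewrite -normr_le0.
  exact: (le_trans (le_coord_enorm x i)).
move=> x0; rewrite /enorm big1 ?sqrtr0// => i _.
by rewrite x0 expr0n.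
Qed.

Lemma lebesgue_rV_ball_scale n (b : R) : (0 < b)%R ->
  lebesgue_rV n [set x : 'rV[R]_n | (enorm x <= b)%R] =
  (b ^+ n)%:E * lebesgue_rV n [set x : 'rV[R]_n | (enorm x <= 1)%R].
Proof.
move=> b0.
have mB c := @measurable_enorm_le n c.
rewrite -(@setIT _ [set x | (enorm x <= b)%R]) -integral_indic//.
rewrite (ge0_integral_scale_rV b0)//; last exact/measurable_EFinP.
congr (_ * _); rewrite -[in RHS](@setIT _ [set x | _]) -integral_indic//.
apply: eq_integral => x _; rewrite !indicE; congr (_%:R%:E); congr nat_of_bool.
apply/idP/idP => /set_mem /= h; apply/mem_set => /=; move: h;
  by rewrite enormZ gtr0_norm// -{2}[b]mulr1 ler_pM2l.
Qed.

(** The unit ball lies in the cube of half-width 1. *)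
Lemma lebesgue_rV_ball_lty n :
  lebesgue_rV n [set x : 'rV[R]_n | (enorm x <= 1)%R] < +oo.
Proof.
have mB c := @measurable_enorm_le n c.
have mA : measurable [set x : 'rV[R]_n | forall i, `[(-1)%R, 1%R]%classic (x ord0 i)].
  rewrite (_ : [set x | _] = \bigcap_(i in [set: 'I_n])
      ((fun x : 'rV[R]_n => x ord0 i) @^-1` `[(-1)%R, 1%R]%classic)); last first.
    by apply/seteqP; split => x /= + i => /(_ i); exact.
  apply: fin_bigcap_measurable => // i _; rewrite -[X in measurable X]setTI.
  exact: (measurable_rV_coord i measurableT (measurable_itv _)).
apply: (@le_lt_trans _ _ (lebesgue_rV n [set x : 'rV[R]_n | forall i, `[(-1)%R, 1%R]%classic (x ord0 i)])).
  apply: le_measure; rewrite ?inE//.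
  move=> x /= x1 i; rewrite in_itv/= -ler_norml.
  exact: (le_trans (le_coord_enorm x i)).
rewrite (lebesgue_rV_box (A := fun=> `[(-1)%R, 1%R]%classic))//.
rewrite ltey_eq; apply/orP; left.
apply: (big_ind (fun z : \bar R => z \is a fin_num)) => // [x y|i _]; first exact: fin_numM.
by rewrite lebesgue_measure_itv/= lte_fin; case: ifP.
Qed.

Lemma lebesgue_rV_ball_gt0 n :
  0 < lebesgue_rV n [set x : 'rV[R]_n | (enorm x <= 1)%R].
Proof.
have mB c := @measurable_enorm_le n c.
(* the cube of half-width 1 / (n + 1) lies in the unit ball *)
pose h : R := (n.+1%:R)^-1%R.
have h0 : (0 < h)%R by rewrite invr_gt0.
have mA : measurable [set x : 'rV[R]_n | forall i, `[(- h)%R, h]%classic (x ord0 i)].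
  rewrite (_ : [set x | _] = \bigcap_(i in [set: 'I_n])
      ((fun x : 'rV[R]_n => x ord0 i) @^-1` `[(- h)%R, h]%classic)); last first.
    by apply/seteqP; split => x /= + i => /(_ i); exact.
  apply: fin_bigcap_measurable => // i _; rewrite -[X in measurable X]setTI.
  exact: (measurable_rV_coord i measurableT (measurable_itv _)).
apply: (@lt_le_trans _ _ (lebesgue_rV n [set x : 'rV[R]_n | forall i, `[(- h)%R, h]%classic (x ord0 i)])); last first.
  apply: le_measure; rewrite ?inE//.
  move=> x /= xh.
  have : (enorm x ^+ 2 <= n%:R * h ^+ 2)%R.
    by apply: enorm_le => [|i]; [exact: ltW|rewrite ler_norml; have := xh i; rewrite in_itv].
  move=> hx; rewrite -(@ler_pXn2r _ 2)// ?nnegrE ?enorm_ge0// expr1n (le_trans hx)//.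
  rewrite /h exprVn ler_pdivrMr ?exprn_gt0// mul1r -natrX ler_nat.
  by rewrite -[X in (X <= _)%N]muln1 -mulnn leq_mul.
rewrite (lebesgue_rV_box (A := fun=> `[(- h)%R, h]%classic))//.
apply: (big_ind (fun z : \bar R => 0 < z)) => // [x y|i _]; first exact: mule_gt0.
rewrite lebesgue_measure_itv/= lte_fin gtrN// -EFinD lte_fin.
by rewrite subr_gt0 gtrN.
Qed.

Lemma is_derive1_continuous (F f : R -> R) :
  (forall x : R, is_derive x (1 : R)%R F (f x)) -> continuous F.
Proof.
by move=> dF x; apply/differentiable_continuous/derivable1_diffP; case: (dF x).
Qed.

Lemma FTC_global (F f : R -> R) (a b : R) : (a <= b)%R ->
  (forall x : R, is_derive x (1 : R)%R F (f x)) -> continuous f ->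
  \int[leb]_(x in `[a, b]) (f x)%:E = (F b - F a)%:E.
Proof.
move=> ab dF cf; move: ab; rewrite le_eqVlt => /predU1P[->|ab].
  by rewrite set_itv1 integral_set1 subrr.
have cF := is_derive1_continuous dF.
rewrite (@continuous_FTC2 _ f F)//.
- exact: continuous_subspaceT.
- split.
  + by move=> x _; case: (dF x).
  + exact: cvg_at_right_filter (cF a).
  + exact: cvg_at_left_filter (cF b).
- by move=> x _; rewrite derive1E; case: (dF x).
Qed.

Lemma is_derive1_exprn (f : R -> R) (n : nat) (x df : R) :
  is_derive x (1 : R)%R f df ->
  is_derive x (1 : R)%R (fun y => f y ^+ n)%R (n%:R * f x ^+ n.-1 * df)%R.
Proof.
move=> dfx; have := @is_deriveX R R f n x 1%R df dfx.
rewrite (_ : (f ^+ n)%R = (fun y => f y ^+ n)%R) //.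
by apply/funext => y; rewrite exprfctE.
Qed.

Lemma integral_power (n : nat) (b : R) : (0 <= b)%R -> (0 < n)%N ->
  \int[leb]_(x in `[0%R, b]) (n%:R * x ^+ n.-1)%:E = (b ^+ n)%:E.
Proof.
case: n => // n b0 _.
transitivity ((b ^+ n.+1 - 0 ^+ n.+1)%:E); last by rewrite expr0n subr0.
apply: (@FTC_global (fun x => x ^+ n.+1)%R (fun x => n.+1%:R * x ^+ n)%R) => //.
- move=> x; rewrite -[X in is_derive _ _ _ X]mulr1.
  exact: (@is_derive1_exprn id n.+1 x 1%R).
- move=> x; apply: cvgM; first exact: cvg_cst.
  exact: exprn_continuous.
Qed.

(** Power of the positive part: a weight defined on the whole line that vanishes
on the negative half-line when k > 0, so that integrals in r or z need no
restriction of the domain. *)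
Definition ppow (k : nat) (s : R) : R := (Num.max s 0 ^+ k)%R.

Lemma ppow_ge0 k s : (0 <= ppow k s)%R.
Proof. by rewrite exprn_ge0// le_max lexx orbT. Qed.

Lemma ppow0 k s : (0 < k)%N -> (s <= 0)%R -> ppow k s = 0%R.
Proof. by move=> k0 s0; rewrite /ppow (max_idPr s0) expr0n; case: k k0. Qed.

Lemma ppowE k s : (0 <= s)%R -> ppow k s = (s ^+ k)%R.
Proof. by move=> s0; rewrite /ppow (max_idPl s0). Qed.

Lemma ppowM k c s : (0 < c)%R -> ppow k (c * s) = (c ^+ k * ppow k s)%R.
Proof.
move=> c0; rewrite /ppow -exprMn; congr (_ ^+ _)%R.
by rewrite maxr_pMr ?mulr0// ltW.
Qed.

Lemma measurable_ppow k : measurable_fun setT (ppow k).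
Proof.
by apply: measurable_funX; apply: measurable_maxr.
Qed.

(** The law of the norm is determined by the measures of the balls. The ball of
radius b has b^n times the measure of the unit ball, so the density is a
multiple of n b^(n-1); the measure of the unit ball enters only through its
being finite and positive. *)
Lemma radial_law n : (1 < n)%N -> exists2 c : R, (0 < c)%R &
  forall g : mR -> \bar R, measurable_fun setT g ->
   (forall s, 0 <= g s) ->
   \int[lebesgue_rV n]_x g (enorm x) =
   c%:E * \int[leb]_s (g s * (ppow n.-1 s)%:E).
Proof.
move=> n1; pose B := [set x : 'rV[R]_n | (enorm x <= 1)%R].
pose V := fine (lebesgue_rV n B).
have VE : (lebesgue_rV n B) = V%:E.
  by rewrite fineK// ge0_fin_numE// lebesgue_rV_ball_lty.
have V0 : (0 < V)%R by rewrite -lte_fin -VE lebesgue_rV_ball_gt0.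
pose w s := (V * (n%:R * ppow n.-1 s))%R : R.
have w0 s : (0 <= w s)%R.
  by rewrite mulr_ge0 ?(ltW V0)// mulr_ge0// ppow_ge0.
have mw : measurable_fun setT w.
  apply: measurable_funM => //; apply: measurable_funM => //.
  exact: measurable_ppow.
have [m [mE mI]] := density_measure mw w0.
have men : measurable_fun setT (@enorm R n : 'rV[R]_n -> mR).
  exact: measurable_enorm.
pose nu : {measure set mR -> \bar R} :=
  measure_function_pushforward__canonical__measure_function_Measure (lebesgue_rV n) men.
have nuE b : nu `]-oo, b]%classic = lebesgue_rV n [set x : 'rV[R]_n | (enorm x <= b)%R].
  rewrite /nu /= /pushforward; congr (lebesgue_rV n _).
have w_neg s : (s <= 0)%R -> w s = 0%R.
  by move=> s0; rewrite /w ppow0 ?mulr0//; lia.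
have nu0 b : (b <= 0)%R -> nu `]-oo, b]%classic = 0.
  move=> b0; rewrite nuE; apply: (@subset_measure0 _ _ _ (lebesgue_rV n) _ [set x : 'rV[R]_n | (enorm x <= 0)%R]).
  - exact: measurable_enorm_le.
  - exact: measurable_enorm_le.
  - by move=> x /= /le_trans; apply.
  - exact/lebesgue_rV_enorm0/ltnW.
have nu1 b : (0 < b)%R -> nu `]-oo, b]%classic = (b ^+ n * V)%:E.
  by move=> b0; rewrite nuE lebesgue_rV_ball_scale// VE EFinM.
have num A : measurable A -> nu A = m A.
  apply: eq_measure_rays => b; last first.
    by have [/nu0 ->|/nu1 ->] := leP b 0%R; rewrite ltry.
  have [b0|b0] := leP b 0%R.
    rewrite nu0// mE//.
    rewrite integral0_eq// => x /=; rewrite in_itv/= => xb.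
    by rewrite w_neg// (le_trans xb).
  rewrite nu1// mE//.
  rewrite (_ : `]-oo, b]%classic = `]-oo, 0%R[ `|` `[0%R, b]); last first.
    apply/seteqP; split => x /=; rewrite !in_itv/=.
      by move=> ->; case: ltP => _; [left|right].
    by move=> [/ltW/le_trans|/andP[]//]; apply; exact: ltW.
  rewrite ge0_integral_setU//=; last first.
  - apply/disj_setPS => x /=; rewrite !in_itv/= => -[x0 /andP[]].
    by rewrite leNgt x0.
  - by move=> x _; rewrite lee_fin.
  - by apply/measurable_EFinP; exact: measurable_funTS.
  rewrite integral0_eq ?add0e; last first.
    by move=> x /=; rewrite in_itv/= => /ltW x0; rewrite w_neg.
  rewrite (eq_integral (fun x : mR => V%:E * (n%:R * (x : R) ^+ n.-1)%:E)); last first.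
    move=> x; rewrite inE/= in_itv/= => /andP[x0 _].
    by rewrite -EFinM /w ppowE.
  rewrite ge0_integralZl_EFin//; last first.
  - exact: ltW.
  - by apply/measurable_EFinP; apply: measurable_funM => //; exact: measurable_funX.
  - move=> x /=; rewrite in_itv/= => /andP[x0 _].
    by rewrite lee_fin mulr_ge0// exprn_ge0.
  by rewrite integral_power ?(ltW b0)// ?(ltnW n1)// -EFinM mulrC.
exists (V * n%:R)%R; first by rewrite mulr_gt0// ltr0n ltnW.
move=> g mg g0.
transitivity (\int[nu]_s g s).
  rewrite ge0_integral_pushforward//= preimage_setT//.
rewrite (eq_measure_integral m); last by move=> A mA _; exact: num.
rewrite mI//.
rewrite -ge0_integralZl_EFin//.
- by apply: eq_integral => s _; rewrite /w mulrA EFinM muleCA.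
- by move=> x _; rewrite mule_ge0// lee_fin ppow_ge0.
- by apply: emeasurable_funM => //; apply/measurable_EFinP; exact: measurable_ppow.
- by rewrite mulr_ge0// ltW.
Qed.

End radial.

(** * Integration in the coordinates r = |x| and z = t / s *)

Section polar.
Context {R : realType}.
Local Notation leb := (@lebesgue_measure R).
Local Notation mR := (measurableTypeR R).

Lemma measurable_invr : measurable_fun setT (fun x : R => x^-1).
Proof.
rewrite (_ : (fun x : R => x^-1) = (fun x => x * (x ^+ 2) `^ (-1))); last first.
  apply/funext => x; rewrite powR_inv1 ?sqr_ge0//.
  have [->|x0] := eqVneq x 0; first by rewrite invr0 mul0r.
  by rewrite expr2 invfM mulrA divff// mul1r.
apply: measurable_funM => //.
apply: (measurableT_comp (f := fun y : R => y `^ (-1))).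
  exact: measurable_powR.
exact: measurable_funX.
Qed.

Lemma measurable_sqrt : measurable_fun setT (@Num.sqrt R).
Proof. by apply: continuous_measurable_fun; exact: sqrt_continuous. Qed.

Lemma enorm_row_mx m n (x : 'rV[R]_m) (y : 'rV[R]_n) :
  enorm (row_mx x y) = Num.sqrt (enorm x ^+ 2 + enorm y ^+ 2).
Proof.
rewrite !enorm_sqr /enorm big_split_ord/=; congr (Num.sqrt (_ + _)).
  by apply: eq_bigr => i _; rewrite row_mxEl.
by apply: eq_bigr => i _; rewrite row_mxEr.
Qed.

Lemma measurable_enorm_rows m n (f : 'I_n -> 'I_m) :
  measurable_fun setT (fun x : 'rV[R]_m => enorm (\row_i x ord0 (f i))).
Proof.
apply: (measurableT_comp (@measurable_enorm R n)).
apply: measurable_fun_rVP => i; under eq_fun do rewrite mxE.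
exact: measurable_rV_coord.
Qed.

Lemma measurable_t_coord n : measurable_fun setT (@t_coord R n).
Proof.
rewrite (_ : @t_coord R n = fun x : 'rV[R]_(n + n) => enorm (\row_i x ord0 (rshift n i))).
  exact: measurable_enorm_rows.
apply/funext => x; rewrite /t_coord; congr enorm; apply/rowP => i.
by rewrite !mxE.
Qed.

Lemma measurable_s_coord n : measurable_fun setT (@s_coord R n).
Proof.
rewrite (_ : @s_coord R n = fun x : 'rV[R]_(n + n) => enorm (\row_i x ord0 (lshift n i))).
  exact: measurable_enorm_rows.
apply/funext => x; rewrite /s_coord; congr enorm; apply/rowP => i.
by rewrite !mxE.
Qed.

(** With z = tan theta, [zweight n z] dz is the measure
cos^(n-1) theta sin^(n-1) theta dtheta. *)
Definition zweight (n : nat) (z : R) : R := ppow n.-1 z / (1 + z ^+ 2) ^+ n.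

Lemma zweight_ge0 n z : 0 <= zweight n z.
Proof. by rewrite divr_ge0 ?ppow_ge0// exprn_ge0// addr_ge0// sqr_ge0. Qed.

Lemma measurable_zweight n : measurable_fun setT (zweight n).
Proof.
apply: measurable_funM; first exact: measurable_ppow.
apply: (measurableT_comp measurable_invr).
by apply: measurable_funX; apply: measurable_funD => //; exact: measurable_funX.
Qed.

Lemma ppow_merge n (s Z : R) : (1 < n)%N -> 0 < s ->
  s * ppow n.-1 s * (s ^+ n.-1 * Z) = ppow (n + n).-1 s * Z.
Proof.
move=> n1 s0; rewrite !ppowE ?(ltW s0)// !mulrA; congr (_ * _).
by rewrite -exprS -exprD; congr (_ ^+ _); lia.
Qed.

Local Open Scope ereal_scope.

(** Applying [radial_law] in each factor leaves s^(n-1) t^(n-1) ds dt on the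
quarter plane. The changes of variables t = s z for fixed s, then
s = r / sqrt (1 + z^2) for fixed z, are dilations of the line. *)
Lemma polar_formula n : (1 < n)%N -> exists2 C : R, (0 < C)%R &
  forall g : mR -> mR -> \bar R,
   measurable_fun setT (fun p : mR * mR => g p.1 p.2) ->
   (forall r z, 0 <= g r z) ->
   \int[lebesgue_rV (n + n)]_x g (enorm x) (t_coord x / s_coord x)%R =
   C%:E * \int[leb]_r \int[leb]_z
      (g r z * (ppow (n + n).-1 r * zweight n z)%:E).
Proof.
move=> n1; have [c c0 cE] := @radial_law R n n1.
exists (c * c)%R; first exact: mulr_gt0.
move=> g mg g0.
pose h (s t : mR) : \bar R := g (Num.sqrt (s ^+ 2 + t ^+ 2))%R (t / s)%R.
have mh : measurable_fun setT (fun p : mR * mR => h p.1 p.2).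
  apply: (measurableT_comp (f := fun p : mR * mR => g p.1 p.2)
    (g := fun p : mR * mR => ((Num.sqrt (p.1 ^+ 2 + p.2 ^+ 2))%R : mR, (p.2 / p.1)%R : mR))) => //.
  apply/measurable_fun_pairP; split => /=.
    apply: (measurableT_comp measurable_sqrt).
    by apply: measurable_funD; apply: measurable_funX; [exact: measurable_fst|exact: measurable_snd].
  apply: measurable_funM; first exact: measurable_snd.
  apply: (measurableT_comp measurable_invr); exact: measurable_fst.
have h0 s t : 0 <= h s t by exact: g0.
have measurable_rz : measurable_fun setT
    (fun x : 'rV[R]_(n + n) => g (enorm x) (t_coord x / s_coord x)%R).
  apply: (measurableT_comp (f := fun p : mR * mR => g p.1 p.2)
    (g := fun x : 'rV[R]_(n + n) => ((enorm x) : mR, (t_coord x / s_coord x)%R : mR))) => //.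
  apply/measurable_fun_pairP; split => /=; first exact: measurable_enorm.
  apply: measurable_funM; first exact: measurable_t_coord.
  exact: (measurableT_comp measurable_invr (@measurable_s_coord n)).
transitivity (\int[lebesgue_rV n]_x \int[lebesgue_rV n]_y h (enorm x) (enorm y)).
  rewrite (ge0_integral_rVD measurable_rz); last by move=> x; exact: g0.
  apply: eq_integral => x _; apply: eq_integral => y _.
  by rewrite enorm_row_mx /t_coord /s_coord row_mxKl row_mxKr.
have mh1 s : measurable_fun setT (h s).
  exact: (measurableT_comp mh (measurable_pair1 s)).
have mhp s : measurable_fun setT (fun t : mR => h s t * (ppow n.-1 t)%:E).
  by apply: emeasurable_funM => //; apply/measurable_EFinP; exact: measurable_ppow.
under eq_integral do rewrite cE//.
have mF : measurable_fun setT (fun s : mR => \int[leb]_t (h s t * (ppow n.-1 t)%:E)).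
  apply: (measurable_fun_fubini_tonelli_F (fun p : mR * mR => h p.1 p.2 * (ppow n.-1 p.2)%:E)).
    apply: emeasurable_funM => //; apply/measurable_EFinP.
    by apply: (measurableT_comp (measurable_ppow _)); exact: measurable_snd.
  by move=> p; rewrite mule_ge0// lee_fin ppow_ge0.
have F0 s : 0 <= \int[leb]_t (h s t * (ppow n.-1 t)%:E).
  by apply: integral_ge0 => t _; rewrite mule_ge0// lee_fin ppow_ge0.
rewrite (cE (fun s => c%:E * \int[leb]_t (h s t * (ppow n.-1 t)%:E))); last 2 first.
- exact: measurable_funeM.
- by move=> s; rewrite mule_ge0// lee_fin ltW.
under eq_integral do rewrite -muleA.
rewrite ge0_integralZl_EFin//; last 3 first.
- by move=> s _; rewrite mule_ge0// lee_fin ppow_ge0.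
- by apply: emeasurable_funM => //; apply/measurable_EFinP; exact: measurable_ppow.
- exact: ltW.
rewrite muleA -EFinM; congr (_ * _).
(* t = s z *)
transitivity (\int[leb]_s \int[leb]_z
   (g (s * Num.sqrt (1 + z ^+ 2))%R z * (ppow (n + n).-1 s * ppow n.-1 z)%:E)).
  apply: eq_integral => s _.
  have [s0|s0] := leP s 0%R.
    rewrite (ppow0 _ s0) ?mule0; last by lia.
    rewrite integral0_eq// => z _; rewrite ppow0 ?mul0r ?mule0//; lia.
  rewrite (@ge0_integral_scale R s); last 3 first.
  - exact: s0.
  - exact: mhp.
  - by move=> t; rewrite mule_ge0// lee_fin ppow_ge0.
  rewrite muleAC -EFinM -ge0_integralZl_EFin//; last 3 first.
  - by move=> z _; rewrite mule_ge0// lee_fin ppow_ge0.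
  - apply: (@measurableT_comp _ _ _ _ _ _ (fun t : mR => h s t * (ppow n.-1 t)%:E) _ (fun z : mR => (s * z)%R : mR)).
      exact: mhp.
    exact: mulrl_measurable.
  - by rewrite mulr_ge0// ?ppow_ge0// ltW.
  apply: eq_integral => z _; rewrite ppowM// /h muleCA -EFinM; congr (_ * _%:E).
    congr (g _ _).
      rewrite exprMn -[X in (X + _)%R]mulr1 -mulrDr sqrtrM ?sqr_ge0// sqrtr_sqr.
      by rewrite gtr0_norm.
    by rewrite mulrAC divff ?gt_eqF// mul1r.
  exact: ppow_merge.
have mfstR : measurable_fun setT (fun p : mR * mR => p.1 : R) by exact: measurable_fst.
have msndR : measurable_fun setT (fun p : mR * mR => p.2 : R) by exact: measurable_snd.
have mG1 : measurable_fun setT (fun p : mR * mR => g (p.1 * Num.sqrt (1 + p.2 ^+ 2))%R p.2 * (ppow (n + n).-1 p.1 * ppow n.-1 p.2)%:E).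
  apply: emeasurable_funM.
    apply: (measurableT_comp (f := fun p : mR * mR => g p.1 p.2)
      (g := fun p : mR * mR => ((p.1 * Num.sqrt (1 + p.2 ^+ 2))%R : mR, p.2))) => //.
    apply/measurable_fun_pairP; split => //=.
    apply: measurable_funM => //; apply: (measurableT_comp measurable_sqrt).
    by apply: measurable_funD => //; exact: measurable_funX.
  apply/measurable_EFinP; apply: measurable_funM.
    exact: (measurableT_comp (measurable_ppow _) mfstR).
  exact: (measurableT_comp (measurable_ppow _) msndR).
have mG2 : measurable_fun setT (fun p : mR * mR => g p.1 p.2 * (ppow (n + n).-1 p.1 * zweight n p.2)%:E).
  apply: emeasurable_funM => //; apply/measurable_EFinP; apply: measurable_funM.
    exact: (measurableT_comp (measurable_ppow _) mfstR).
  exact: (measurableT_comp (measurable_zweight _) msndR).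
rewrite (fubini_tonelli (fun p : mR * mR => g (p.1 * Num.sqrt (1 + p.2 ^+ 2))%R p.2 * (ppow (n + n).-1 p.1 * ppow n.-1 p.2)%:E) mG1)/=; last first.
  by move=> p; rewrite mule_ge0// lee_fin mulr_ge0// ppow_ge0.
rewrite (fubini_tonelli (fun p : mR * mR => g p.1 p.2 * (ppow (n + n).-1 p.1 * zweight n p.2)%:E) mG2)/=; last first.
  by move=> p; rewrite mule_ge0// lee_fin mulr_ge0// ?zweight_ge0// ppow_ge0.
apply: eq_integral => z _.
(* r = k s *)
set k := Num.sqrt (1 + z ^+ 2).
have k2 : (k ^+ 2 = 1 + z ^+ 2)%R by rewrite sqr_sqrtr// addr_ge0// sqr_ge0.
have k0 : (0 < k)%R by rewrite sqrtr_gt0 ltr_pwDl// sqr_ge0.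
rewrite [RHS](@ge0_integral_scale R k)//; last 2 first.
- exact: (measurableT_comp mG2 (measurable_pair2 z)).
- by move=> r; rewrite mule_ge0// lee_fin mulr_ge0// ?zweight_ge0// ppow_ge0.
rewrite -ge0_integralZl_EFin//; last 3 first.
- by move=> r _; rewrite mule_ge0// lee_fin mulr_ge0// ?zweight_ge0// ppow_ge0.
- apply: (@measurableT_comp _ _ _ _ _ _ (fun r : mR => g r z * (ppow (n + n).-1 r * zweight n z)%:E) _ (fun r : mR => (k * r)%R : mR)).
    exact: (measurableT_comp mG2 (measurable_pair2 z)).
  exact: mulrl_measurable.
- exact: ltW.
apply: eq_integral => s _; rewrite muleCA -EFinM mulrC; congr (_ * _%:E).
rewrite ppowM// /zweight -k2 -exprM.
have -> : (k * (k ^+ (n + n).-1 * ppow (n + n).-1 s * (ppow n.-1 z / k ^+ (2 * n))) =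
  (k * k ^+ (n + n).-1) / k ^+ (2 * n) * (ppow (n + n).-1 s * ppow n.-1 z))%R by ring.
rewrite -exprS (_ : (n + n).-1.+1 = 2 * n)%N; last lia.
by rewrite divff ?mul1r// expf_neq0// gt_eqF.
Qed.

End polar.

(** * One-dimensional sup bounds with weights *)

Section strip.
Context {R : realType}.
Local Notation leb := (@lebesgue_measure R).
Local Notation mR := (measurableTypeR R).
Local Open Scope ereal_scope.

Lemma tonelliX (A B : set mR) (f : mR * mR -> \bar R) :
  measurable A -> measurable B -> measurable_fun setT f -> (forall p, 0 <= f p) ->
  \int[leb \x leb]_(p in A `*` B) f p =
    \int[leb]_(r in A) \int[leb]_(z in B) f (r, z) /\
  \int[leb \x leb]_(p in A `*` B) f p =
    \int[leb]_(z in B) \int[leb]_(r in A) f (r, z).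
Proof.
move=> mA mB mf f0.
have mAB : measurable (A `*` B) by exact: measurableX.
have mfAB : measurable_fun setT (f \_ (A `*` B)).
  by apply/(measurable_restrictT _ _).1 => //; exact: measurable_funTS.
have f0AB p : 0 <= (f \_ (A `*` B)) p by exact: erestrict_ge0.
rewrite integral_mkcond; split.
  rewrite (fubini_tonelli1 _ mfAB f0AB) [RHS]integral_mkcond; apply: eq_integral => r _.
  rewrite /fubini_F [RHS]patchE; case: ifPn => rA; last first.
    rewrite integral0_eq// => z _; rewrite patchE; case: ifPn => //.
    by rewrite inE => -[/= Ar _]; rewrite notin_setE in rA.
  rewrite [RHS]integral_mkcond; apply: eq_integral => z _; rewrite !patchE.
  rewrite (_ : ((r, z) \in A `*` B) = (z \in B))//.
  apply/idP/idP => [/set_mem[] _ ?|h]; first exact/mem_set.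
  by apply/mem_set; split => /=; exact/set_mem.
rewrite (fubini_tonelli2 _ mfAB f0AB) [RHS]integral_mkcond; apply: eq_integral => z _.
rewrite /fubini_G [RHS]patchE; case: ifPn => zB; last first.
  rewrite integral0_eq// => r _; rewrite patchE; case: ifPn => //.
  by rewrite inE => -[/= _ Bz]; rewrite notin_setE in zB.
rewrite [RHS]integral_mkcond; apply: eq_integral => r _; rewrite !patchE.
rewrite (_ : ((r, z) \in A `*` B) = (r \in A))//.
apply/idP/idP => [/set_mem[] ? _|h]; first exact/mem_set.
by apply/mem_set; split => /=; exact/set_mem.
Qed.

Lemma FTC_abs (F f : R -> R) (a b : R) : (a <= b)%R ->
  (forall x : R, is_derive x (1 : R)%R F (f x)) -> continuous f ->
  `|F b - F a|%:E <= \int[leb]_(x in `[a, b]) `|f x|%:E.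
Proof.
move=> ab dF cf; rewrite -abse_EFin -(FTC_global ab dF cf).
apply: le_abse_integral; first exact: measurable_itv.
by apply/measurable_EFinP; apply: measurable_funTS; exact: continuous_measurable_fun.
Qed.

(** What the estimates use of a test function written in the coordinates (r, z):
[dr] and [dz] are its partial derivatives, and it vanishes for r near 0 and
near 1, which supplies boundary values for one-dimensional estimates in r. *)
Record profile (psi dr dz : R -> R -> R) : Prop := Profile {
  profile_m : measurable_fun setT (fun p : mR * mR => psi p.1 p.2 : R) ;
  profile_mr : measurable_fun setT (fun p : mR * mR => dr p.1 p.2 : R) ;
  profile_mz : measurable_fun setT (fun p : mR * mR => dz p.1 p.2 : R) ;
  profile_dr : forall r z : R, is_derive r (1 : R)%R (psi^~ z) (dr r z) ;
  profile_dz : forall r z : R, is_derive z (1 : R)%R (psi r) (dz r z) ;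
  profile_cr : forall z, continuous (dr^~ z) ;
  profile_cz : forall r, continuous (dz r) ;
  profile_supp : exists2 d : R, (0 < d)%R &
     forall r z : R, (0 <= r)%R -> (r <= d)%R || (1 - d <= r)%R -> psi r z = 0%R }.

Lemma is_derive1_pow (F f : R -> R) (q : nat) :
  (forall x : R, is_derive x (1 : R)%R F (f x)) -> continuous f ->
  (forall x : R, is_derive x (1 : R)%R (fun x => F x ^+ q)%R (q%:R * F x ^+ q.-1 * f x)%R) /\
  continuous (fun x => q%:R * F x ^+ q.-1 * f x)%R.
Proof.
move=> dF cf; split=> x; first exact: is_derive1_exprn.
apply: cvgM; last exact: cf.
apply: cvgM; first exact: cvg_cst.
apply: (@continuous_comp _ _ _ F (fun y => y ^+ q.-1)%R); last exact: exprn_continuous.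
exact: (is_derive1_continuous dF).
Qed.

Variables (psi dr dz : R -> R -> R).
Hypothesis P : profile psi dr dz.

Lemma powR_interval_le (a r rho : R) : (0 < r)%R -> (0 < rho)%R ->
  ((0 <= a) && (r <= rho) || (a <= 0) && (rho <= r))%R -> (r `^ a <= rho `^ a)%R.
Proof.
move=> r0 rho0 /orP[/andP[a0 rr]|/andP[a0 rr]].
  by apply: (ge0_ler_powR a0) => //; rewrite nnegrE ltW.
rewrite -[a]opprK !(powRN _ (- a)%R) lef_pV2 ?posrE ?powR_gt0//.
by apply: ge0_ler_powR; rewrite ?oppr_ge0// nnegrE ltW.
Qed.

(** Integrate the derivative of psi^q from r in the direction in which s^a grows:
towards 1 if a >= 0, towards 0 if a < 0. On the way s^a is at least r^a, so the
weight may be put under the integral, and psi vanishes at the far end. *)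
Lemma sup_bound_r (q : nat) (a r z : R) : (0 < q)%N -> (0 < r < 1)%R ->
  (r `^ a * `|psi r z| ^+ q)%:E <=
  \int[leb]_(s in `]0%R, 1%R[) (s `^ a * (q%:R * `|psi s z| ^+ q.-1 * `|dr s z|))%:E.
Proof.
move=> q0 /andP[r0 r1].
have [d d0 supp] := profile_supp P.
have [dF cf] := is_derive1_pow q (fun r => profile_dr P r z) (@profile_cr _ _ _ P z).
have [mp md] : measurable_fun setT (psi^~ z : mR -> R) /\ measurable_fun setT (dr^~ z : mR -> R).
  split.
    exact: (measurableT_comp (profile_m P) (measurable_pair2 z)).
  exact: (measurableT_comp (profile_mr P) (measurable_pair2 z)).
have mf : measurable_fun setT (fun s : mR => (s `^ a * (q%:R * `|psi s z| ^+ q.-1 * `|dr s z|))%:E).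
  apply/measurable_EFinP; apply: measurable_funM; first exact: measurable_powR.
  apply: measurable_funM; last exact: measurableT_comp.
  by apply: measurable_funM => //; apply: measurable_funX; exact: measurableT_comp.
(* of the ends of [x, y], one is r, where s^a is minimal, and psi vanishes at the other *)
have key (x y : R) : (x <= y)%R -> (0 < x)%R -> (y < 1)%R ->
   ((0 <= a) && (r == x) || (a <= 0) && (r == y))%R ->
   (psi x z ^+ q = 0 \/ psi y z ^+ q = 0)%R ->
   (r `^ a * `|psi r z| ^+ q)%:E <=
  \int[leb]_(s in `]0%R, 1%R[) (s `^ a * (q%:R * `|psi s z| ^+ q.-1 * `|dr s z|))%:E.
  move=> xy x0 y1 ar xy0.
  have e : (`|psi r z| ^+ q)%:E <= \int[leb]_(s in `[x, y]) (q%:R * `|psi s z| ^+ q.-1 * `|dr s z|)%:E.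
    apply: (le_trans _ (le_trans (FTC_abs xy dF cf) _)).
      rewrite lee_fin -normrX; move: ar xy0 => /orP[]/andP[_ /eqP ->] [h|h].
      - by rewrite h normr0.
      - by rewrite h sub0r normrN.
      - by rewrite h subr0.
      - by rewrite h normr0.
    rewrite le_eqVlt; apply/orP; left; apply/eqP; apply: eq_integral => s _.
    by rewrite !normrM normrX normr_nat.
  rewrite EFinM; apply: (le_trans (lee_wpmul2l _ e)); first by rewrite lee_fin powR_ge0.
  rewrite -ge0_integralZl_EFin//; last first.
  - exact: powR_ge0.
  - apply/measurable_EFinP/measurable_funTS.
    apply: measurable_funM; last exact: measurableT_comp.
    by apply: measurable_funM => //; apply: measurable_funX; exact: measurableT_comp.
  have xy01 s : s \in `[x, y] -> (0 < s < 1)%R.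
    by rewrite in_itv/= => /andP[xs sy]; rewrite (lt_le_trans x0)// (le_lt_trans sy).
  apply: (@le_trans _ _ (\int[leb]_(s in `[x, y]) (s `^ a * (q%:R * `|psi s z| ^+ q.-1 * `|dr s z|))%:E)).
    apply: ge0_le_integral => //.
    - by move=> s _; rewrite -EFinM lee_fin !mulr_ge0// ?powR_ge0// exprn_ge0.
    - apply: measurable_funeM; apply/measurable_EFinP/measurable_funTS.
      apply: measurable_funM; last exact: measurableT_comp.
      by apply: measurable_funM => //; apply: measurable_funX; exact: measurableT_comp.
    - exact: measurable_funTS.
    - move=> s /= sxy; rewrite -EFinM lee_fin ler_wpM2r// ?mulr_ge0 ?exprn_ge0//.
      have /andP[s0 s1] := xy01 _ sxy.
      apply: powR_interval_le => //; move: sxy; rewrite in_itv/= => /andP[xs sy].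
      by move: ar => /orP[]/andP[-> /eqP ->]; rewrite ?xs ?sy ?orbT.
  apply: ge0_subset_integral => //.
  - exact: measurable_funTS.
  - by move=> s _; rewrite lee_fin !mulr_ge0// ?powR_ge0// exprn_ge0.
have [a0|a0] := leP 0%R a.
  apply: (key r (Num.max r (1 - d)%R)) => //.
  - by rewrite le_max lexx.
  - by rewrite gt_max r1 gtrBl.
  - by rewrite a0 eqxx.
  - right; rewrite supp ?expr0n ?gtn_eqF//; first by rewrite le_max ltW.
    by rewrite le_max lexx !orbT.
apply: (key (Num.min r d) r) => //.
- by rewrite ge_min lexx.
- by rewrite lt_min r0.
- by rewrite (ltW a0) eqxx orbT.
- left; rewrite supp ?expr0n ?gtn_eqF//; first by rewrite le_min !ltW.
  by rewrite ge_min lexx !orbT.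
Qed.

(** There is no boundary value in z: the value at z is compared with the average
over the interval, whose length 1/2 gives the factor 2. *)
Lemma sup_bound_z (q : nat) (r z : R) : z \in `[2^-1%R, 1%R] ->
  (`|psi r z| ^+ q)%:E <=
  \int[leb]_(s in `[2^-1%R, 1%R])
     (2 * `|psi r s| ^+ q + q%:R * `|psi r s| ^+ q.-1 * `|dz r s|)%:E.
Proof.
move=> zI.
have [dF cf] := is_derive1_pow q (profile_dz P r) (@profile_cz _ _ _ P r).
have [mp md] : measurable_fun setT (psi r : mR -> R) /\ measurable_fun setT (dz r : mR -> R).
  split.
    exact: (measurableT_comp (profile_m P) (measurable_pair1 r)).
  exact: (measurableT_comp (profile_mz P) (measurable_pair1 r)).
pose f s := (q%:R * `|psi r s| ^+ q.-1 * `|dz r s|)%R.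
have f0 s : (0 <= f s)%R by rewrite !mulr_ge0// exprn_ge0.
have mf : measurable_fun setT (f : mR -> R).
  apply: measurable_funM; last exact: measurableT_comp.
  by apply: measurable_funM => //; apply: measurable_funX; exact: measurableT_comp.
have mpq : measurable_fun setT (fun s : mR => (`|psi r s| ^+ q)%R).
  by apply: measurable_funX; exact: measurableT_comp.
pose I := \int[leb]_(s in `[2^-1%R, 1%R]) (f s)%:E.
have fE : I = \int[leb]_(s in `[2^-1%R, 1%R]) `|q%:R * psi r s ^+ q.-1 * dz r s|%:E.
  by apply: eq_integral => s _; rewrite /f !normrM normrX normr_nat.
have I0 : 0 <= I by apply: integral_ge0 => s _; rewrite lee_fin.
have key (x y : R) : (x <= y)%R -> (2^-1 <= x)%R -> (y <= 1)%R ->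
   `|psi r y ^+ q - psi r x ^+ q|%:E <= I.
  move=> xy x2 y1; apply: (le_trans (FTC_abs xy dF cf)); rewrite fE.
  apply: ge0_subset_integral => //.
  - apply/measurable_EFinP/measurable_funTS/measurableT_comp => //.
    exact: continuous_measurable_fun.
  - by move=> s; rewrite /= !in_itv/= => /andP[xs sy]; rewrite (le_trans x2)//= (le_trans sy).
have key2 s : s \in `[2^-1%R, 1%R] -> (`|psi r z| ^+ q)%:E <= (`|psi r s| ^+ q)%:E + I.
  move=> sI.
  have h : `|psi r z ^+ q - psi r s ^+ q|%:E <= I.
    move: zI sI; rewrite !in_itv/= => /andP[? ?] /andP[? ?].
    have [zs|/ltW sz] := leP z s; last exact: key.
    by rewrite distrC; exact: key.
  apply: (le_trans _ (leeD2l _ h)); rewrite -EFinD lee_fin -!normrX.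
  by rewrite -lerBlDl lerB_dist.
have l2 : leb `[2^-1%R, 1%R] = (2^-1)%:E.
  rewrite lebesgue_measure_itv/= lte_fin invf_lt1 ?ltr1n// -EFinD /=.
  by congr (_%:E); lra.
have key3 : (`|psi r z| ^+ q)%:E * (2^-1)%:E <= \int[leb]_(s in `[2^-1%R, 1%R]) (`|psi r s| ^+ q)%:E + I * (2^-1)%:E.
  rewrite -l2 -!integral_cst// -ge0_integralD//; last first.
  - by apply/measurable_EFinP/measurable_funTS.
  apply: ge0_le_integral => //.
  - by move=> s _ /=; rewrite lee_fin exprn_ge0.
  - apply: emeasurable_funD => //; exact/measurable_EFinP/measurable_funTS.
have -> : (`|psi r z| ^+ q)%:E = 2%:E * ((`|psi r z| ^+ q)%:E * (2^-1)%:E).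
  by rewrite -!EFinM mulrCA divff// mulr1.
apply: (le_trans (lee_wpmul2l _ key3)); first by rewrite lee_fin.
rewrite ge0_muleDr; last 2 first.
- by apply: integral_ge0 => s _; rewrite lee_fin exprn_ge0.
- by rewrite mule_ge0// lee_fin.
rewrite -ge0_integralZl_EFin//; last by apply/measurable_EFinP/measurable_funTS.
rewrite muleCA -EFinM divff// mule1 -ge0_integralD//.
- by apply: measurable_funeM; apply/measurable_EFinP/measurable_funTS.
- by move=> s _; rewrite lee_fin.
- by apply/measurable_EFinP/measurable_funTS.
Qed.

End strip.

(** * Moments on the strip 1/2 <= z <= 1 *)

Section gn.
Context {R : realType}.
Local Notation leb := (@lebesgue_measure R).
Local Notation mR := (measurableTypeR R).
Local Notation m2 := (leb \x leb)%E.
Local Open Scope ereal_scope.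

Lemma measurable_fstR : measurable_fun setT (fun p : mR * mR => p.1 : R).
Proof. exact: measurable_fst. Qed.

Lemma measurable_fst_powR b :
  measurable_fun setT (fun p : mR * mR => ((p.1 : R) `^ b)%R).
Proof.
apply: (measurableT_comp (f := fun y : R => (y `^ b)%R)).
  exact: measurable_powR.
exact: measurable_fstR.
Qed.

Lemma measurable_tonelliX1 (B : set mR) (f : mR * mR -> \bar R) :
  measurable B -> measurable_fun setT f -> (forall p, 0 <= f p) ->
  measurable_fun setT (fun r => \int[leb]_(z in B) f (r, z)).
Proof.
move=> mB mf f0.
have mfB : measurable_fun setT (f \_ (setT `*` B)).
  apply/(measurable_restrictT _ _).1; first exact: measurableX.
  exact: measurable_funTS.
have := @measurable_fun_fubini_tonelli_F _ _ mR mR R leb _ mfB (fun p => erestrict_ge0 (fun p _ => f0 p) p).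
apply: eq_measurable_fun => r _; rewrite /fubini_F [RHS]integral_mkcond.
apply: eq_integral => z _; rewrite !patchE (_ : ((r, z) \in _) = (z \in B))//.
by apply/idP/idP => [/set_mem[] _ ?|h]; [exact/mem_set|apply/mem_set; split => //=; exact/set_mem].
Qed.

Lemma measurable_tonelliX2 (A : set mR) (f : mR * mR -> \bar R) :
  measurable A -> measurable_fun setT f -> (forall p, 0 <= f p) ->
  measurable_fun setT (fun z => \int[leb]_(r in A) f (r, z)).
Proof.
move=> mA mf f0.
have mfA : measurable_fun setT (f \_ (A `*` setT)).
  apply/(measurable_restrictT _ _).1; first exact: measurableX.
  exact: measurable_funTS.
have := @measurable_fun_fubini_tonelli_G _ _ mR mR R leb _ mfA (fun p => erestrict_ge0 (fun p _ => f0 p) p).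
apply: eq_measurable_fun => z _; rewrite /fubini_G [RHS]integral_mkcond.
apply: eq_integral => r _; rewrite !patchE (_ : ((r, z) \in _) = (r \in A))//.
by apply/idP/idP => [/set_mem[] ? _|h]; [exact/mem_set|apply/mem_set; split => //=; exact/set_mem].
Qed.

Definition strip : set (mR * mR) := `]0%R, 1%R[ `*` `[2^-1%R, 1%R].

Lemma measurable_strip : measurable strip.
Proof. by apply: measurableX; exact: (@measurable_itv R). Qed.

Variables (N alpha : R).
Hypothesis alpha2 : (2 <= alpha)%R.

(** The density of the H norm with respect to dr dz, up to bounded factors of z:
r^(N-1) comes from the volume element, and r^(N-3) from the additional factor
1 / r^2 of an angular derivative. *)
Definition energy_density (psi dr dz : R -> R -> R) (p : mR * mR) : R :=
  ((p.1 : R) `^ (N - 1) * dr p.1 p.2 ^+ 2 + (p.1 : R) `^ (N - 3) * dz p.1 p.2 ^+ 2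
   + (p.1 : R) `^ (N - 1 - alpha) * psi p.1 p.2 ^+ 2)%R.

Definition moment (psi : R -> R -> R) (q : nat) (b : R) : \bar R :=
  \int[m2]_(p in strip) ((p.1 : R) `^ b * `|psi p.1 p.2| ^+ (2 * q))%:E.

Definition strip_energy psi dr dz : \bar R :=
  \int[m2]_(p in strip) (energy_density psi dr dz p)%:E.

Section one_profile.
Variables (psi dr dz : R -> R -> R).
Hypothesis P : profile psi dr dz.

Lemma measurable_energy_density :
  measurable_fun setT (energy_density psi dr dz).
Proof.
have mp b : measurable_fun setT (fun p : mR * mR => (p.1 : R) `^ b)%R.
  exact: measurable_fst_powR.
by apply: measurable_funD; [apply: measurable_funD|]; apply: measurable_funM => //;
  apply: measurable_funX; [exact: profile_mr P|exact: profile_mz P|exact: profile_m P].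
Qed.

Lemma energy_density_ge0 p : (0 <= energy_density psi dr dz p)%R.
Proof. by rewrite !addr_ge0// mulr_ge0// ?powR_ge0// sqr_ge0. Qed.

Lemma measurable_moment_density q b :
  measurable_fun setT (fun p : mR * mR => (p.1 : R) `^ b * `|psi p.1 p.2| ^+ (2 * q))%R.
Proof.
apply: measurable_funM.
  exact: measurable_fst_powR.
by apply: measurable_funX; apply: measurableT_comp => //; exact: profile_m P.
Qed.

Lemma moment_density_ge0 q b (p : mR * mR) :
  (0 <= (p.1 : R) `^ b * `|psi p.1 p.2| ^+ (2 * q))%R.
Proof. by rewrite mulr_ge0// ?powR_ge0// exprn_ge0. Qed.

Lemma powR_half (r b : R) : ((r `^ (b / 2)) ^+ 2 = r `^ b)%R.
Proof.
rewrite -powR_mulrn ?powR_ge0// -powRrM; congr (_ `^ _)%R.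
by rewrite divfK.
Qed.

Lemma powR_halfD (r a b : R) : (0 < r)%R ->
  (r `^ ((a + b) / 2) = r `^ (a / 2) * r `^ (b / 2))%R.
Proof.
by move=> r0; rewrite mulrDl powRD ?(gt_eqF r0) ?implybT.
Qed.

(** Young's inequality, the power of r being split evenly between a moment of
lower order and the radial term of the energy. *)
Lemma bound_r q b (r z : R) : (0 < r)%R ->
  (r `^ ((b + (N - 1)) / 2) * (q%:R * `|psi r z| ^+ q.-1 * `|dr r z|) <=
   q%:R * (r `^ b * `|psi r z| ^+ (2 * q.-1) + energy_density psi dr dz (r, z)))%R.
Proof.
move=> r0; rewrite powR_halfD// /energy_density/=.
rewrite -(powR_half r b) -(powR_half r (N - 1)) mulnC exprM.
set u := (r `^ (b / 2))%R; set v := (r `^ ((N - 1) / 2))%R; set x := (`|psi r z| ^+ q.-1)%R.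
have e : (`|dr r z| ^+ 2 = dr r z ^+ 2)%R by rewrite real_normK ?num_real.
have h2 : (0 <= r `^ (N - 3) * dz r z ^+ 2)%R by rewrite mulr_ge0 ?powR_ge0 ?sqr_ge0.
have h3 : (0 <= r `^ (N - 1 - alpha) * psi r z ^+ 2)%R by rewrite mulr_ge0 ?powR_ge0 ?sqr_ge0.
have -> : (u * v * (q%:R * x * `|dr r z|) = q%:R * ((u * x) * (v * `|dr r z|)))%R by ring.
rewrite ler_wpM2l// -e -exprMn.
have := sqr_ge0 (u * x - v * `|dr r z|)%R.
have := sqr_ge0 (u * x)%R; have := sqr_ge0 (v * `|dr r z|)%R.
rewrite !exprMn -[(v ^+ 2 * _)%R]exprMn; nra.
Qed.

(** Young's inequality again. The term without derivative requires r^(N-3) psi^2,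
which the energy controls through r^(N-1-alpha) psi^2 because alpha >= 2 and
r < 1. *)
Lemma bound_z q b (r z : R) : (0 < q)%N -> (0 < r)%R -> (r < 1)%R ->
  (r `^ ((b + (N - 3)) / 2) * (2 * `|psi r z| ^+ q + q%:R * `|psi r z| ^+ q.-1 * `|dz r z|) <=
   (1 + q%:R) * (r `^ b * `|psi r z| ^+ (2 * q.-1) + energy_density psi dr dz (r, z)))%R.
Proof.
move=> q0 r0 r1; rewrite powR_halfD// /energy_density/=.
have : (r `^ (N - 3) <= r `^ (N - 1 - alpha))%R.
  have h : (N - 1 - alpha <= N - 3)%R by move: alpha2; lra.
  by apply: (ger_powR _ h); rewrite r0 ltW.
rewrite -(powR_half r b) -(powR_half r (N - 3)) mulnC exprM.
have qE : (`|psi r z| ^+ q = `|psi r z| * `|psi r z| ^+ q.-1)%R by rewrite -exprS prednK.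
rewrite qE.
set u := (r `^ (b / 2))%R; set v := (r `^ ((N - 3) / 2))%R; set x := (`|psi r z| ^+ q.-1)%R.
set w := (r `^ (N - 1 - alpha))%R => vw.
have e : (`|dz r z| ^+ 2 = dz r z ^+ 2)%R by rewrite real_normK ?num_real.
have e' : (`|psi r z| ^+ 2 = psi r z ^+ 2)%R by rewrite real_normK ?num_real.
have h2 : (0 <= r `^ (N - 1) * dr r z ^+ 2)%R by rewrite mulr_ge0 ?powR_ge0 ?sqr_ge0.
have h3 : (v ^+ 2 * `|psi r z| ^+ 2 <= w * psi r z ^+ 2)%R.
  by rewrite e' ler_wpM2r ?sqr_ge0.
have -> : (u * v * (2 * (`|psi r z| * x) + q%:R * x * `|dz r z|) =
   2 * ((u * x) * (v * `|psi r z|)) + q%:R * ((u * x) * (v * `|dz r z|)))%R by ring.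
rewrite -e [leRHS]mulrDl mul1r.
apply: lerD.
  have := sqr_ge0 (u * x - v * `|psi r z|)%R.
  have : (0 <= v ^+ 2 * `|dz r z| ^+ 2)%R by rewrite mulr_ge0 ?sqr_ge0.
  rewrite sqrrB !exprMn; lra.
rewrite ler_wpM2l//.
have h4 : (0 <= w * psi r z ^+ 2)%R by rewrite mulr_ge0 ?powR_ge0 ?sqr_ge0.
have := sqr_ge0 (u * x - v * `|dz r z|)%R.
have : (0 <= u ^+ 2 * x ^+ 2)%R by rewrite mulr_ge0 ?sqr_ge0.
have : (0 <= v ^+ 2 * `|dz r z| ^+ 2)%R by rewrite mulr_ge0 ?sqr_ge0.
rewrite sqrrB !exprMn; lra.
Qed.

(** A Gagliardo-Nirenberg inequality in the plane. The integrand
r^(b+N-2) psi^(2q) is the product of two powers of r times |psi|^q; by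
[sup_bound_r] one factor is at most a function of z alone, by [sup_bound_z] the
other is at most a function of r alone. Hence the integral is at most a product
of two integrals over the strip, estimated by [bound_r] and [bound_z]. *)
Lemma gn_step (q : nat) (b : R) : (0 < q)%N ->
  moment psi q (b + (N - 2)) <=
  (q%:R%:E * (moment psi q.-1 b + strip_energy psi dr dz)) *
  ((1 + q%:R)%:E * (moment psi q.-1 b + strip_energy psi dr dz)).
Proof.
move=> q0.
have mA : measurable (`]0%R, 1%R[ : set mR) by exact: (@measurable_itv R).
have mB : measurable (`[2^-1%R, 1%R] : set mR) by exact: (@measurable_itv R).
pose a1 := ((b + (N - 1)) / 2)%R; pose a2 := ((b + (N - 3)) / 2)%R.
have mp c : measurable_fun setT (fun p : mR * mR => (p.1 : R) `^ c)%R.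
  exact: measurable_fst_powR.
have mpsi : measurable_fun setT (fun p : mR * mR => `|psi p.1 p.2|%R).
  by apply: measurableT_comp => //; exact: profile_m P.
pose f1 (p : mR * mR) : R := ((p.1 : R) `^ a1 * (q%:R * `|psi p.1 p.2| ^+ q.-1 * `|dr p.1 p.2|))%R.
pose f2 (p : mR * mR) : R := ((p.1 : R) `^ a2 * (2 * `|psi p.1 p.2| ^+ q + q%:R * `|psi p.1 p.2| ^+ q.-1 * `|dz p.1 p.2|))%R.
have mf1 : measurable_fun setT f1.
  apply: measurable_funM => //; apply: measurable_funM.
    by apply: measurable_funM => //; exact: measurable_funX.
  by apply: measurableT_comp => //; exact: profile_mr P.
have mf2 : measurable_fun setT f2.
  apply: measurable_funM => //; apply: measurable_funD.
    by apply: measurable_funM => //; exact: measurable_funX.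
  apply: measurable_funM.
    by apply: measurable_funM => //; exact: measurable_funX.
  by apply: measurableT_comp => //; exact: profile_mz P.
have f10 p : (0 <= f1 p)%R by rewrite !mulr_ge0// ?powR_ge0// exprn_ge0.
have f20 p : (0 <= f2 p)%R.
  by rewrite mulr_ge0// ?powR_ge0// addr_ge0// !mulr_ge0// exprn_ge0.
have Ef1 p : 0 <= (f1 p)%:E by rewrite lee_fin.
have Ef2 p : 0 <= (f2 p)%:E by rewrite lee_fin.
have mEf1 : measurable_fun setT (fun p => (f1 p)%:E) by exact/measurable_EFinP.
have mEf2 : measurable_fun setT (fun p => (f2 p)%:E) by exact/measurable_EFinP.
pose X z := \int[leb]_(r in `]0%R, 1%R[) (f1 (r, z))%:E.
pose Y r := \int[leb]_(z in `[2^-1%R, 1%R]) (f2 (r, z))%:E.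
have mX : measurable_fun setT (X : mR -> \bar R).
  exact: (@measurable_tonelliX2 _ _ mA mEf1 Ef1).
have mY : measurable_fun setT (Y : mR -> \bar R).
  exact: (@measurable_tonelliX1 _ _ mB mEf2 Ef2).
have X0 z : 0 <= X z by exact: integral_ge0.
have Y0 r : 0 <= Y r by exact: integral_ge0.
have IX : \int[leb]_(z in `[2^-1%R, 1%R]) X z = \int[m2]_(p in strip) (f1 p)%:E.
  by have [_ ->] := tonelliX mA mB mEf1 Ef1.
have IY : \int[leb]_(r in `]0%R, 1%R[) Y r = \int[m2]_(p in strip) (f2 p)%:E.
  by have [-> _] := tonelliX mA mB mEf2 Ef2.
have mS := measurable_strip.
have mg : measurable_fun setT (fun p : mR * mR => (p.1 : R) `^ b * `|psi p.1 p.2| ^+ (2 * q.-1) + energy_density psi dr dz p)%R.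
  by apply: measurable_funD; [exact: measurable_moment_density|exact: measurable_energy_density].
have g0 (p : mR * mR) : (0 <= (p.1 : R) `^ b * `|psi p.1 p.2| ^+ (2 * q.-1) + energy_density psi dr dz p)%R.
  by rewrite addr_ge0// ?moment_density_ge0// energy_density_ge0.
have IG : \int[m2]_(p in strip) ((p.1 : R) `^ b * `|psi p.1 p.2| ^+ (2 * q.-1) + energy_density psi dr dz p)%:E
  = moment psi q.-1 b + strip_energy psi dr dz.
  apply: rintD => //; [exact: measurable_moment_density|exact: measurable_energy_density|..].
  - by move=> p _; exact: moment_density_ge0.
  - by move=> p _; exact: energy_density_ge0.
have HX : \int[m2]_(p in strip) (f1 p)%:E <= q%:R%:E * (moment psi q.-1 b + strip_energy psi dr dz).
  rewrite -IG -rintZ//; apply: rint_le => //; first exact: measurable_funM.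
  move=> [r z] [/=]; rewrite in_itv/= => /andP[r0 r1] _.
  exact: bound_r.
have HY : \int[m2]_(p in strip) (f2 p)%:E <= (1 + q%:R)%:E * (moment psi q.-1 b + strip_energy psi dr dz).
  rewrite -IG -rintZ//; apply: rint_le => //; first exact: measurable_funM.
  move=> [r z] [/=]; rewrite in_itv/= => /andP[r0 r1] _.
  exact: bound_z.
rewrite -IX in HX; rewrite -IY in HY.
apply: (le_trans _ (lee_pmul _ _ HX HY)); last 2 first.
- by apply: integral_ge0.
- by apply: integral_ge0.
have mm := measurable_moment_density q (b + (N - 2))%R.
rewrite /moment; have [-> _] := tonelliX mA mB (measurable_fun_EFin (D := setT) mm) (fun p => moment_density_ge0 q (b + (N - 2)) p).
rewrite muleC -ge0_integralZr//; last first.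
- exact: integral_ge0.
- exact: measurable_funTS.
apply: ge0_le_integral => //.
- by move=> r _; apply: integral_ge0 => z _; rewrite lee_fin (moment_density_ge0 q (b + (N - 2))%R (r, z)).
- apply: measurable_funTS.
  exact: (@measurable_tonelliX1 _ _ mB (measurable_fun_EFin (D := setT) mm) (fun p => moment_density_ge0 q (b + (N - 2)) p)).
- by apply: emeasurable_funM => //; exact: measurable_funTS.
move=> r; rewrite /= in_itv/= => /andP[r0 r1].
rewrite -ge0_integralZl//; last first.
- exact: measurable_funTS.
apply: ge0_le_integral => //.
- by move=> z _; rewrite lee_fin (moment_density_ge0 q (b + (N - 2))%R (r, z)).
- apply: measurable_funTS; apply/measurable_EFinP.
  exact: (measurableT_comp mm (measurable_pair1 r)).
- apply: measurable_funTS; exact: measurable_funeM.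
move=> z /= zB.
have -> : (r `^ (b + (N - 2)) * `|psi r z| ^+ (2 * q))%R =
   ((r `^ a2 * `|psi r z| ^+ q) * (r `^ a1 * `|psi r z| ^+ q))%R.
  rewrite mulrACA -exprD addnn -mul2n -powRD ?(gt_eqF r0) ?implybT//.
  by congr (_ `^ _ * _)%R; rewrite /a1 /a2; lra.
rewrite EFinM; apply: lee_pmul.
- by rewrite lee_fin mulr_ge0 ?powR_ge0 ?exprn_ge0.
- by rewrite lee_fin mulr_ge0 ?powR_ge0 ?exprn_ge0.
- rewrite EFinM; apply: (le_trans (lee_wpmul2l _ (sup_bound_z P q r zB))).
    by rewrite lee_fin powR_ge0.
  rewrite -rintZ ?powR_ge0//.
    apply: measurable_funD.
      apply: measurable_funM => //; apply: measurable_funX.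
      exact: (measurableT_comp mpsi (measurable_pair1 r)).
    apply: measurable_funM.
      apply: measurable_funM => //; apply: measurable_funX.
      exact: (measurableT_comp mpsi (measurable_pair1 r)).
    apply: measurableT_comp => //.
    exact: (measurableT_comp (profile_mz P) (measurable_pair1 r)).
- by apply: (sup_bound_r P) => //; rewrite r0.
Qed.

End one_profile.

(** Every application of [gn_step] raises the power of psi by 2 and that of r by
N - 2; the starting point is the term r^(N-1-alpha) psi^2 of the energy. *)
Lemma gn_bound (m : nat) (D0 : R) : (0 < m)%N -> exists K : R,
  forall psi dr dz, profile psi dr dz ->
    strip_energy psi dr dz <= D0%:E ->
    moment psi m (m.-1%:R * (N - 2) + (N - 1 - alpha)) <= K%:E.
Proof.
case: m => // m _; elim: m => [|m [K IH]].
  exists D0 => psi dr dz P ED; apply: (le_trans _ ED).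
  apply: rint_le; first exact: measurable_strip.
  - exact: (measurable_moment_density P).
  - exact: (measurable_energy_density P).
  - by move=> p _; exact: moment_density_ge0.
  - move=> p _; rewrite mul0r add0r /energy_density real_normK ?num_real// lerDr.
    by rewrite addr_ge0// mulr_ge0 ?powR_ge0 ?sqr_ge0.
exists ((m.+2%:R * (K + D0)) * ((1 + m.+2%:R) * (K + D0)))%R => psi dr dz P ED.
have := gn_step P (m%:R * (N - 2) + (N - 1 - alpha)) (isT : (0 < m.+2)%N).
rewrite (_ : m%:R * (N - 2) + (N - 1 - alpha) + (N - 2) = m.+2.-1%:R * (N - 2) + (N - 1 - alpha))%R; last first.
  by rewrite -[m.+2.-1]/(m.+1) -[m.+1%:R]natr1; ring.
move=> /le_trans; apply.
have S0 : 0 <= moment psi m.+2.-1 (m%:R * (N - 2) + (N - 1 - alpha)) + strip_energy psi dr dz.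
  apply: adde_ge0; apply: rint_ge0 => p _; first exact: moment_density_ge0.
  exact: energy_density_ge0.
have SK : moment psi m.+2.-1 (m%:R * (N - 2) + (N - 1 - alpha)) + strip_energy psi dr dz <= (K + D0)%:E.
  by rewrite EFinD; apply: leeD => //; exact: (IH _ _ _ P).
rewrite EFinM; apply: lee_pmul.
- by rewrite mule_ge0// lee_fin.
- by rewrite mule_ge0// lee_fin.
- by rewrite EFinM lee_wpmul2l// lee_fin.
- by rewrite EFinM lee_wpmul2l// lee_fin.
Qed.

End gn.

(** * Test functions in the coordinates r and z *)

Section rV_calculus.
Context {R : realType} {m : nat}.
Implicit Types (phi : 'rV[R]_m -> R) (x v : 'rV[R]_m).

(** The measurable sets of rows are generated by the coordinates. A continuous
function is the pointwise limit of its values at the nodes of the grids of mesh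
1 / (k + 1), and these depend on x only through the integer row [rho k x], which
takes countably many values, each on a box. *)
Lemma continuous_measurable_rV phi : continuous phi -> measurable_fun setT phi.
Proof.
move=> cphi.
pose rho (k : nat) x : 'rV[int]_m := \row_i Num.floor (k.+1%:R * x ord0 i).
pose back (k : nat) (v : 'rV[int]_m) : 'rV[R]_m := \row_i ((v ord0 i)%:~R / k.+1%:R).
apply: (@measurable_fun_cvg _ _ _ _ (fun k x => phi (back k (rho k x)))).
  move=> k _ Y mY; rewrite setTI.
  rewrite (_ : _ @^-1` Y = \bigcup_(v in [set: 'rV[int]_m])
    (if phi (back k v) \in Y then rho k @^-1` [set v] else set0)); last first.
    apply/seteqP; split => x /=.
      by move=> Yx; exists (rho k x) => //=; rewrite mem_set.
    by move=> [v _]; case: ifPn => // /set_mem Yv /= h; rewrite h.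
  apply: countable_bigcupT_measurable => // v; case: ifPn => // _.
  rewrite (_ : _ @^-1` _ = \bigcap_(i in [set: 'I_m])
    (fun x => x ord0 i) @^-1` `[(v ord0 i)%:~R / k.+1%:R, (v ord0 i + 1)%:~R / k.+1%:R[%classic); last first.
    apply/seteqP; split => x /=.
      move=> xv i _ /=; rewrite in_itv/= ler_pdivrMr ?ltr0n// ltr_pdivlMr ?ltr0n//.
      by rewrite mulrC -xv mxE floor_itv.
    move=> xv; apply/rowP => i; rewrite mxE; have := xv i I.
    rewrite /= in_itv/= ler_pdivrMr ?ltr0n// ltr_pdivlMr ?ltr0n// => h.
    by apply: floor_def; rewrite mulrC.
  apply: fin_bigcap_measurable => // i _; rewrite -[X in measurable X]setTI.
  exact: (measurable_rV_coord i measurableT (measurable_itv _)).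
move=> x _; apply: (@cvg_comp _ _ _ (fun k => back k (rho k x)) phi _ (nbhs x)); last exact: cphi.
apply/cvg_ballP => e e0; near=> k; split => // a i; rewrite ord1 /ball /=.
rewrite !mxE; set y := x ord0 i.
have k0 : 0 < k.+1%:R :> R by rewrite ltr0n.
have /andP[h1 h2] := floor_itv (k.+1%:R * y).
rewrite ger0_norm; last by rewrite subr_ge0 ler_pdivrMr// [y * _]mulrC.
rewrite ltrBlDr.
apply: (@lt_le_trans _ _ ((Num.floor (k.+1%:R * y) + 1)%:~R / k.+1%:R)).
  by rewrite ltr_pdivlMr// [y * _]mulrC.
rewrite rmorphD/= mulrDl mul1r addrC lerD2r.
near: k; have [K _ HK] := near_infty_natSinv_lt (PosNum e0).
by exists K => // k /HK /ltW.
Unshelve. all: end_near. Qed.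

Definition grad_dot phi x v : R := \sum_(i < m) gradient phi x ord0 i * v ord0 i.

Lemma diff_grad_dot phi x v : differentiable phi x -> 'd phi x v = grad_dot phi x v.
Proof.
move=> dphi; rewrite {1}(row_sum_delta v) linear_sum; apply: eq_bigr => i _.
by rewrite linearZ /= -deriveE// /gradient mxE mulrC.
Qed.

Lemma is_derive_curve phi (c : R -> 'rV[R]_m) (t : R) (v : 'rV[R]_m) :
  differentiable phi (c t) ->
  (forall i, is_derive t (1 : R) (fun s => c s ord0 i) (v ord0 i)) ->
  is_derive t (1 : R) (fun s => phi (c s)) (grad_dot phi (c t) v).
Proof.
move=> dphi dc.
have dcm : derivable c t 1.
  by apply/derivable_mxP => a i; rewrite ord1; case: (dc i).
have dcE : 'D_1 c t = v.
  rewrite derive_mx//; apply/rowP => i; rewrite mxE; by case: (dc i).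
have dcd : differentiable c t by apply/derivable1_diffP.
have dcomp : differentiable (phi \o c) t by exact: differentiable_comp.
apply: DeriveDef; first by apply/derivable1_diffP.
rewrite (deriveE _ dcomp) diff_comp//= -(deriveE _ dcd) dcE.
exact: diff_grad_dot.
Qed.

Lemma cauchy_schwarz (v w : 'rV[R]_m) :
  (\sum_(i < m) v ord0 i * w ord0 i) ^+ 2 <= enorm v ^+ 2 * enorm w ^+ 2.
Proof.
rewrite !enorm_sqr; set A := \sum_i _ * _; set V := \sum_i _; set W := \sum_i _.
have W0 : 0 <= W by apply: sumr_ge0 => i _; exact: sqr_ge0.
have V0 : 0 <= V by apply: sumr_ge0 => i _; exact: sqr_ge0.
have [Weq|Wn] := eqVneq W 0.
  have w0 i : w ord0 i = 0.
    apply/eqP; rewrite -sqrf_eq0; apply/eqP.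
    move/eqP: Weq; rewrite psumr_eq0; last by move=> ? _; exact: sqr_ge0.
    by move=> /allP/(_ i (mem_index_enum _))/eqP.
  by rewrite /A big1 ?expr0n ?mulr_ge0// => i _; rewrite w0 mulr0.
have Wp : 0 < W by rewrite lt_neqAle eq_sym Wn.
have : 0 <= \sum_i (W * v ord0 i - A * w ord0 i) ^+ 2.
  by apply: sumr_ge0 => i _; exact: sqr_ge0.
have -> : \sum_i (W * v ord0 i - A * w ord0 i) ^+ 2 =
   W ^+ 2 * V - 2 * W * A * A + A ^+ 2 * W.
  transitivity (\sum_i (W ^+ 2 * v ord0 i ^+ 2 + (- (2 * W * A)) * (v ord0 i * w ord0 i)
     + A ^+ 2 * w ord0 i ^+ 2)); first by apply: eq_bigr => i _; ring.
  by rewrite !big_split/= -!mulr_sumr -/A -/V -/W; ring.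
have -> : W ^+ 2 * V - 2 * W * A * A + A ^+ 2 * W = W * (V * W - A ^+ 2) by ring.
by rewrite pmulr_rge0// subr_ge0.
Qed.

End rV_calculus.

Section real_derivatives.
Context {R : realType}.
Implicit Types (f g : R -> R) (x : R).

Lemma is_derive1D f g x df dg : is_derive x (1 : R) f df ->
  is_derive x (1 : R) g dg -> is_derive x (1 : R) (fun y => f y + g y) (df + dg).
Proof. by move=> hf hg; exact: (is_deriveD hf hg). Qed.

Lemma is_derive1M f g x df dg : is_derive x (1 : R) f df ->
  is_derive x (1 : R) g dg ->
  is_derive x (1 : R) (fun y => f y * g y) (f x * dg + g x * df).
Proof. by move=> hf hg; exact: (is_deriveM hf hg). Qed.

Lemma is_derive1Z f (k : R) x df : is_derive x (1 : R) f df ->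
  is_derive x (1 : R) (fun y => k * f y) (k * df).
Proof. by move=> hf; exact: (is_deriveZ k hf). Qed.

Lemma is_derive1_addl f (k : R) x df : is_derive x (1 : R) f df ->
  is_derive x (1 : R) (fun y => k + f y) df.
Proof.
move=> hf; have := is_derive1D (is_derive_cst k x (1 : R)) hf.
by rewrite add0r.
Qed.

Lemma is_derive1_eq f x df df' : is_derive x (1 : R) f df -> df = df' ->
  is_derive x (1 : R) f df'.
Proof. by move=> h <-. Qed.

Lemma is_derive1_id x : is_derive x (1 : R) (fun y => y) 1.
Proof. exact: is_derive_id. Qed.

End real_derivatives.

Section test_functions.
Context {R : realType} {n : nat}.
Hypothesis n0 : (0 < n)%N.
Local Notation mR := (measurableTypeR R).
Local Notation RN := 'rV[R]_(n + n).

Let i0 : 'I_n := Ordinal n0.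
Definition e_s : RN := row_mx (delta_mx 0 i0) 0.
Definition e_t : RN := row_mx 0 (delta_mx 0 i0).

(** The cosine of the angle whose tangent is z. *)
Definition zcos (z : R) : R := (Num.sqrt (1 + z ^+ 2))^-1.

Lemma one_plus_sqr_gt0 (z : R) : 0 < 1 + z ^+ 2.
Proof. by rewrite ltr_pwDl// sqr_ge0. Qed.

Lemma zcos_gt0 z : 0 < zcos z.
Proof. by rewrite invr_gt0 sqrtr_gt0 one_plus_sqr_gt0. Qed.

Lemma zcos_sqr z : zcos z ^+ 2 = (1 + z ^+ 2)^-1.
Proof. by rewrite exprVn sqr_sqrtr// ltW// one_plus_sqr_gt0. Qed.

Lemma is_derive_zcos (z : R) : is_derive z (1 : R) zcos (- z * zcos z ^+ 3).
Proof.
have d1 : is_derive z (1 : R) (fun z => 1 + z ^+ 2) (2 * z).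
  apply: is_derive1_addl; apply: (is_derive1_eq (is_derive1_exprn 2 (is_derive1_id z))).
  by rewrite /= expr1 mulr1.
have d2 : is_derive (1 + z ^+ 2) (1 : R) Num.sqrt (2 * Num.sqrt (1 + z ^+ 2))^-1.
  exact: (is_derive1_sqrt (one_plus_sqr_gt0 z)).
have d3 : is_derive z (1 : R) (fun z => Num.sqrt (1 + z ^+ 2)) ((2 * Num.sqrt (1 + z ^+ 2))^-1 * (2 * z)).
  exact: (@is_derive1_comp _ Num.sqrt (fun z => 1 + z ^+ 2) z).
have s0 : Num.sqrt (1 + z ^+ 2) != 0 by rewrite gt_eqF// sqrtr_gt0 one_plus_sqr_gt0.
have d4 := @is_deriveV _ (fun z => Num.sqrt (1 + z ^+ 2)) z _ 1 s0 d3.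
apply: (is_derive1_eq d4).
rewrite /GRing.scale/= /zcos; field.
exact: s0.
Qed.

(** For r > 0 and z > 0, a point with |x| = r and t / s = z. A test function
depends only on (s, t), hence is determined by its values at these points. *)
Definition X_rz (r z : R) : RN := (r * zcos z) *: e_s + (r * z * zcos z) *: e_t.

Lemma X_rzE r z : X_rz r z = row_mx ((r * zcos z) *: delta_mx 0 i0) ((r * z * zcos z) *: delta_mx 0 i0).
Proof. by rewrite /X_rz !scale_row_mx !scaler0 add_row_mx addr0 add0r. Qed.

Lemma enorm_delta (a : R) : enorm (a *: delta_mx 0 i0 : 'rV[R]_n) = `|a|.
Proof.
rewrite enormZ /enorm (bigD1 i0)//= big1 ?addr0; last first.
  by move=> i /negbTE h; rewrite mxE eqxx h /= expr0n.
by rewrite mxE !eqxx expr1n sqrtr1 mulr1.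
Qed.

Lemma s_X r z : s_coord (X_rz r z) = `|r| * zcos z.
Proof. by rewrite /s_coord X_rzE row_mxKl enorm_delta normrM [`|zcos z|]gtr0_norm ?zcos_gt0. Qed.

Lemma t_X r z : t_coord (X_rz r z) = `|r * z| * zcos z.
Proof. by rewrite /t_coord X_rzE row_mxKr enorm_delta normrM [`|zcos z|]gtr0_norm ?zcos_gt0. Qed.

Lemma enorm_st (x : RN) : enorm x = Num.sqrt (s_coord x ^+ 2 + t_coord x ^+ 2).
Proof. by rewrite -enorm_row_mx hsubmxK. Qed.

Lemma enorm_X r z : enorm (X_rz r z) = `|r|.
Proof.
rewrite enorm_st s_X t_X normrM -mulrA [`|z| * _]mulrC mulrA [X in _ + X]exprMn -[X in X + _]mulr1 -mulrDr.
rewrite real_normK ?num_real// exprMn zcos_sqr mulrC mulrA -mulrA.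
rewrite mulrC -mulrA mulVf ?mulr1; last by rewrite gt_eqF// one_plus_sqr_gt0.
by rewrite sqrtr_sqr normr_id.
Qed.

Variable phi : RN -> R.
Hypothesis tphi : H_test phi.

Lemma test_continuous : continuous phi.
Proof. by case: tphi => /(_ 0). Qed.

Lemma test_differentiable x : differentiable phi x.
Proof. by case: tphi => /(_ 1%N)[]. Qed.

Lemma test_partial_continuous i : continuous ('D_(delta_mx 0 i) phi).
Proof. by case: tphi => /(_ 1%N)[_ /(_ i)]. Qed.

Lemma gradient_continuous i : continuous (fun x => gradient phi x ord0 i).
Proof.
rewrite (_ : (fun x => _) = 'D_(delta_mx 0 i) phi); last first.
  by apply/funext => x; rewrite mxE.
exact: test_partial_continuous.
Qed.

Lemma measurable_gradient : measurable_fun setT (gradient phi).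
Proof.
apply: measurable_fun_rVP => i; under eq_fun do rewrite mxE.
by apply: continuous_measurable_rV; exact: test_partial_continuous.
Qed.

Lemma measurable_test : measurable_fun setT phi.
Proof. by apply: continuous_measurable_rV; exact: test_continuous. Qed.

Lemma test_st x y : s_coord x = s_coord y -> t_coord x = t_coord y -> phi x = phi y.
Proof. by case: tphi => _ _ _ [g gE] sxy txy; rewrite !gE sxy txy. Qed.

Definition psi_of (r z : R) : R := phi (X_rz r z).
Definition dr_of (r z : R) : R := grad_dot phi (X_rz r z) (X_rz 1 z).
(** The direction is the derivative of [X_rz r z] in z, as the derivatives of
zcos and of z zcos are - z zcos^3 and zcos^3. *)
Definition dz_of (r z : R) : R :=
  grad_dot phi (X_rz r z) ((- (r * z * zcos z ^+ 3)) *: e_s + (r * zcos z ^+ 3) *: e_t).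

Lemma X_rz_coord r z i : X_rz r z ord0 i = r * zcos z * e_s ord0 i + r * z * zcos z * e_t ord0 i.
Proof. by rewrite !mxE. Qed.

Lemma psi_of_dr (r z : R) : is_derive r (1 : R) (psi_of^~ z) (dr_of r z).
Proof.
apply: (is_derive_curve (c := fun r => X_rz r z)); first exact: test_differentiable.
move=> i.
rewrite (_ : (fun s => _) = (fun s => (X_rz 1 z ord0 i) * s)); last first.
  by apply/funext => s; rewrite !X_rz_coord; ring.
apply: (is_derive1_eq (is_derive1Z (X_rz 1 z ord0 i) (is_derive1_id r))).
exact: mulr1.
Qed.

Lemma psi_of_dz (r z : R) : is_derive z (1 : R) (psi_of r) (dz_of r z).
Proof.
apply: (is_derive_curve (c := X_rz r)); first exact: test_differentiable.
move=> i.
rewrite (_ : (fun s => _) = (fun s => r * e_s ord0 i * zcos s + r * e_t ord0 i * (s * zcos s))); last first.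
  by apply/funext => s; rewrite !X_rz_coord; ring.
have dzc := is_derive_zcos z.
apply: (is_derive1_eq (is_derive1D (is_derive1Z (r * e_s ord0 i) dzc)
  (is_derive1Z (r * e_t ord0 i) (is_derive1M (is_derive1_id z) dzc)))).
rewrite !mxE.
have -> : z * (- z * zcos z ^+ 3) + zcos z * 1 = zcos z ^+ 3.
  rewrite (_ : z * _ + _ = zcos z * (1 - z ^+ 2 * zcos z ^+ 2)); last by ring.
  rewrite [RHS](exprS _ 2); congr (_ * _); rewrite zcos_sqr.
  by have := one_plus_sqr_gt0 z => h; field; rewrite gt_eqF.
ring.
Qed.

Lemma continuous_X_rz r z : continuous (fun r => X_rz r z) /\ continuous (X_rz r).
Proof.
have H (c : R -> RN) : (forall t i, exists v : R, is_derive t (1 : R) (fun s => c s ord0 i) v) -> continuous c.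
  move=> h t; apply/differentiable_continuous/derivable1_diffP/derivable_mxP => a i.
  by rewrite ord1; have [v []] := h t i.
split; apply: H => t i.
  exists (X_rz 1 z ord0 i).
  rewrite (_ : (fun s => _) = (fun s => (X_rz 1 z ord0 i) * s)); last first.
    by apply/funext => s; rewrite !X_rz_coord; ring.
  apply: (is_derive1_eq (is_derive1Z (X_rz 1 z ord0 i) (is_derive1_id t))).
  exact: mulr1.
eexists.
rewrite (_ : (fun s => _) = (fun s => r * e_s ord0 i * zcos s + r * e_t ord0 i * (s * zcos s))); last first.
  by apply/funext => s; rewrite !X_rz_coord; ring.
have dzc := is_derive_zcos t.
exact: (is_derive1D (is_derive1Z (r * e_s ord0 i) dzc)
  (is_derive1Z (r * e_t ord0 i) (is_derive1M (is_derive1_id t) dzc))).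
Qed.

Lemma continuous_zcos : continuous zcos.
Proof. exact: (is_derive1_continuous is_derive_zcos). Qed.

Lemma continuous_sumR (V : topologicalType) (I : Type) (s : seq I) (F : I -> V -> R) :
  (forall i, continuous (F i)) -> continuous (fun x => \sum_(i <- s) F i x).
Proof.
move=> cF; elim: s => [|i s IH].
  by under eq_fun do rewrite big_nil; move=> x; exact: cvg_cst.
by under eq_fun do rewrite big_cons; move=> x; apply: cvgD; [exact: cF|exact: IH].
Qed.

Lemma continuous_dr_of z : continuous (dr_of^~ z).
Proof.
have [cX _] := continuous_X_rz 0 z.
apply: continuous_sumR => i x; apply: cvgM; last exact: cvg_cst.
apply: (@continuous_comp _ _ _ (fun r => X_rz r z) (fun x => gradient phi x ord0 i)).
  exact: cX.
exact: gradient_continuous.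
Qed.

Lemma continuous_dz_of r : continuous (dz_of r).
Proof.
have [_ cX] := continuous_X_rz r 0.
have cz3 : continuous (fun y => zcos y ^+ 3).
  move=> x; apply: (@continuous_comp _ _ _ zcos (fun y => y ^+ 3)); first exact: continuous_zcos.
  exact: exprn_continuous.
have cv i : continuous (fun x => ((- (r * x * zcos x ^+ 3)) *: e_s + (r * zcos x ^+ 3) *: e_t : RN) ord0 i).
  rewrite (_ : (fun x => _) = (fun x => - (r * x * zcos x ^+ 3) * e_s ord0 i + r * zcos x ^+ 3 * e_t ord0 i)); last first.
    by apply/funext => y; rewrite !mxE.
  move=> x; apply: cvgD.
    apply: cvgM; last exact: cvg_cst.
    apply: cvgN; apply: cvgM; last exact: cz3.
    by apply: cvgM; [exact: cvg_cst|exact: cvg_id].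
  apply: cvgM; last exact: cvg_cst.
  by apply: cvgM; [exact: cvg_cst|exact: cz3].
apply: continuous_sumR => i x; apply: cvgM; last exact: cv.
apply: (@continuous_comp _ _ _ (X_rz r) (fun x => gradient phi x ord0 i)).
  exact: cX.
exact: gradient_continuous.
Qed.

Lemma measurable_zcos2 : measurable_fun setT (fun p : mR * mR => zcos p.2 : R).
Proof.
apply: (measurableT_comp (f := zcos : mR -> R)); last exact: measurable_snd.
by apply: continuous_measurable_fun; exact: continuous_zcos.
Qed.

Lemma measurable_X_rz : measurable_fun setT (fun p : mR * mR => X_rz p.1 p.2).
Proof.
have m1 : measurable_fun setT (fun p : mR * mR => p.1 : R) by exact: measurable_fst.
have m2 : measurable_fun setT (fun p : mR * mR => p.2 : R) by exact: measurable_snd.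
have m3 := measurable_zcos2.
apply: measurable_fun_rVP => i; under eq_fun do rewrite X_rz_coord.
apply: measurable_funD; apply: measurable_funM => //; apply: measurable_funM => //.
exact: measurable_funM.
Qed.

Lemma measurable_comp_X (h : RN -> R) : measurable_fun setT h ->
  measurable_fun setT (fun p : mR * mR => h (X_rz p.1 p.2) : R).
Proof. by move=> mh; apply: (measurableT_comp mh); exact: measurable_X_rz. Qed.

Lemma measurable_partial i : measurable_fun setT (fun x : RN => gradient phi x ord0 i).
Proof.
under eq_fun do rewrite mxE.
by apply: continuous_measurable_rV; exact: test_partial_continuous.
Qed.

(** The support is compact in the punctured open ball: the norm has on it a
positive minimum and a maximum below 1. *)
Lemma test_profile_supp : exists2 d : R, 0 < d &
  forall r z : R, 0 <= r -> (r <= d) || (1 - d <= r) -> psi_of r z = 0.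
Proof.
have [_ cK subK _] := tphi; set K := tsupport phi in cK subK.
have phi0 x : ~ K x -> phi x = 0.
  move=> nK; apply: contrapT => h; apply: nK; apply: subset_closure => /=.
  exact/eqP.
have cen : continuous (@enorm R (n + n)).
  move=> x; apply: (@continuous_comp _ _ _ (fun x : RN => \sum_(i < n + n) x ord0 i ^+ 2) Num.sqrt); last exact: sqrt_continuous.
  apply: continuous_sumR => i y.
  apply: (@continuous_comp _ _ _ (fun x : RN => x ord0 i) (fun y => y ^+ 2)).
    exact: coord_continuous.
  exact: exprn_continuous.
have [K0|/set0P K0] := eqVneq K set0.
  by exists 1 => // r z _ _; apply: phi0; rewrite K0.
have [x1 /set_mem Kx1 max1] := EVT_max_rV K0 cK (continuous_subspaceT cen).
have [x2 /set_mem Kx2 min2] := EVT_min_rV K0 cK (continuous_subspaceT cen).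
have e1 : enorm x1 < 1 by have [] := subK _ Kx1.
have e2 : 0 < enorm x2.
  have [_ x20] := subK _ Kx2; rewrite lt_neqAle enorm_ge0 andbT eq_sym.
  apply/eqP => e20; apply: x20 => /=; apply/rowP => i; rewrite mxE.
  by apply/eqP; rewrite -normr_le0 -e20 le_coord_enorm.
exists (Num.min (enorm x2) (1 - enorm x1) / 2).
  by rewrite divr_gt0// lt_min e2 subr_gt0.
move=> r z r0 h; apply: phi0 => KX.
have := max1 _ (mem_set KX); have := min2 _ (mem_set KX).
rewrite enorm_X ger0_norm//.
set d := Num.min _ _ in h.
have d1 : d <= enorm x2 by rewrite ge_min lexx.
have d2 : d <= 1 - enorm x1 by rewrite ge_min lexx orbT.
have d0 : 0 < d by rewrite lt_min e2 subr_gt0.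
by case/orP: h => h; lra.
Qed.

Lemma test_profile : profile psi_of dr_of dz_of.
Proof.
have m1 : measurable_fun setT (fun p : mR * mR => p.1 : R) by exact: measurable_fst.
have m2 : measurable_fun setT (fun p : mR * mR => p.2 : R) by exact: measurable_snd.
have m3 := measurable_zcos2.
split.
- exact: (measurable_comp_X measurable_test).
- apply: measurable_sum => i; apply: measurable_funM.
    exact: (measurable_comp_X (measurable_partial i)).
  under eq_fun do rewrite X_rz_coord.
  by apply: measurable_funD; apply: measurable_funM => //; apply: measurable_funM => //; exact: measurable_funM.
- apply: measurable_sum => i; apply: measurable_funM.
    exact: (measurable_comp_X (measurable_partial i)).
  under eq_fun do rewrite !mxE.
  apply: measurable_funD; apply: measurable_funM => //.
    apply: (@measurable_funN _ _ _ setT (fun p : mR * mR => p.1 * p.2 * zcos p.2 ^+ 3 : R)); apply: measurable_funM; [exact: measurable_funM|exact: measurable_funX].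
  apply: measurable_funM => //; exact: measurable_funX.
- exact: psi_of_dr.
- exact: psi_of_dz.
- exact: continuous_dr_of.
- exact: continuous_dz_of.
- exact: test_profile_supp.
Qed.

End test_functions.

(** * Gradients and the H norm in the coordinates r and z *)

Section relations.
Context {R : realType} {n : nat}.
Hypothesis n0 : (0 < n)%N.
Local Notation RN := 'rV[R]_(n + n).
Variable phi : RN -> R.
Hypothesis tphi : H_test phi.
Variable x : RN.
Hypothesis s0 : 0 < s_coord x.
Let z := t_coord x / s_coord x.
Let r := enorm x.

Lemma s_coord_polar : s_coord x = r * zcos z.
Proof.
rewrite /zcos /r enorm_st /z.
have -> : 1 + (t_coord x / s_coord x) ^+ 2 = (s_coord x ^+ 2 + t_coord x ^+ 2) / s_coord x ^+ 2.
  by rewrite expr_div_n mulrDl divff// expf_neq0// gt_eqF.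
rewrite sqrtrM ?addr_ge0 ?sqr_ge0// sqrtrV ?sqr_ge0// sqrtr_sqr gtr0_norm//.
by rewrite invfM invrK mulrA divff ?mul1r// gt_eqF// sqrtr_gt0 ltr_pwDl ?sqr_ge0 ?exprn_gt0.
Qed.

Lemma t_coord_polar : t_coord x = r * z * zcos z.
Proof. by rewrite mulrAC -s_coord_polar /z mulrC divfK// gt_eqF. Qed.

Lemma z_coord_ge0 : 0 <= z.
Proof. by rewrite divr_ge0 ?enorm_ge0. Qed.

Lemma enorm_gt0_s : 0 < r.
Proof.
rewrite /r enorm_st sqrtr_gt0 ltr_pwDl ?sqr_ge0// exprn_gt0//.
Qed.

Lemma s_coordZ (c : R) (y : RN) : s_coord (c *: y) = `|c| * s_coord y.
Proof. by rewrite /s_coord linearZ enormZ. Qed.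

Lemma t_coordZ (c : R) (y : RN) : t_coord (c *: y) = `|c| * t_coord y.
Proof. by rewrite /t_coord linearZ enormZ. Qed.

Lemma phi_psi : phi x = psi_of n0 phi r z.
Proof.
apply: (test_st tphi); rewrite ?s_X ?t_X ger0_norm.
- exact: s_coord_polar.
- exact: enorm_ge0.
- exact: t_coord_polar.
- by rewrite mulr_ge0 ?z_coord_ge0 ?enorm_ge0.
Qed.

(** The derivatives are taken along two different rays, that of [X_rz] and that of
x, but the test function takes the same values on both. *)
Lemma dr_grad : dr_of n0 phi r z = grad_dot phi x (r^-1 *: x).
Proof.
have r0 := enorm_gt0_s.
have h : is_derive r (1 : R) (fun rho => phi ((rho / r) *: x)) (grad_dot phi ((r / r) *: x) (r^-1 *: x)).
  apply: (@is_derive_curve _ _ phi (fun rho => (rho / r) *: x) r).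
    exact: (test_differentiable tphi).
  move=> i; rewrite mxE.
  rewrite (_ : (fun s => _) = (fun s => (r^-1 * x ord0 i) * s)); last first.
    by apply/funext => s; rewrite mxE; ring.
  by apply: (is_derive1_eq (is_derive1Z (r^-1 * x ord0 i) (is_derive1_id r))); exact: mulr1.
rewrite divff ?gt_eqF// scale1r in h.
have h' := psi_of_dr n0 tphi r z.
have e : (psi_of n0 phi)^~ z = (fun rho => phi ((rho / r) *: x)).
  apply/funext => rho; apply: (test_st tphi).
    rewrite s_X s_coordZ s_coord_polar normrM [`|r^-1|]gtr0_norm ?invr_gt0//.
    have -> : `|rho| / r * (r * zcos z) = `|rho| * zcos z * (r / r) by ring.
    by rewrite divff ?mulr1// gt_eqF.
  rewrite t_X t_coordZ t_coord_polar [`|rho * z|]normrM [`|rho / r|]normrM [`|r^-1|]gtr0_norm ?invr_gt0//.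
  rewrite [`|z|]ger0_norm ?z_coord_ge0//.
  have -> : `|rho| / r * (r * z * zcos z) = `|rho| * z * zcos z * (r / r) by ring.
  by rewrite divff ?mulr1// gt_eqF.
rewrite -e in h.
by case: h => _ <-; case: h' => _ ->.
Qed.

Hypothesis t0 : 0 < t_coord x.

Lemma z_coord_gt0 : 0 < z.
Proof. by rewrite divr_gt0. Qed.

(** Both sides are derivatives of one function of z: on the right x moves in its
own plane, the directions lsubmx x / s and rsubmx x / t being kept fixed. The
factor 1 + z^2 converts d/dz into d/dtheta. *)
Lemma dz_grad : (1 + z ^+ 2) * dz_of n0 phi r z = grad_dot phi x (dx_dtheta x).
Proof.
have r0 := enorm_gt0_s.
have z0 := z_coord_gt0.
pose c (y : R) : RN := row_mx ((r * zcos y / s_coord x) *: lsubmx x) ((r * y * zcos y / t_coord x) *: rsubmx x).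
have cz : c z = x.
  by rewrite /c -s_coord_polar -t_coord_polar !divff ?gt_eqF// !scale1r hsubmxK.
have h : is_derive z (1 : R) (fun y => phi (c y)) (grad_dot phi (c z) ((1 + z ^+ 2)^-1 *: dx_dtheta x)).
  apply: (@is_derive_curve _ _ phi c z); first exact: (test_differentiable tphi).
  have dzc := is_derive_zcos z.
  have zc2 : zcos z ^+ 3 = zcos z * (1 + z ^+ 2)^-1 by rewrite -zcos_sqr -exprS.
  move=> i; rewrite mxE; case: (split_ordP i) => j ->.
    rewrite (_ : (fun s => _) = (fun s => (r / s_coord x * lsubmx x ord0 j) * zcos s)); last first.
      by apply/funext => s; rewrite row_mxEl [LHS]mxE; ring.
    apply: (is_derive1_eq (is_derive1Z _ dzc)).
    rewrite /dx_dtheta row_mxEl [in RHS]mxE zc2 -/z.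
    have -> : r / s_coord x * lsubmx x ord0 j * (- z * (zcos z / (1 + z ^+ 2))) =
       (r * zcos z) / s_coord x * (lsubmx x ord0 j * - z / (1 + z ^+ 2)) by ring.
    rewrite -s_coord_polar divff ?gt_eqF//; ring.
  rewrite (_ : (fun s => _) = (fun s => (r / t_coord x * rsubmx x ord0 j) * (s * zcos s))); last first.
    by apply/funext => s; rewrite row_mxEr [LHS]mxE; ring.
  apply: (is_derive1_eq (is_derive1Z _ (is_derive1M (is_derive1_id z) dzc))).
  rewrite /dx_dtheta row_mxEr [in RHS]mxE zc2.
  have -> : z * (- z * (zcos z / (1 + z ^+ 2))) + zcos z * 1 = zcos z / (1 + z ^+ 2).
    by have := one_plus_sqr_gt0 z => h; field; rewrite gt_eqF.
  have -> : s_coord x / t_coord x = r * zcos z / t_coord x by rewrite -s_coord_polar.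
  ring.
have h' := psi_of_dz n0 tphi r z.
have e : psi_of n0 phi r = (fun y => phi (c y)).
  apply/funext => y; apply: (test_st tphi).
    rewrite s_X {1}/s_coord /c row_mxKl enormZ normrM -/(s_coord x).
    rewrite normfV [`|s_coord x|]gtr0_norm// divfK ?gt_eqF// normrM.
    by rewrite [`|zcos y|]gtr0_norm ?zcos_gt0.
  rewrite t_X {1}/t_coord /c row_mxKr enormZ [`|_ / t_coord x|]normrM -/(t_coord x).
  rewrite normfV [`|t_coord x|]gtr0_norm// divfK ?gt_eqF// [`|_ * zcos y|]normrM.
  by rewrite [`|zcos y|]gtr0_norm ?zcos_gt0.
rewrite -e cz in h.
have -> : dz_of n0 phi r z = grad_dot phi x ((1 + z ^+ 2)^-1 *: dx_dtheta x).
  by case: h => _ <-; case: h' => _ ->.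
rewrite /grad_dot mulr_sumr; apply: eq_bigr => i _.
have -> : ((1 + z ^+ 2)^-1 *: dx_dtheta x) ord0 i = (1 + z ^+ 2)^-1 * dx_dtheta x ord0 i.
  by rewrite mxE.
by rewrite [gradient _ _ _ _ * _]mulrCA mulVKf// gt_eqF// one_plus_sqr_gt0.
Qed.

Lemma enorm_dx_dtheta : enorm (dx_dtheta x) = r.
Proof.
rewrite /dx_dtheta enorm_row_mx !enormZ -/(s_coord x) -/(t_coord x) /r enorm_st.
rewrite normrN !normrM !normfV [`|s_coord x|]gtr0_norm// [`|t_coord x|]gtr0_norm//.
by rewrite !divfK ?gt_eqF// addrC.
Qed.

Lemma dr_le : dr_of n0 phi r z ^+ 2 <= enorm (gradient phi x) ^+ 2.
Proof.
rewrite dr_grad; apply: (le_trans (cauchy_schwarz _ _)).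
rewrite enormZ normfV [`|r|]gtr0_norm ?enorm_gt0_s// -/r mulVf ?gt_eqF ?enorm_gt0_s//.
by rewrite expr1n mulr1.
Qed.

Lemma dz_le : ((1 + z ^+ 2) * dz_of n0 phi r z) ^+ 2 <= enorm (gradient phi x) ^+ 2 * r ^+ 2.
Proof. by rewrite dz_grad; apply: (le_trans (cauchy_schwarz _ _)); rewrite enorm_dx_dtheta. Qed.

End relations.

Section ball_polar.
Context {R : realType}.
Local Notation leb := (@lebesgue_measure R).
Local Notation mR := (measurableTypeR R).
Local Notation m2 := (leb \x leb)%E.

(** The indicator of r < 1 is part of the weight, so that integrals over the ball
become integrals over the whole plane. *)
Definition rzweight (n : nat) (p : mR * mR) : R :=
  ppow (n + n).-1 p.1 * zweight n p.2 * ((p.1 : R) < 1)%R%:R.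

Lemma rzweight_ge0 n p : 0 <= rzweight n p.
Proof. by apply: mulr_ge0 => //; apply: mulr_ge0; [exact: ppow_ge0|exact: zweight_ge0]. Qed.

Lemma measurable_lt1 : measurable_fun setT (fun p : mR * mR => ((p.1 : R) < 1)%R%:R : R).
Proof.
have m1 : measurable_fun setT (fun p : mR * mR => p.1 : R) by exact: measurable_fst.
have mb : measurable_fun setT (fun p : mR * mR => (p.1 : R) < 1).
  exact: measurable_fun_ltr.
rewrite (_ : (fun p => _) = (fun p : mR * mR => if (p.1 : R) < 1 then 1 else 0 : R)); last first.
  by apply/funext => p; case: ifP.
exact: measurable_fun_if.
Qed.

Lemma measurable_rzweight n : measurable_fun setT (rzweight n).
Proof.
apply: measurable_funM; last exact: measurable_lt1.
apply: measurable_funM.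
  apply: (measurableT_comp (f := ppow (n + n).-1 : mR -> R)); last exact: measurable_fst.
  exact: measurable_ppow.
apply: (measurableT_comp (f := zweight n : mR -> R)); last exact: measurable_snd.
exact: measurable_zweight.
Qed.

Definition rz_coord {n} (x : 'rV[R]_(n + n)) : mR * mR := (enorm x, t_coord x / s_coord x).

Lemma measurable_rz_coord n : measurable_fun setT (@rz_coord n).
Proof.
apply/measurable_fun_pairP; split => /=; first exact: measurable_enorm.
apply: measurable_funM; first exact: measurable_t_coord.
exact: (measurableT_comp measurable_invr (@measurable_s_coord R n)).
Qed.

Local Open Scope ereal_scope.

Lemma ball_polar n : (1 < n)%N -> exists2 C : R, (0 < C)%R &
  forall g : mR * mR -> \bar R, measurable_fun setT g -> (forall p, 0 <= g p) ->
   \int[ball_measure (n + n)]_x g (rz_coord x) =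
   C%:E * \int[m2]_p (g p * (rzweight n p)%:E).
Proof.
move=> n1; have [C C0 CE] := @polar_formula R n n1; exists C => // g mg g0.
have mgx : measurable_fun setT (fun x : 'rV[R]_(n + n) => g (rz_coord x)).
  by apply: (measurableT_comp mg); exact: measurable_rz_coord.
rewrite /ball_measure ge0_integral_mrestr//.
rewrite integral_mkcond.
pose g' (r z : mR) := g (r, z) * (((r : R) < 1)%R%:R : R)%:E.
have mg' : measurable_fun setT (fun p : mR * mR => g' p.1 p.2).
  apply: emeasurable_funM; last by apply/measurable_EFinP; exact: measurable_lt1.
  by rewrite (_ : (fun x => _) = g)//; apply/funext => -[].
have g'0 r z : 0 <= g' r z by rewrite mule_ge0// lee_fin.
transitivity (\int[lebesgue_rV (n + n)]_x g' (enorm x) (t_coord x / s_coord x)%R).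
  apply: eq_integral => x _; rewrite patchE /g'.
  rewrite (_ : (x \in @unit_ball R (n + n)) = (enorm x < 1)%R); last first.
    by apply/idP/idP => [/set_mem//|h]; exact/mem_set.
  by case: ifP => _; rewrite ?mule1 ?mule0.
rewrite CE//; congr (_ * _).
rewrite fubini_tonelli1.
- apply: eq_integral => r _; apply: eq_integral => z _.
  by rewrite /g' /rzweight /= -muleA -EFinM; congr (_ * _%:E); rewrite mulrC.
- by apply: emeasurable_funM => //; apply/measurable_EFinP; exact: measurable_rzweight.
- by move=> p; rewrite mule_ge0// lee_fin rzweight_ge0.
Qed.

Lemma ball_finite n : ball_measure (n + n) [set: 'rV[R]_(n + n)] < +oo.
Proof.
rewrite /ball_measure /= /mrestr setTI.
apply: le_lt_trans (@lebesgue_rV_ball_lty R (n + n)).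
apply: le_measure; rewrite ?inE; [exact: measurable_unit_ball|exact: measurable_enorm_le|].
by move=> x /ltW.
Qed.

(** The weight in z vanishes for z <= 0, and z = t / s is 0 as soon as s or t
is, since division by 0 gives 0. *)
Lemma ball_ae_z_gt0 n : (1 < n)%N ->
  {ae ball_measure (n + n), forall x : 'rV[R]_(n + n), (0 < s_coord x)%R /\ (0 < t_coord x)%R}.
Proof.
move=> n1; have [C C0 CE] := @ball_polar n n1.
pose A : set (mR * mR) := [set p | (p.2 : R) <= 0]%R.
have mA : measurable A.
  rewrite (_ : A = snd @^-1` (`]-oo, 0%R]%classic : set mR)); last first.
    by apply/seteqP; split => p /=; rewrite in_itv.
  by rewrite -[X in measurable X]setTI; apply: measurable_snd => //; exact: (@measurable_itv R).
have mB : measurable (@rz_coord n @^-1` A).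
  by rewrite -[X in measurable X]setTI; exact: measurable_rz_coord.
exists (@rz_coord n @^-1` A); split => //.
  rewrite -(setIT (_ @^-1` _)) -integral_indic//.
  have := CE (fun p => (\1_A p)%:E); rewrite /indic => ->.
  - rewrite integral0_eq ?mule0// => p _.
    case: (boolP (p \in A)) => [/set_mem pA|_]; last by rewrite mul0e.
    have e : zweight n p.2 = 0%R by rewrite /zweight (ppow0 _ pA) ?mul0r//; lia.
    by rewrite /rzweight e mulr0 mul0r mule0.
  - by apply/measurable_EFinP; exact: measurable_indic.
  - by move=> p; rewrite lee_fin.
move=> x h; suff : (t_coord x / s_coord x <= 0)%R by [].
rewrite leNgt; apply/negP => z0; apply: h => /=.
have st : (0 <= s_coord x)%R by exact: enorm_ge0.
have tt : (0 <= t_coord x)%R by exact: enorm_ge0.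
rewrite !lt_neqAle st tt !andbT; split; apply/eqP => e; move: z0; rewrite -e.
  by rewrite invr0 mulr0 ltxx.
by rewrite mul0r ltxx.
Qed.

(** Estimates are made on the integral itself, before the square root of
[H_pair_norm] is taken. *)
Definition Hsq n (alpha : R) (u : 'rV[R]_(n + n) -> R) (G : 'rV[R]_(n + n) -> 'rV[R]_(n + n)) : \bar R :=
  \int[ball_measure (n + n)]_x (enorm (G x) ^+ 2 + u x ^+ 2 / enorm x `^ alpha)%:E.

Lemma Hsq_density_ge0 n alpha (u : 'rV[R]_(n + n) -> R) G x :
  (0 <= enorm (G x : 'rV[R]_(n + n)) ^+ 2 + u x ^+ 2 / enorm x `^ alpha)%R.
Proof. by rewrite addr_ge0 ?sqr_ge0// divr_ge0 ?sqr_ge0// powR_ge0. Qed.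

Lemma Hsq_ge0 n alpha (u : 'rV[R]_(n + n) -> R) G : 0 <= Hsq alpha u G.
Proof. by apply: rint_ge0 => x _; exact: Hsq_density_ge0. Qed.

Lemma measurable_Hsq_density n alpha (u : 'rV[R]_(n + n) -> R) G :
  measurable_fun setT u -> measurable_fun setT G ->
  measurable_fun setT (fun x => enorm (G x : 'rV[R]_(n + n)) ^+ 2 + u x ^+ 2 / enorm x `^ alpha)%R.
Proof.
move=> mu mG; apply: measurable_funD.
  by apply: measurable_funX; apply: (measurableT_comp (@measurable_enorm R (n + n))).
apply: measurable_funM; first exact: measurable_funX.
apply: (measurableT_comp measurable_invr).
apply: (measurableT_comp (f := fun y : R => (y `^ alpha)%R)).
  exact: measurable_powR.
exact: measurable_enorm.
Qed.

Lemma H_pair_normE n alpha (u : 'rV[R]_(n + n) -> R) G :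
  H_pair_norm alpha u G = Hsq alpha u G `^ 2^-1.
Proof. by []. Qed.

Lemma Hsq_le n alpha (u : 'rV[R]_(n + n) -> R) G (M : R) :
  H_pair_norm alpha u G <= M%:E -> Hsq alpha u G <= (M ^+ 2)%:E.
Proof.
rewrite H_pair_normE => h.
have M0 : (0 <= M)%R by rewrite -lee_fin; apply: le_trans h; exact: poweR_ge0.
have -> : Hsq alpha u G = (Hsq alpha u G `^ 2^-1) `^ 2.
  by rewrite -poweRrM mulVf// poweRe1// Hsq_ge0.
rewrite -powR_mulrn// -poweR_EFin.
by apply: gt0_ler_poweR => //; rewrite in_itv/= ?poweR_ge0 ?leey ?lee_fin ?M0.
Qed.

Section energy_of_test.
Variables (n : nat) (n1 : (1 < n)%N) (alpha : R).
Let n0 : (0 < n)%N := ltnW n1.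

(** |grad phi|^2 + phi^2 / |x|^alpha in the coordinates (r, z): the derivative in
theta is (1 + z^2) d/dz, and contributes to the gradient with a factor 1 / r. *)
Definition rz_energy (psi dr dz : R -> R -> R) (p : mR * mR) : R :=
  (dr p.1 p.2 ^+ 2 + ((1 + (p.2 : R) ^+ 2) * dz p.1 p.2) ^+ 2 / (p.1 : R) ^+ 2
   + psi p.1 p.2 ^+ 2 / (p.1 : R) `^ alpha)%R.

Lemma rz_energy_ge0 psi dr dz p : (0 <= rz_energy psi dr dz p)%R.
Proof. by rewrite !addr_ge0 ?divr_ge0 ?sqr_ge0 ?powR_ge0. Qed.

Lemma measurable_rz_energy psi dr dz : profile psi dr dz ->
  measurable_fun setT (rz_energy psi dr dz).
Proof.
move=> P.
have m1 : measurable_fun setT (fun p : mR * mR => p.1 : R) by exact: measurable_fst.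
have m2' : measurable_fun setT (fun p : mR * mR => p.2 : R) by exact: measurable_snd.
apply: measurable_funD; [apply: measurable_funD|].
- by apply: measurable_funX; exact: profile_mr P.
- apply: measurable_funM.
    apply: measurable_funX; apply: measurable_funM; last exact: profile_mz P.
    by apply: measurable_funD => //; exact: measurable_funX.
  by apply: (measurableT_comp measurable_invr); exact: measurable_funX.
- apply: measurable_funM; first by apply: measurable_funX; exact: profile_m P.
  by apply: (measurableT_comp measurable_invr); exact: measurable_fst_powR.
Qed.

(** The radial and angular derivatives are the products of the gradient with x / r
and with dx/dtheta, of norms 1 and r, so that Cauchy-Schwarz bounds each of
them. Not using the orthogonality of these vectors costs the factor 2. *)
Lemma weighted_energy_le : exists2 K : R, (0 < K)%R & forall phi : 'rV[R]_(n + n) -> R,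
  H_test phi ->
  \int[m2]_p (rz_energy (psi_of n0 phi) (dr_of n0 phi) (dz_of n0 phi) p * rzweight n p)%:E <=
  K%:E * Hsq alpha phi (gradient phi).
Proof.
have [C C0 CE] := @ball_polar n n1.
exists (C^-1 * 2)%R; first by rewrite mulr_gt0// invr_gt0.
move=> phi tphi.
have P := test_profile n0 tphi.
set e := rz_energy _ _ _.
have me : measurable_fun setT e := measurable_rz_energy P.
have mE : measurable_fun setT (fun p => (e p)%:E) by exact/measurable_EFinP.
have e0 p : (0 <= e p)%R by exact: rz_energy_ge0.
have := CE (fun p => (e p)%:E) mE (fun p => e0 p).
under [X in _ = _ * X]eq_integral do rewrite -EFinM.
move=> h.
have -> : \int[m2]_p (e p * rzweight n p)%:E = (C^-1)%:E * \int[ball_measure (n + n)]_x (e (rz_coord x))%:E.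
  by rewrite h muleA -EFinM mulVf ?mul1e// gt_eqF.
rewrite EFinM -muleA; apply: lee_wpmul2l; first by rewrite lee_fin invr_ge0 ltW.
have mu := measurable_test tphi; have mG := measurable_gradient tphi.
have mH := measurable_Hsq_density alpha mu mG.
rewrite /Hsq -rintZ//; last by move=> x _; exact: Hsq_density_ge0.
apply: ae_ge0_le_integral => //.
- by move=> x _; rewrite lee_fin.
- by apply/measurable_EFinP; apply: (measurableT_comp me); exact: measurable_rz_coord.
- by move=> x _; rewrite lee_fin mulr_ge0// Hsq_density_ge0.
- by apply/measurable_EFinP; apply: measurable_funM.
apply: filterS (ball_ae_z_gt0 n1) => x [s0 t0] _; rewrite lee_fin.
have r0 := enorm_gt0_s s0.
have h1 := dr_le n0 tphi s0.
have h2 := dz_le n0 tphi s0 t0.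
rewrite /e /rz_energy /= -(phi_psi n0 tphi s0).
have h3 : (((1 + (t_coord x / s_coord x) ^+ 2) * dz_of n0 phi (enorm x) (t_coord x / s_coord x)) ^+ 2 / enorm x ^+ 2 <= enorm (gradient phi x) ^+ 2)%R.
  by rewrite ler_pdivrMr ?exprn_gt0.
have h4 : (0 <= phi x ^+ 2 / enorm x `^ alpha)%R by rewrite divr_ge0 ?sqr_ge0 ?powR_ge0.
lra.
Qed.

End energy_of_test.

End ball_polar.

(** * Compactness in L^1 of bounded sets of W^{1,1} of a rectangle *)

Section pigeonhole.

Lemma infinite_fiber (T : finType) (f : nat -> T) :
  exists c, exists s : nat -> nat, {homo s : i j / (i < j)%N} /\ forall k, f (s k) = c.
Proof.
have [c Hc] : exists c, forall m, exists2 k, (m <= k)%N & f k = c.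
  apply: contrapT => /forallNP h.
  have {}h c : exists m, forall k, (m <= k)%N -> f k <> c.
    have /existsNP[m /forall2NP hm] := h c.
    by exists m => k mk fk; have [] := hm k.
  have [g Hg] := @choice _ nat _ h.
  pose m := \max_(c : T) g c.
  exact: (Hg (f m) m (leq_bigmax (f m))).
have /(@choice nat nat)[g Hg] : forall m, exists k, (m < k)%N /\ f k = c.
  by move=> m; have [k mk fk] := Hc m.+1; exists k.
exists c, (fun k => iter k.+1 g 0%N); split; last by move=> k; have [] := Hg (iter k g 0%N).
apply: homo_ltn; first exact: ltn_trans.
by move=> k /=; have [] := Hg (g (iter k g 0%N)).
Qed.

(** Round the bounded values to multiples of e: the rounded families range over a
finite set, so one of them is taken infinitely often. *)
Lemma pigeon_reals (R : realType) (T : finType) (B e : R) (v : nat -> T -> R) :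
  0 < e -> (forall j c, `|v j c| <= B) ->
  exists2 s : nat -> nat, {homo s : i j / (i < j)%N} &
    forall i j c, `|v (s i) c - v (s j) c| <= e.
Proof.
move=> e0 vB.
pose g j c := Num.truncn ((v j c + B) / e).
pose m := Num.truncn ((B + B) / e).
have gm j c : (g j c <= m)%N.
  apply: le_truncn; rewrite ler_pM2r ?invr_gt0// lerD2r.
  by have := vB j c; rewrite ler_norml => /andP[].
pose f j : {ffun T -> 'I_m.+1} := [ffun c => inord (g j c)].
have [w [s [sincr fs]]] := infinite_fiber f.
exists s => // i j c.
have gij : g (s i) c = g (s j) c.
  have := congr1 (fun h : {ffun T -> 'I_m.+1} => val (h c)) (etrans (fs i) (esym (fs j))).
  by rewrite /f !ffunE /= !inordK ?ltnS.
have nn k : 0 <= (v k c + B) / e.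
  rewrite divr_ge0 ?(ltW e0)// -lerBlDr sub0r.
  by have := vB k c; rewrite ler_norml => /andP[].
have /andP[h1 h2] := truncn_itv (nn (s i)).
have /andP[h3 h4] := truncn_itv (nn (s j)).
rewrite -/(g _ _) in h1 h2 h3 h4; rewrite gij in h1 h2.
rewrite !(ler_pdivlMr _ _ e0) in h1 h3; rewrite !(ltr_pdivrMr _ _ e0) in h2 h4.
rewrite -natr1 in h2 h4.
by rewrite ler_norml; apply/andP; split; lra.
Qed.

End pigeonhole.

Section W11.
Context {R : realType}.
Local Notation leb := (@lebesgue_measure R).
Local Notation mR := (measurableTypeR R).
Local Notation m2 := (leb \x leb)%E.
Local Open Scope ereal_scope.

Definition rect (a b c d : R) : set (mR * mR) := `[a, b[%classic `*` `[c, d[%classic.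

Lemma measurable_rect a b c d : measurable (rect a b c d).
Proof. by apply: measurableX; exact: (@measurable_itv R). Qed.

Lemma rect_area a b c d : (a <= b)%R -> (c <= d)%R ->
  m2 (rect a b c d) = ((b - a) * (d - c))%:E.
Proof.
move=> ab cd.
have l (x y : R) : (x <= y)%R -> leb `[x, y[%classic = (y - x)%:E.
  rewrite le_eqVlt => /predU1P[->|xy]; rewrite lebesgue_measure_itv/= lte_fin.
    by rewrite ltxx subrr.
  by rewrite xy.
by rewrite /rect product_measure1E//= !l.
Qed.

Lemma integral_slices (D : set (mR * mR)) (g : mR * mR -> mR) (K : nat) (a h : R)
    (f : mR * mR -> \bar R) :
  measurable D -> measurable_fun setT g -> (0 <= h)%R ->
  measurable_fun setT f -> (forall p, 0 <= f p) ->
  \int[m2]_(p in D `&` g @^-1` `[(a : R), (a + K%:R * h)%R[%classic) f p =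
  \sum_(i < K) \int[m2]_(p in D `&` g @^-1` `[(a + i%:R * h)%R, (a + i.+1%:R * h)%R[%classic) f p.
Proof.
move=> mD mg h0 mf f0.
have mS (x y : R) : measurable (D `&` g @^-1` `[x, y[%classic).
  apply: measurableI => //; rewrite -[X in measurable X]setTI.
  by apply: mg => //; exact: (@measurable_itv R).
elim: K => [|K IH].
  rewrite big_ord0 mul0r addr0 (_ : _ `&` _ = set0) ?integral_set0//.
  apply/seteqP; split => // p [_] /=; rewrite in_itv/= => /andP[/le_lt_trans hh] /hh.
  by rewrite ltxx.
rewrite big_ord_recr/= -IH -ge0_integral_setU//; last 2 first.
- exact: measurable_funTS.
- apply/disj_setPS => p [[_ /= +] [_ /= +]]; rewrite !in_itv/= => /andP[_ h1] /andP[h2 _].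
  by have := le_lt_trans h2 h1; rewrite ltxx.
congr (integral _ _ _); apply/seteqP; split => p /=.
  rewrite !in_itv/= => -[Dp /andP[h1 h2]].
  have [h4|h4] := ltP (g p : R) (a + K%:R * h)%R; [left|right]; split => //.
  by rewrite h1.
have le1 : (a + K%:R * h <= a + K.+1%:R * h)%R by rewrite lerD2l ler_wpM2r// ler_nat.
have le0 : (a <= a + K%:R * h)%R by rewrite lerDl mulr_ge0.
rewrite !in_itv/= => -[] [Dp /andP[h1 h2]]; split => //.
  by rewrite h1 (lt_le_trans h2).
by rewrite (le_trans le0).
Qed.

Definition cell (K : nat) (a h c k : R) (x : 'I_K * 'I_K) : set (mR * mR) :=
  rect (a + x.1%:R * h) (a + x.1.+1%:R * h) (c + x.2%:R * k) (c + x.2.+1%:R * k).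

Lemma split_cells (K : nat) (a h c k : R) (f : mR * mR -> \bar R) :
  (0 <= h)%R -> (0 <= k)%R -> measurable_fun setT f -> (forall p, 0 <= f p) ->
  \int[m2]_(p in rect a (a + K%:R * h) c (c + K%:R * k)) f p =
  \sum_(x : 'I_K * 'I_K) \int[m2]_(p in cell a h c k x) f p.
Proof.
move=> h0 k0 mf f0.
have mI (x y : R) : measurable (`[x, y[%classic : set mR) by exact: (@measurable_itv R).
have E1 x y u v : rect x y u v = (setT `*` `[u, v[%classic) `&` fst @^-1` `[x, y[%classic.
  by apply/seteqP; split => p; [move=> []|move=> [[]]].
have E2 x y u v : rect x y u v = (`[x, y[%classic `*` setT) `&` snd @^-1` `[u, v[%classic.
  by apply/seteqP; split => p; [move=> []|move=> [[]]].
rewrite E1 (integral_slices _ _ _ measurable_fst)//; last exact: measurableX.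
rewrite -(pair_bigA _ (fun i j => \int[m2]_(p in cell a h c k (i, j)) f p))/=.
apply: eq_bigr => i _; rewrite -E1 E2 (integral_slices _ _ _ measurable_snd)//; last exact: measurableX.
by apply: eq_bigr => j _; rewrite -E2.
Qed.

Lemma cell_sub (K : nat) (a h c k : R) (x : 'I_K * 'I_K) : (0 <= h)%R -> (0 <= k)%R ->
  cell a h c k x `<=` rect a (a + K%:R * h) c (c + K%:R * k).
Proof.
case: x => i j h0 k0 p [/=]; rewrite !in_itv/= => /andP[h1 h2] /andP[h3 h4].
have le (l : 'I_K) (w : R) : (0 <= w)%R -> (l.+1%:R * w <= K%:R * w)%R.
  by move=> w0; rewrite ler_wpM2r// ler_nat.
split; rewrite /= in_itv/=; apply/andP; split.
- by rewrite (le_trans _ h1)// lerDl mulr_ge0.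
- by rewrite (lt_le_trans h2)// lerD2l le.
- by rewrite (le_trans _ h3)// lerDl mulr_ge0.
- by rewrite (lt_le_trans h4)// lerD2l le.
Qed.

Lemma variation_le (F f : R -> R) (a b x y : R) :
  (forall x : R, is_derive x (1 : R)%R F (f x)) -> continuous f ->
  x \in `[a, b[ -> y \in `[a, b[ ->
  `|F x - F y|%:E <= \int[leb]_(s in `[a, b[) `|f s|%:E.
Proof.
move=> dF cf.
have key (u v : R) : u \in `[a, b[ -> v \in `[a, b[ -> (u <= v)%R ->
    `|F v - F u|%:E <= \int[leb]_(s in `[a, b[) `|f s|%:E.
  rewrite !in_itv/= => /andP[au ub] /andP[av vb] uv.
  apply: (le_trans (FTC_abs uv dF cf)).
  apply: (@rint_subset _ _ R leb) => //.
    by apply: measurableT_comp => //; exact: continuous_measurable_fun.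
  move=> s; rewrite /= !in_itv/= => /andP[h1 h2].
  by rewrite (le_trans au)//= (le_lt_trans h2).
move=> xI yI; have [xy|/ltW yx] := leP x y; last exact: key.
by rewrite distrC; exact: key.
Qed.

Section one.
Variables (psi dr dz : R -> R -> R).
Hypothesis P : profile psi dr dz.

Lemma measurable_absr : measurable_fun setT (fun p : mR * mR => `|dr p.1 p.2|%R : R).
Proof. by apply: measurableT_comp => //; exact: profile_mr P. Qed.
Lemma measurable_absz : measurable_fun setT (fun p : mR * mR => `|dz p.1 p.2|%R : R).
Proof. by apply: measurableT_comp => //; exact: profile_mz P. Qed.
Lemma measurable_abspsi (v : R) : measurable_fun setT (fun p : mR * mR => `|psi p.1 p.2 - v|%R : R).
Proof.
apply: measurableT_comp => //; apply: measurable_funB => //; exact: profile_m P.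
Qed.

(** The sample is psi (r', c), where r' is such that the integral of |dz| along
r = r' exceeds its mean over r' by little; the slack e guarantees that
r' exists. Any (r, z) is reached from (r', c) along a segment in z followed by a
segment in r. *)
Lemma cell_sample (a b c d e : R) : (a < b)%R -> (c < d)%R -> (0 < e)%R ->
  \int[m2]_(p in rect a b c d) `|dz p.1 p.2|%:E < +oo ->
  exists v : R, \int[m2]_(p in rect a b c d) `|psi p.1 p.2 - v|%:E <=
    (b - a)%:E * \int[m2]_(p in rect a b c d) `|dr p.1 p.2|%:E +
    (d - c)%:E * \int[m2]_(p in rect a b c d) `|dz p.1 p.2|%:E + e%:E.
Proof.
move=> ab cd e0 Zoo.
have ba0 : (0 < b - a)%R by rewrite subr_gt0.
have dc0 : (0 < d - c)%R by rewrite subr_gt0.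
have mA : measurable (`[a, b[%classic : set mR) by exact: (@measurable_itv R).
have mB : measurable (`[c, d[%classic : set mR) by exact: (@measurable_itv R).
set Z := (X in _ + _ * X + _); rewrite -/Z in Zoo.
have Z0 : 0 <= Z by apply: rint_ge0.
have Zfin : Z \is a fin_num by rewrite ge0_fin_numE.
have mEz := measurable_absz; have mEr := measurable_absr.
have EmEz : measurable_fun setT (fun p : mR * mR => `|dz p.1 p.2|%:E) by exact/measurable_EFinP.
have EmEr : measurable_fun setT (fun p : mR * mR => `|dr p.1 p.2|%:E) by exact/measurable_EFinP.
have Ez0 (p : mR * mR) : 0 <= `|dz p.1 p.2|%:E by rewrite lee_fin.
have Er0 (p : mR * mR) : 0 <= `|dr p.1 p.2|%:E by rewrite lee_fin.
pose Bz (r : mR) := \int[leb]_(s in `[c, d[) `|dz r s|%:E.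
have mBz : measurable_fun setT Bz.
  by apply: (@measurable_tonelliX1 _ _ (fun p : mR * mR => `|dz p.1 p.2|%:E)).
have ZE : Z = \int[leb]_(r in `[a, b[) Bz r.
  by rewrite /Z; have [-> _] := tonelliX mA mB EmEz Ez0.
have lA : leb `[a, b[%classic = (b - a)%:E by rewrite lebesgue_measure_itv/= lte_fin ab.
have lB : leb `[c, d[%classic = (d - c)%:E by rewrite lebesgue_measure_itv/= lte_fin cd.
pose t := ((fine Z + e / (d - c)) / (b - a))%R.
have [r' r'I Br'] : exists2 r' : R, r' \in `[a, b[ & Bz r' <= t%:E.
  apply: contrapT => /forall2NP h.
  have {}h (r : R) : r \in `[a, b[ -> t%:E <= Bz r.
    by move=> rI; case: (h r) => // /negP; rewrite -ltNge => /ltW.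
  have : t%:E * leb `[a, b[%classic <= Z.
    rewrite -rint_cst// ZE; apply: ge0_le_integral => //.
    - move=> r _; rewrite lee_fin divr_ge0 ?(ltW ba0)// addr_ge0// ?fine_ge0//.
      by rewrite divr_ge0 ?ltW.
    - exact: measurable_funTS.
  rewrite lA -EFinM /t divfK ?gt_eqF// -[leRHS](fineK Zfin) lee_fin gerDl.
  by rewrite leNgt divr_gt0.
exists (psi r' c).
have cI : c \in `[c, d[ by rewrite in_itv/= lexx.
pose Ar (z : mR) := \int[leb]_(s in `[a, b[) `|dr s z|%:E.
have mAr : measurable_fun setT Ar.
  by apply: (@measurable_tonelliX2 _ _ (fun p : mR * mR => `|dr p.1 p.2|%:E)).
have mpsi := measurable_abspsi (psi r' c).
have EmP : measurable_fun setT (fun p : mR * mR => `|psi p.1 p.2 - psi r' c|%:E) by exact/measurable_EFinP.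
have Ep0 (p : mR * mR) : 0 <= `|psi p.1 p.2 - psi r' c|%:E by rewrite lee_fin.
have [_ ->] := tonelliX mA mB EmP Ep0.
have [_ ->] := tonelliX mA mB EmEr Er0.
rewrite -/(Ar _).
have Ar0 z : 0 <= Ar z by apply: rint_ge0.
have Bz0 r : 0 <= Bz r by apply: rint_ge0.
have pt (r z : R) : r \in `[a, b[ -> z \in `[c, d[ -> `|psi r z - psi r' c|%:E <= Ar z + Bz r'.
  move=> rI zI; rewrite -[X in `|X|%:E](subrKA (psi r' z)).
  apply: (@le_trans _ _ (`|psi r z - psi r' z|%:E + `|psi r' z - psi r' c|%:E)).
    by rewrite -EFinD lee_fin ler_normD.
  apply: leeD.
    exact: (variation_le (fun r => profile_dr P r z) (@profile_cr _ _ _ _ P z)).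
  exact: (variation_le (profile_dz P r') (@profile_cz _ _ _ _ P r')).
apply: (@le_trans _ _ (\int[leb]_(z in `[c, d[) ((b - a)%:E * (Ar z + Bz r')))).
  apply: ge0_le_integral => //.
  - by move=> z _; apply: rint_ge0.
  - apply: measurable_funTS.
    by apply: (@measurable_tonelliX2 _ _ (fun p : mR * mR => `|psi p.1 p.2 - psi r' c|%:E)).
  - by apply: measurable_funTS; apply: measurable_funeM; apply: emeasurable_funD.
  move=> z zI; rewrite muleC -lA -integral_cst//; apply: ge0_le_integral => //.
  - by apply: measurable_funTS; exact: (measurableT_comp EmP (measurable_pair2 z)).
  - by move=> r rI; exact: pt.
rewrite ge0_integralZl//; last 3 first.
- by apply: measurable_funTS; apply: emeasurable_funD.
- by move=> z _; rewrite adde_ge0.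
- by rewrite lee_fin ltW.
rewrite ge0_integralD//; last first.
- exact: measurable_funTS.
have -> : \int[leb]_(_ in `[c, d[) Bz r' = Bz r' * (d - c)%:E by rewrite -lB integral_cst.
rewrite ge0_muleDr//; last 2 first.
- by apply: integral_ge0.
- by rewrite mule_ge0// lee_fin ltW.
rewrite -addeA; apply: leeD2l.
apply: (@le_trans _ _ ((b - a)%:E * (t%:E * (d - c)%:E))).
  by apply: lee_wpmul2l; rewrite ?lee_fin ?(ltW ba0)//; apply: lee_wpmul2r; rewrite ?lee_fin ?(ltW dc0).
rewrite -(fineK Zfin) -!EFinM -EFinD lee_fin /t.
rewrite le_eqVlt; apply/orP; left; apply/eqP; field.
by rewrite !gt_eqF.
Qed.

Definition w11_density (p : mR * mR) : R :=
  (`|psi p.1 p.2| + `|dr p.1 p.2| + `|dz p.1 p.2|)%R.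

Lemma measurable_w11_density : measurable_fun setT w11_density.
Proof.
apply: measurable_funD; last exact: measurable_absz.
apply: measurable_funD; last exact: measurable_absr.
by apply: measurableT_comp => //; exact: profile_m P.
Qed.

(** The samples are bounded independently of psi, as the pigeonhole principle
requires, and up to the slacks the total error is proportional to the side lengths
of the cells. *)
Lemma sample_cells (K : nat) (a h c k e M : R) : (0 < h)%R -> (0 < k)%R -> (0 < e)%R ->
  \int[m2]_(p in rect a (a + K%:R * h) c (c + K%:R * k)) (w11_density p)%:E <= M%:E ->
  exists2 v : 'I_K * 'I_K -> R,
    (forall x, `|v x| <= (M + (h * M + k * M + e)) / (h * k))%R &
    \sum_(x : 'I_K * 'I_K) \int[m2]_(p in cell a h c k x) `|psi p.1 p.2 - v x|%:E <=
      (h * M + k * M + K%:R ^+ 2 * e)%:E.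
Proof.
move=> h0 k0 e0 WM; set Q := rect _ _ _ _ in WM.
have mQ : measurable Q by exact: measurable_rect.
have mC (x : 'I_K * 'I_K) : measurable (cell a h c k x) by exact: measurable_rect.
have mw := measurable_w11_density.
have bound (f : mR * mR -> R) A : measurable A -> A `<=` Q -> measurable_fun setT f ->
    (forall p, 0 <= f p <= w11_density p)%R -> \int[m2]_(p in A) (f p)%:E <= M%:E.
  move=> mA AQ mf fw; apply: (le_trans _ WM).
  apply: (@le_trans _ _ (\int[m2]_(p in Q) (f p)%:E)).
    by apply: rint_subset => // p _; have /andP[] := fw p.
  by apply: rint_le => // p _; have /andP[] := fw p.
have wr p : (0 <= `|dr p.1 p.2| <= w11_density p)%R.
  by rewrite normr_ge0 /w11_density -addrA addrCA lerDl addr_ge0.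
have wz p : (0 <= `|dz p.1 p.2| <= w11_density p)%R.
  by rewrite normr_ge0 /w11_density lerDr addr_ge0.
have wp p : (0 <= `|psi p.1 p.2| <= w11_density p)%R.
  by rewrite normr_ge0 /w11_density -addrA lerDl addr_ge0.
have mr := measurable_absr; have mz := measurable_absz.
have mp : measurable_fun setT (fun p : mR * mR => `|psi p.1 p.2|%R : R).
  by apply: measurableT_comp => //; exact: profile_m P.
have CQ (x : 'I_K * 'I_K) : cell a h c k x `<=` Q.
  exact: (@cell_sub K a h c k x (ltW h0) (ltW k0)).
have /choice[v Hv] : forall x : 'I_K * 'I_K, exists v : R,
    \int[m2]_(p in cell a h c k x) `|psi p.1 p.2 - v|%:E <=
    h%:E * \int[m2]_(p in cell a h c k x) `|dr p.1 p.2|%:E +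
    k%:E * \int[m2]_(p in cell a h c k x) `|dz p.1 p.2|%:E + e%:E.
  move=> x; have lt (l : nat) (u w : R) : (0 < w)%R -> (u + l%:R * w < u + l.+1%:R * w)%R.
    by move=> w0; rewrite ltrD2l ltr_pM2r// ltr_nat.
  have width (l : nat) (u w : R) : (u + l.+1%:R * w - (u + l%:R * w) = w)%R.
    by rewrite -natr1; ring.
  have fz : \int[m2]_(p in cell a h c k x) `|dz p.1 p.2|%:E < +oo.
    by apply: (@le_lt_trans _ _ M%:E); rewrite ?ltry//; apply: bound.
  have [v Hv] := cell_sample (lt x.1 a h h0) (lt x.2 c k k0) e0 fz.
  by exists v; rewrite !width in Hv.
have hk0 : (0 < h * k)%R by rewrite mulr_gt0.
exists v => [x|].
  rewrite ler_pdivlMr// -lee_fin EFinM.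
  have Ca : m2 (cell a h c k x) = (h * k)%:E.
    rewrite /cell rect_area; last 2 first.
    - by rewrite lerD2l ler_wpM2r ?(ltW h0)// ler_nat.
    - by rewrite lerD2l ler_wpM2r ?(ltW k0)// ler_nat.
    by congr (_%:E); rewrite -!natr1; ring.
  rewrite -Ca -rint_cst//.
  apply: (@le_trans _ _ (\int[m2]_(p in cell a h c k x)
      (`|psi p.1 p.2| + `|psi p.1 p.2 - v x|)%:E)).
    apply: rint_le => //.
      by apply: measurable_funD => //; exact: measurable_abspsi.
    by move=> p _; rewrite -[X in (`|X| <= _)%R](subKr (psi p.1 p.2)) (le_trans (ler_normB _ _)).
  rewrite rintD//; last exact: measurable_abspsi.
  rewrite EFinD; apply: leeD; first exact: bound.
  apply: (le_trans (Hv x)); rewrite !EFinD !EFinM; apply: leeD2r; apply: leeD.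
    by rewrite lee_wpmul2l ?lee_fin ?(ltW h0)//; exact: bound.
  by rewrite lee_wpmul2l ?lee_fin ?(ltW k0)//; exact: bound.
apply: (le_trans (lee_sum _ (fun x _ => Hv x))).
rewrite !big_split/= -!ge0_sume_distrr; last 2 first.
- by move=> x _; apply: rint_ge0.
- by move=> x _; apply: rint_ge0.
rewrite !EFinD !EFinM; apply: leeD; first apply: leeD.
- rewrite lee_wpmul2l ?lee_fin ?(ltW h0)// -(@split_cells K a h c k _ (ltW h0) (ltW k0))//; first exact: bound.
  exact/measurable_EFinP.
- rewrite lee_wpmul2l ?lee_fin ?(ltW k0)// -(@split_cells K a h c k _ (ltW h0) (ltW k0))//; first exact: bound.
  exact/measurable_EFinP.
rewrite sumEFin lee_fin sumr_const card_prod card_ord -[(e *+ _)%R]mulr_natl natrM.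
exact: lexx.
Qed.

End one.

(** On sufficiently small cells each function is close in L^1 to the step function
of its samples. By [pigeon_reals] a subsequence has nearly equal samples. *)
Lemma W11_compact (a b c d M e : R) (psi dr dz : nat -> R -> R -> R) :
  (a < b)%R -> (c < d)%R -> (forall j, profile (psi j) (dr j) (dz j)) ->
  (forall j, \int[m2]_(p in rect a b c d) (w11_density (psi j) (dr j) (dz j) p)%:E <= M%:E) ->
  (0 < e)%R ->
  exists2 s : nat -> nat, {homo s : i j / (i < j)%N} &
    forall i j, \int[m2]_(p in rect a b c d)
      `|psi (s i) p.1 p.2 - psi (s j) p.1 p.2|%:E <= e%:E.
Proof.
move=> ab cd P WM e0.
have M0 : (0 <= M)%R.
  rewrite -lee_fin; apply: le_trans (WM 0%N); apply: rint_ge0 => p _.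
  by rewrite !addr_ge0.
have ba0 : (0 < b - a)%R by rewrite subr_gt0.
have dc0 : (0 < d - c)%R by rewrite subr_gt0.
(* the number K >= x0 of cells per side makes h M + k M at most e / 8 *)
pose x0 := (((b - a) + (d - c)) * M * 8 / e)%R.
pose K := (Num.truncn x0).+1.
have K0 : (0 < K%:R :> R)%R by rewrite ltr0n.
have xK : (x0 <= K%:R)%R.
  have x00 : (0 <= x0)%R.
    apply: divr_ge0 (ltW e0); apply: mulr_ge0 => //; apply: mulr_ge0 => //.
    by rewrite addr_ge0// ltW.
  by have /andP[_ /ltW] := truncn_itv x00.
pose h := ((b - a) / K%:R)%R; pose k := ((d - c) / K%:R)%R.
have h0 : (0 < h)%R by rewrite divr_gt0.
have k0 : (0 < k)%R by rewrite divr_gt0.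
have bE : b = (a + K%:R * h)%R by rewrite /h mulrC divfK ?gt_eqF// addrC subrK.
have dE : d = (c + K%:R * k)%R by rewrite /k mulrC divfK ?gt_eqF// addrC subrK.
rewrite bE dE in WM *.
(* e is spent as follows: for each of the two functions e / 8 on the sides of
   the cells and e / 8 on the slacks e1, and e / 2 on the distance of the samples *)
pose e1 := (e / 8 / K%:R ^+ 2)%R.
have e10 : (0 < e1)%R by rewrite !divr_gt0// exprn_gt0.
have /choice[v Hv] : forall j, exists v : 'I_K * 'I_K -> R,
    (forall x, `|v x| <= (M + (h * M + k * M + e1)) / (h * k))%R /\
    \sum_(x : 'I_K * 'I_K) \int[m2]_(p in cell a h c k x) `|psi j p.1 p.2 - v x|%:E <=
      (h * M + k * M + K%:R ^+ 2 * e1)%:E.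
  by move=> j; have [w w1 w2] := sample_cells (P j) h0 k0 e10 (WM j); exists w.
pose del := (e / 2 / ((b - a) * (d - c)))%R.
have del0 : (0 < del)%R by rewrite !divr_gt0// mulr_gt0.
have [s sincr sv] := pigeon_reals del0 (fun j x => (Hv j).1 x).
exists s => // i j.
have mp l w : measurable_fun setT (fun p : mR * mR => `|psi l p.1 p.2 - w|%R : R).
  exact: measurable_abspsi (P l) w.
have mpp : measurable_fun setT
    (fun p : mR * mR => `|psi (s i) p.1 p.2 - psi (s j) p.1 p.2|%R : R).
  by apply: measurableT_comp => //; apply: measurable_funB; [exact: profile_m (P (s i))|exact: profile_m (P (s j))].
rewrite (@split_cells K a h c k _ (ltW h0) (ltW k0))//; last exact/measurable_EFinP.
have area (x : 'I_K * 'I_K) : m2 (cell a h c k x) = (h * k)%:E.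
  rewrite /cell rect_area; last 2 first.
  - by rewrite lerD2l ler_wpM2r ?(ltW h0)// ler_nat.
  - by rewrite lerD2l ler_wpM2r ?(ltW k0)// ler_nat.
  by congr (_%:E); rewrite -!natr1; ring.
apply: (@le_trans _ _ (\sum_(x : 'I_K * 'I_K)
   (\int[m2]_(p in cell a h c k x) `|psi (s i) p.1 p.2 - v (s i) x|%:E +
    \int[m2]_(p in cell a h c k x) `|psi (s j) p.1 p.2 - v (s j) x|%:E + (del * (h * k))%:E))).
  apply: lee_sum => x _.
  have mC : measurable (cell a h c k x) by exact: measurable_rect.
  rewrite EFinM -(area x) -rint_cst// -rintD//.
  rewrite -rintD//; [|exact: measurable_funD|by move=> p _; exact: ltW].
  apply: rint_le => //.
    by apply: measurable_funD => //; exact: measurable_funD.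
  move=> p _; have := sv i j x.
  set A := psi _ _ _; set B := psi _ _ _; set va := v _ _; set vb := v _ _ => sx.
  have -> : (A - B = (A - va) - (B - vb) + (va - vb))%R by ring.
  by rewrite (le_trans (ler_normD _ _))// lerD// ler_normB.
rewrite big_split big_split.
apply: (le_trans (leeD (leeD (Hv (s i)).2 (Hv (s j)).2) (lexx _))).
rewrite sumEFin -!EFinD lee_fin sumr_const card_prod card_ord -[(_ *+ (K * K))%R]mulr_natl natrM.
have h1 : (h * M + k * M <= e / 8)%R.
  have -> : (h * M + k * M = ((b - a) + (d - c)) * M / K%:R)%R by rewrite /h /k; field; rewrite gt_eqF.
  rewrite ler_pdivrMr//; move: xK; rewrite /x0 ler_pdivrMr//; lra.
have h2 : (K%:R ^+ 2 * e1 = e / 8)%R by rewrite /e1 mulrC divfK// gt_eqF// exprn_gt0.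
have h3 : (K%:R * K%:R * (del * (h * k)) = e / 2)%R.
  by rewrite /del /h /k; field; rewrite !gt_eqF.
rewrite h2 h3; lra.
Qed.

End W11.

(** * Compactness in L^1 of H-bounded sets of test functions *)

Section rellich.
Context {R : realType}.
Local Notation leb := (@lebesgue_measure R).
Local Notation mR := (measurableTypeR R).
Local Notation m2 := (leb \x leb)%E.
Variables (n : nat) (n1 : (1 < n)%N) (alpha : R) (alpha0 : 0 < alpha).
Let n0 : (0 < n)%N := ltnW n1.
Local Notation RN := 'rV[R]_(n + n).
Local Notation mu := (@ball_measure R (n + n)).
Local Notation psi_ phi := (psi_of n0 phi).
Local Notation dr_ phi := (dr_of n0 phi).
Local Notation dz_ phi := (dz_of n0 phi).

Lemma zweight_lb (a b z : R) : 0 < a -> a <= z -> z <= b ->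
  a ^+ n.-1 / (1 + b ^+ 2) ^+ n <= zweight n z.
Proof.
move=> a0 az zb; have z0 : 0 < z := lt_le_trans a0 az.
rewrite /zweight /ppow (max_idPl (ltW z0)).
apply: ler_pM.
- by rewrite exprn_ge0// ltW.
- by rewrite invr_ge0 exprn_ge0// ltW// one_plus_sqr_gt0.
- by rewrite lerXn2r// nnegrE ltW.
rewrite lef_pV2 ?posrE ?exprn_gt0 ?one_plus_sqr_gt0//.
rewrite lerXn2r ?nnegrE ?(ltW (one_plus_sqr_gt0 _))// lerD2l lerXn2r// nnegrE ltW//.
exact: lt_le_trans zb.
Qed.

Lemma zweight_le1 (z : R) : zweight n z <= 1.
Proof.
rewrite /zweight /ppow ler_pdivrMr ?exprn_gt0 ?one_plus_sqr_gt0// mul1r.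
set y := Num.max _ _; have y0 : 0 <= y by rewrite le_max lexx orbT.
have yz : y <= 1 + z ^+ 2.
  rewrite /y ge_max (ltW (one_plus_sqr_gt0 _)) andbT.
  have := sqr_ge0 (z - 1); have := sqr_ge0 z; rewrite !expr2; nra.
apply: (@le_trans _ _ ((1 + z ^+ 2) ^+ n.-1)).
  by rewrite lerXn2r// nnegrE// ltW// one_plus_sqr_gt0.
by rewrite ler_weXn2l ?leq_pred// lerDl sqr_ge0.
Qed.

Lemma rzweight_le1 (p : mR * mR) : rzweight n p <= 1.
Proof.
rewrite /rzweight; case: ltP => r1; last by rewrite mulr0.
rewrite mulr1 -[leRHS]mulr1.
apply: ler_pM; [exact: ppow_ge0|exact: zweight_ge0| |exact: zweight_le1].
by rewrite /ppow exprn_ile1// ?le_max ?lexx ?orbT// ge_max ler01 ltW.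
Qed.

Lemma powR_le1 (x a : R) : 0 <= x -> x <= 1 -> 0 <= a -> x `^ a <= 1.
Proof.
move=> x0 x1 a0; have := @ge0_ler_powR R a a0 x 1; rewrite powR1 !nnegrE.
exact.
Qed.

Local Open Scope ereal_scope.

(** Reduces a bound by the H norm on a region to a pointwise comparison, which is
available where the weight is bounded below. *)
Lemma dominated_energy_le : exists2 K : R, (0 < K)%R &
  forall (phi : RN -> R) (A : set (mR * mR)) (f : mR * mR -> R) (k : R), H_test phi ->
  measurable A -> measurable_fun setT f -> (0 <= k)%R ->
  (forall p, A p -> 0 <= f p)%R ->
  (forall p, A p ->
    f p <= k * (rz_energy alpha (psi_ phi) (dr_ phi) (dz_ phi) p * rzweight n p))%R ->
  \int[m2]_(p in A) (f p)%:E <= (k * K)%:E * Hsq alpha phi (gradient phi).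
Proof.
have [K K0 KE] := weighted_energy_le n1 alpha; exists K => // phi A f k tphi mA mf k0 f0 fk.
have mEW : measurable_fun setT (fun p =>
    rz_energy alpha (psi_ phi) (dr_ phi) (dz_ phi) p * rzweight n p)%R.
  apply: measurable_funM; last exact: measurable_rzweight.
  exact: measurable_rz_energy (test_profile n0 tphi).
have EW0 p : (0 <= rz_energy alpha (psi_ phi) (dr_ phi) (dz_ phi) p * rzweight n p)%R.
  by rewrite mulr_ge0 ?rz_energy_ge0 ?rzweight_ge0.
rewrite EFinM -muleA; apply: (@le_trans _ _ (k%:E * \int[m2]_(p in A)
    (rz_energy alpha (psi_ phi) (dr_ phi) (dz_ phi) p * rzweight n p)%:E)).
  by rewrite -rintZ//; apply: rint_le => //; exact: measurable_funM.
by rewrite lee_wpmul2l// (le_trans _ (KE phi tphi))//; exact: rint_subset.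
Qed.

Lemma strip_energy_le : exists2 K : R, (0 < K)%R & forall phi : RN -> R, H_test phi ->
  strip_energy (n + n)%:R alpha (psi_ phi) (dr_ phi) (dz_ phi) <=
  K%:E * Hsq alpha phi (gradient phi).
Proof.
have [K1 K10 K1E] := dominated_energy_le.
pose c : R := (2^-1 ^+ n.-1 / (1 + 1 ^+ 2) ^+ n)%R.
have c0 : (0 < c)%R by rewrite divr_gt0// exprn_gt0.
exists (c^-1 * K1)%R; first by rewrite mulr_gt0// invr_gt0.
move=> phi tphi; apply: K1E => //.
- exact: measurable_strip.
- exact: measurable_energy_density (test_profile n0 tphi).
- by rewrite invr_ge0 ltW.
- by move=> p _; exact: energy_density_ge0.
move=> [r z] [/=]; rewrite !in_itv/= => /andP[r0 r1] /andP[z2 z1].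
rewrite /rzweight /= r1 mulr1.
have half0 : (0 < 2^-1 :> R)%R by rewrite invr_gt0.
have cz : (1 <= c^-1 * zweight n z)%R.
  by rewrite mulrC ler_pdivlMr// mul1r; exact: zweight_lb.
set E := rz_energy _ _ _ _ _; have E0 : (0 <= E)%R by exact: rz_energy_ge0.
have rn : (r `^ ((n + n)%:R - 1) = r ^+ (n + n).-1)%R.
  rewrite -powR_mulrn ?(ltW r0)//; congr (_ `^ _)%R.
  by rewrite -(@natrB _ _ 1) ?subn1// ltn_addr// ltnW.
apply: (@le_trans _ _ (r ^+ (n + n).-1 * E)%R).
  rewrite /energy_density /E /rz_energy/= -rn !mulrDr.
  have r3 : (r `^ ((n + n)%:R - 3) = r `^ ((n + n)%:R - 1) / r ^+ 2)%R.
    rewrite -(powR_mulrn 2 (ltW r0)) -powRN -powRD ?(gt_eqF r0) ?implybT//.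
    by congr (_ `^ _)%R; lra.
  have ra : (r `^ ((n + n)%:R - 1 - alpha) = r `^ ((n + n)%:R - 1) / r `^ alpha)%R.
    by rewrite -powRN -powRD ?(gt_eqF r0) ?implybT.
  rewrite r3 ra; set w := (r `^ _)%R; have w0 : (0 <= w)%R by exact: powR_ge0.
  apply: lerD; last by rewrite le_eqVlt; apply/orP; left; apply/eqP; ring.
  have -> : (w / r ^+ 2 * dz_ phi r z ^+ 2 = w * (dz_ phi r z ^+ 2 / r ^+ 2))%R by ring.
  rewrite lerD2l ler_wpM2l// ler_wpM2r ?invr_ge0 ?sqr_ge0//.
  rewrite exprMn ler_peMl ?sqr_ge0// exprn_ege1// lerDl sqr_ge0//.
rewrite /ppow (max_idPl (ltW r0)) mulrA [leRHS]mulrC mulrAC -mulrA mulrA.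
set w := (r ^+ _)%R; have w0 : (0 <= w)%R by rewrite exprn_ge0// ltW.
rewrite -[leLHS]mulr1.
have -> : (w * (c^-1 * E) * zweight n z = (w * E) * (c^-1 * zweight n z))%R by ring.
by rewrite ler_wpM2l// mulr_ge0.
Qed.

(** |y| <= 1 + y^2 makes the quadratic energy control the W^{1,1} norm, as the
rectangle has finite area and all the weights are bounded below on it. *)
Lemma rect_w11_le (a D : R) : (0 < a)%R -> (a < 1)%R -> exists M : R, forall phi : RN -> R,
  H_test phi -> Hsq alpha phi (gradient phi) <= D%:E ->
  \int[m2]_(p in rect a 1 a a^-1) (w11_density (psi_ phi) (dr_ phi) (dz_ phi) p)%:E <= M%:E.
Proof.
move=> a0 a1.
pose c : R := (a ^+ (n + n).-1 * (a ^+ n.-1 / (1 + a^-1 ^+ 2) ^+ n))%R.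
have c0 : (0 < c)%R by rewrite mulr_gt0 ?divr_gt0 ?exprn_gt0 ?one_plus_sqr_gt0.
have a1' : (a <= a^-1)%R by rewrite (@le_trans _ _ 1%R) ?ltW// invf_gt1.
have cw p : rect a 1 a a^-1 p -> (c <= rzweight n p)%R.
  case: p => r z [/=]; rewrite !in_itv/= => /andP[ar r1] /andP[az za].
  rewrite /rzweight /= r1 mulr1; apply: ler_pM.
  - by rewrite exprn_ge0// ltW.
  - by rewrite divr_ge0 ?exprn_ge0 ?(ltW a0) ?(ltW (one_plus_sqr_gt0 _)).
  - rewrite /ppow (max_idPl _) ?(le_trans (ltW a0))// lerXn2r// nnegrE ?(le_trans (ltW a0))//.
  - by apply: zweight_lb => //; exact: ltW.
have mQ := @measurable_rect R a 1 a a^-1.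
have [K K0 KE] := dominated_energy_le.
exists (3 * ((1 - a) * (a^-1 - a)) + c^-1 * K * D)%R => phi tphi HD.
have P := test_profile n0 tphi.
have mE := measurable_rz_energy alpha P.
apply: (@le_trans _ _ (\int[m2]_(p in rect a 1 a a^-1)
   (3 + rz_energy alpha (psi_ phi) (dr_ phi) (dz_ phi) p)%:E)).
  apply: rint_le => //.
  - exact: measurable_w11_density.
  - exact: measurable_funD.
  - by move=> p _; rewrite /w11_density !addr_ge0.
  move=> [r z] [/=]; rewrite !in_itv/= => /andP[ar r1] /andP[az za].
  have r0 : (0 < r)%R := lt_le_trans a0 ar.
  have sq (y : R) : (`|y| <= 1 + y ^+ 2)%R.
    rewrite -[X in (_ <= 1 + X)%R]real_normK ?num_real//.
    by have := sqr_ge0 (`|y| - 1)%R; have := sqr_ge0 `|y|%R; rewrite !expr2; nra.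
  rewrite /w11_density /rz_energy /=.
  have h1 : (psi_ phi r z ^+ 2 <= psi_ phi r z ^+ 2 / r `^ alpha)%R.
    rewrite ler_peMr ?sqr_ge0// invf_ge1 ?powR_gt0//.
    by apply: powR_le1; exact: ltW.
  have h2 : (dz_ phi r z ^+ 2 <= ((1 + z ^+ 2) * dz_ phi r z) ^+ 2 / r ^+ 2)%R.
    rewrite ler_pdivlMr ?exprn_gt0// exprMn mulrC ler_wpM2r ?sqr_ge0//.
    rewrite (@le_trans _ _ 1%R)//; first by rewrite exprn_ile1 ?ltW.
    by rewrite exprn_ege1// lerDl sqr_ge0.
  have := sq (psi_ phi r z); have := sq (dr_ phi r z); have := sq (dz_ phi r z).
  move: h1 h2; lra.
rewrite rintD//; last by move=> p _; exact: rz_energy_ge0.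
have RA : m2 (rect a 1 a a^-1) = ((1 - a) * (a^-1 - a))%:E by rewrite rect_area// ltW.
have -> : (3 * ((1 - a) * (a^-1 - a)) + c^-1 * K * D)%:E =
    3%:E * m2 (rect a 1 a a^-1) + (c^-1 * K * D)%:E.
  by rewrite RA -EFinM -EFinD.
rewrite -rint_cst//; apply: leeD2l.
apply: (@le_trans _ _ ((c^-1 * K)%:E * Hsq alpha phi (gradient phi))); last first.
  by rewrite [leRHS]EFinM lee_wpmul2l// lee_fin mulr_ge0 ?invr_ge0// ltW.
apply: KE => //.
- by rewrite invr_ge0 ltW.
- by move=> p _; exact: rz_energy_ge0.
move=> p Qp; rewrite mulrCA ler_peMr ?rz_energy_ge0//.
by rewrite mulrC ler_pdivlMr// mul1r cw.
Qed.

Lemma ball_ae_enorm : {ae mu, forall x : RN, (0 < enorm x < 1)%R}.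
Proof.
have b1 : {ae mu, forall x : RN, (enorm x < 1)%R}.
  exists (~` @unit_ball R (n + n)); split.
  - by apply: measurableC; exact: measurable_unit_ball.
  - by rewrite /ball_measure /= /mrestr setICl measure0.
  - by move=> x /=.
apply: filterS2 (ball_ae_z_gt0 n1) b1 => x [s0 _] x1.
by rewrite x1 andbT; exact: enorm_gt0_s.
Qed.

(** |x|^-alpha >= 1 on the ball. *)
Lemma L2_le_Hsq (u : RN -> R) G : measurable_fun setT u -> measurable_fun setT G ->
  \int[mu]_x (u x ^+ 2)%:E <= Hsq alpha u G.
Proof.
move=> mu_ mG; apply: ae_ge0_le_integral => //.
- by move=> x _; rewrite lee_fin sqr_ge0.
- by apply/measurable_EFinP; exact: measurable_funX.
- by move=> x _; rewrite lee_fin Hsq_density_ge0.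
- by apply/measurable_EFinP; exact: measurable_Hsq_density.
apply: filterS ball_ae_enorm => x /andP[x0 x1] _; rewrite lee_fin.
rewrite (@le_trans _ _ (u x ^+ 2 / enorm x `^ alpha)%R) ?lerDr ?sqr_ge0//.
rewrite ler_peMr ?sqr_ge0// invf_ge1 ?powR_gt0//.
by apply: powR_le1; exact: ltW.
Qed.

(** The shift by 2 keeps the lower bounds below 1. *)
Definition core (k : nat) : set (mR * mR) := rect k.+2%:R^-1 1 k.+2%:R^-1 (k.+2%:R^-1)^-1.

Lemma core_exhaust : mu (~` (@rz_coord R n @^-1` core k)) @[k --> \oo] --> 0.
Proof.
have mA k : measurable (~` (@rz_coord R n @^-1` core k)).
  apply: measurableC; rewrite -[X in measurable X]setTI.
  by apply: measurable_rz_coord => //; exact: measurable_rect.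
have -> : 0 = mu (\bigcap_k (~` (@rz_coord R n @^-1` core k))).
  apply/esym; have : mu.-negligible (\bigcap_k (~` (@rz_coord R n @^-1` core k))).
    have [N [mN N0 NE]] : {ae mu, forall x : RN, (0 < enorm x < 1)%R /\
        ((0 < s_coord x)%R /\ (0 < t_coord x)%R)}.
      by apply: filterS2 ball_ae_enorm (ball_ae_z_gt0 n1).
    exists N; split => // x Ax; apply: NE => -[/andP[x0 x1] [s0 t0]].
    have z0 : (0 < t_coord x / s_coord x)%R by rewrite divr_gt0.
    set z := (t_coord x / s_coord x)%R in z0.
    (* bounds 1 / r, 1 / z and z at once *)
    pose y : R := ((enorm x)^-1 + z^-1 + z)%R.
    have y0 : (0 <= y)%R by rewrite !addr_ge0 ?invr_ge0 ?ltW.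
    apply: (Ax (Num.truncn y)) => //.
    have /andP[_ yk] := truncn_itv y0.
    have {}yk : (y < (Num.truncn y).+2%:R)%R by rewrite (lt_le_trans yk)// ler_nat.
    have k0 : (0 < (Num.truncn y).+2%:R :> R)%R by rewrite ltr0n.
    have ei : (0 < (enorm x)^-1)%R by rewrite invr_gt0.
    have zi : (0 < z^-1)%R by rewrite invr_gt0.
    split; rewrite /= in_itv/= ?x1 ?andbT ?invrK -/z.
      rewrite -[leRHS]invrK lef_pV2 ?posrE//; move: yk; rewrite /y; lra.
    apply/andP; split; last by move: yk; rewrite /y; lra.
    by rewrite -[leRHS]invrK lef_pV2 ?posrE//; move: yk; rewrite /y; lra.
  by move=> h; apply/negligibleP => //; exact: bigcapT_measurable.
apply: nonincreasing_cvg_mu => //.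
- by apply: le_lt_trans (ball_finite n); apply: le_measure; rewrite ?inE.
- exact: bigcapT_measurable.
move=> i j ij; apply/subsetPset/subsetC => x [/=]; rewrite !in_itv/= !invrK => /andP[h1 h1'] /andP[h2 h3].
have ijR : (i.+2%:R <= j.+2%:R :> R)%R by rewrite ler_nat.
have inv : (j.+2%:R^-1 <= i.+2%:R^-1 :> R)%R by rewrite lef_pV2 ?posrE ?ltr0n.
split; rewrite /= in_itv/= ?invrK ?h1' ?andbT.
  exact: le_trans h1.
by rewrite (le_trans inv h2) (lt_le_trans h3).
Qed.

(** [T k] is a chain of nested extractions, and the diagonal T i i is, from rank k
on, an extraction of T k. *)
Lemma diagonal_subsequence (d : nat -> nat -> \bar R) :
  (forall e : R, (0 < e)%R -> forall t : nat -> nat, {homo t : i j / (i < j)%N} ->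
    exists2 s : nat -> nat, {homo s : i j / (i < j)%N} &
      forall i j, d (t (s i)) (t (s j)) <= e%:E) ->
  exists2 s : nat -> nat, {homo s : i j / (i < j)%N} &
    forall k i j, (k <= i)%N -> (k <= j)%N -> d (s i) (s j) <= (2^-1 ^+ k)%:E.
Proof.
move=> H.
have /choice[F HF] : forall x : nat * (nat -> nat), exists s : nat -> nat,
    {homo x.2 : i j / (i < j)%N} -> {homo s : i j / (i < j)%N} /\
      forall i j, d (x.2 (s i)) (x.2 (s j)) <= (2^-1 ^+ x.1)%:E.
  move=> [k t]; have [ht|nt] := pselect {homo t : i j / (i < j)%N}; last by exists id.
  have e0 : (0 < 2^-1 ^+ k :> R)%R by rewrite exprn_gt0// invr_gt0.
  by have [s s1 s2] := H _ e0 t ht; exists s.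
pose T := fix T k := if k is k'.+1 then T k' \o F (k, T k') else id \o F (0%N, id).
have TI k : {homo T k : i j / (i < j)%N}.
  elim: k => [|k IH] i j ij /=.
    by have [] := HF (0%N, id) (fun i j ij => ij) => + _; exact.
  by apply: (IH); have [+ _] := HF (k.+1, T k) IH; exact.
have TD k i j : d (T k i) (T k j) <= (2^-1 ^+ k)%:E.
  case: k => [|k] /=.
    by have [_] := HF (0%N, id) (fun i j ij => ij); exact.
  by have [_] := HF (k.+1, T k) (TI k); exact.
have ge_id (s : nat -> nat) : {homo s : i j / (i < j)%N} -> forall i, (i <= s i)%N.
  by move=> hs; elim=> // i IH; apply: (leq_ltn_trans IH); exact: hs.
have TS k m : exists g : nat -> nat, T (k + m)%N = T k \o g.
  elim: m => [|m [g gE]]; first by exists id; rewrite addn0.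
  by rewrite addnS /= gE; exists (g \o F ((k + m).+1, T k \o g)).
exists (fun i => T i i) => [|k i j ki kj].
  apply: homo_ltn; first exact: ltn_trans.
  move=> i /=; apply: (TI); have [hs _] := HF (i.+1, T i) (TI i).
  exact: (leq_trans _ (ge_id _ hs i.+1)).
have [g gE] := TS k (i - k)%N; have [h hE] := TS k (j - k)%N.
by rewrite subnKC// in gE; rewrite subnKC// in hE; rewrite gE hE; exact: TD.
Qed.

(** On the core the distance is that of the profiles, and [W11_compact] applies.
Off the core, |w| <= eta w^2 + 1 / eta, where the L^2 norm is bounded and the
measure is small. *)
Lemma rellich_step (D e : R) (phi : nat -> RN -> R) : (0 < e)%R ->
  (forall j, H_test (phi j)) ->
  (forall j, Hsq alpha (phi j) (gradient (phi j)) <= D%:E) ->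
  exists2 s : nat -> nat, {homo s : i j / (i < j)%N} &
    forall i j, \int[mu]_x `|phi (s i) x - phi (s j) x|%:E <= e%:E.
Proof.
move=> e0 tphi HD.
have D0 : (0 <= D)%R by rewrite -lee_fin; apply: le_trans (HD 0%N); exact: Hsq_ge0.
have [C C0 CE] := @ball_polar R n n1.
(* eta is small against the squares, whose integrals are at most 4 D; the
   measure of A is then taken small against 1 / eta *)
pose eta := (e / (16 * (D + 1)))%R.
have D1 : (0 < D + 1)%R by rewrite ltr_wpDl.
have eta0 : (0 < eta)%R by rewrite divr_gt0// mulr_gt0.
have [k Ak] : exists k, mu (~` (@rz_coord R n @^-1` core k)) <= (eta * e / 4)%:E.
  have h0 : (0 < eta * e / 4)%R by rewrite divr_gt0// mulr_gt0.
  have /fine_cvgP[fA /cvgrPdist_le/(_ _ h0)] := core_exhaust.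
  move=> /(filterI fA)[k _ /(_ k (leqnn k))[/= fk]].
  rewrite sub0r normrN ger0_norm ?fine_ge0// => h; exists k.
  by rewrite -[leLHS]fineK// lee_fin.
set A := ~` _ in Ak.
have mcore : measurable (core k) by exact: measurable_rect.
have mA : measurable A.
  apply: measurableC; rewrite -[X in measurable X]setTI.
  exact: measurable_rz_coord.
have a0 : (0 < k.+2%:R^-1 :> R)%R by rewrite invr_gt0 ltr0n.
have a1 : (k.+2%:R^-1 < 1 :> R)%R by rewrite invf_lt1 ?ltr0n// ltr1n.
have [M ME] := rect_w11_le D a0 a1.
have a1' : (k.+2%:R^-1 < (k.+2%:R^-1)^-1 :> R)%R by rewrite (lt_trans a1)// invf_gt1.
have e1 : (0 < e / (2 * C))%R by rewrite divr_gt0// mulr_gt0.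
have [s sincr sE] := W11_compact a1 a1' (fun j => test_profile n0 (tphi j))
  (fun j => ME (phi j) (tphi j) (HD j)) e1.
exists s => // i j.
pose psd := (fun p : mR * mR => `|psi_ (phi (s i)) p.1 p.2 - psi_ (phi (s j)) p.1 p.2|%:E).
have mpsd : measurable_fun setT psd.
  apply/measurable_EFinP; apply: measurableT_comp => //.
  by apply: measurable_funB; [exact: profile_m (test_profile n0 (tphi (s i)))|exact: profile_m (test_profile n0 (tphi (s j)))].
pose g := psd \_ (core k).
have mg : measurable_fun setT g.
  by apply/(measurable_restrictT _ _).1 => //; exact: measurable_funTS.
have g0 p : 0 <= g p by rewrite /g patchE; case: ifP => // _; rewrite lee_fin.
have mphi l : measurable_fun setT (phi l) := measurable_test (tphi l).
have mgrad l : measurable_fun setT (gradient (phi l)) := measurable_gradient (tphi l).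
pose w (x : RN) := (phi (s i) x - phi (s j) x)%R.
have mw : measurable_fun setT w by exact: measurable_funB.
have mind : measurable_fun setT (\1_A : RN -> R) by exact: measurable_indic.
have mgx : measurable_fun setT (fun x : RN => g (rz_coord x)).
  by apply: (measurableT_comp mg); exact: measurable_rz_coord.
have mh : measurable_fun setT (fun x : RN => (eta * (2 * phi (s i) x ^+ 2 + 2 * phi (s j) x ^+ 2) + eta^-1 * \1_A x)%R).
  apply: measurable_funD; apply: measurable_funM => //.
  by apply: measurable_funD; apply: measurable_funM => //; exact: measurable_funX.
apply: (@le_trans _ _ (\int[mu]_x (g (rz_coord x) +
    (eta * (2 * phi (s i) x ^+ 2 + 2 * phi (s j) x ^+ 2) + eta^-1 * \1_A x)%:E))).
  apply: ge0_le_integral => //.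
  - by apply/measurable_EFinP; apply: measurableT_comp.
  - by apply: emeasurable_funD => //; exact/measurable_EFinP.
  move=> x _; have eta2 : (0 <= eta * (2 * phi (s i) x ^+ 2 + 2 * phi (s j) x ^+ 2))%R.
    by rewrite mulr_ge0 ?(ltW eta0)// addr_ge0// mulr_ge0// sqr_ge0.
  have eta3 : (0 <= eta^-1 * \1_A x)%R by rewrite mulr_ge0 ?invr_ge0 ?(ltW eta0)// indicE.
  rewrite /g patchE; case: ifPn => [|] /=.
    rewrite inE => -[/=]; rewrite !in_itv/= => _ /andP[az _].
    have s0 : (0 < s_coord x)%R.
      rewrite lt_neqAle enorm_ge0 andbT; apply/eqP => s0.
      by move: az; rewrite -s0 invr0 mulr0 leNgt a0.
    rewrite /psd /= -(phi_psi n0 (tphi (s i)) s0) -(phi_psi n0 (tphi (s j)) s0).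
    by rewrite -EFinD lee_fin lerDl addr_ge0.
  rewrite notin_setE => nx; rewrite add0e lee_fin indicE mem_set//= mulr1.
  set a := phi _ _; set b := phi _ _.
  have ei : (eta * eta^-1 = 1)%R by rewrite divff// gt_eqF.
  have ei0 : (0 < eta^-1)%R by rewrite invr_gt0.
  set y := (`|a - b|)%R; have yE : (y ^+ 2 = (a - b) ^+ 2)%R by rewrite real_normK// num_real.
  have y2 : (y ^+ 2 <= 2 * a ^+ 2 + 2 * b ^+ 2)%R.
    by rewrite yE; have := sqr_ge0 (a + b)%R; rewrite !expr2; lra.
  apply: (@le_trans _ _ (eta * y ^+ 2 + eta^-1)%R); last first.
    by rewrite lerD2r ler_wpM2l// ltW.
  have := sqr_ge0 (eta * y - 1)%R => q.
  have q2 : (0 <= eta^-1 * (eta * y - 1) ^+ 2)%R by rewrite mulr_ge0// ltW.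
  have qE : (eta^-1 * (eta * y - 1) ^+ 2 = eta * y ^+ 2 - 2 * y + eta^-1)%R.
    have -> : (eta^-1 * (eta * y - 1) ^+ 2 = (eta * eta^-1) * eta * y ^+ 2 - 2 * (eta * eta^-1) * y + eta^-1)%R by ring.
    by rewrite ei; ring.
  have y0 : (0 <= y)%R by exact: normr_ge0.
  move: q2; rewrite qE; lra.
rewrite ge0_integralD//; last 2 first.
- move=> x _; rewrite lee_fin addr_ge0// mulr_ge0 ?invr_ge0 ?(ltW eta0)//.
  by rewrite addr_ge0// mulr_ge0// sqr_ge0.
- exact/measurable_EFinP.
have -> : e%:E = (e / 2)%:E + (e / 4 + e / 4)%:E :> \bar R by rewrite -EFinD; congr (_%:E); field.
apply: leeD.
  rewrite CE//; apply: (@le_trans _ _ (C%:E * (e / (2 * C))%:E)); last first.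
    by rewrite -EFinM lee_fin le_eqVlt; apply/orP; left; apply/eqP; field; rewrite gt_eqF.
  rewrite lee_wpmul2l ?lee_fin ?(ltW C0)//; apply: (le_trans _ (sE i j)).
  rewrite [leRHS]integral_mkcond; apply: ge0_le_integral => //.
  - by move=> p _; rewrite mule_ge0// lee_fin rzweight_ge0.
  - apply: emeasurable_funM => //; apply/measurable_EFinP; exact: measurable_rzweight.
  move=> p _; rewrite -[leRHS]mule1; apply: lee_wpmul2l; first exact: g0.
  by rewrite lee_fin rzweight_le1.
have phi20 l x : (0 <= 2 * phi l x ^+ 2)%R by rewrite mulr_ge0// sqr_ge0.
have mphi2 l : measurable_fun setT (fun x => 2 * phi l x ^+ 2)%R.
  by apply: measurable_funM => //; exact: measurable_funX.
rewrite rintD//; last 4 first.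
- by apply: measurable_funM => //; exact: measurable_funD.
- exact: measurable_funM.
- by move=> x _; rewrite mulr_ge0 ?(ltW eta0)// addr_ge0.
- by move=> x _; rewrite mulr_ge0 ?invr_ge0 ?(ltW eta0)// indicE.
have two l : \int[mu]_x (2 * phi l x ^+ 2)%:E <= (2 * D)%:E.
  rewrite rintZ//; last 2 first.
  - exact: measurable_funX.
  - by move=> x _; exact: sqr_ge0.
  by rewrite EFinM lee_wpmul2l// (le_trans _ (HD l))//; exact: L2_le_Hsq.
rewrite EFinD; apply: leeD.
  rewrite rintZ//; last 3 first.
  - exact: measurable_funD.
  - exact: ltW.
  - by move=> x _; rewrite addr_ge0.
  rewrite rintD//.
  apply: (@le_trans _ _ (eta%:E * ((2 * D)%:E + (2 * D)%:E))).
    by rewrite lee_wpmul2l ?lee_fin ?(ltW eta0)//; apply: leeD.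
  rewrite -EFinD -EFinM lee_fin /eta mulrAC ler_pdivrMr ?mulr_gt0//.
  by move: e0 D0 => ? ?; nra.
rewrite rintZ//; last by rewrite invr_ge0 ltW.
rewrite integral_indic// setIT.
apply: (@le_trans _ _ (eta^-1%:E * (eta * e / 4)%:E)).
  by rewrite lee_wpmul2l// lee_fin invr_ge0 ltW.
rewrite -EFinM lee_fin (_ : (eta^-1 * (eta * e / 4) = e / 4)%R)//.
by field; rewrite gt_eqF.
Qed.

Lemma rellich (D : R) (phi : nat -> RN -> R) :
  (forall j, H_test (phi j)) ->
  (forall j, Hsq alpha (phi j) (gradient (phi j)) <= D%:E) ->
  exists2 s : nat -> nat, {homo s : i j / (i < j)%N} &
    forall k i j, (k <= i)%N -> (k <= j)%N ->
      \int[mu]_x `|phi (s i) x - phi (s j) x|%:E <= (2^-1 ^+ k)%:E.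
Proof.
move=> tphi HD.
apply: (diagonal_subsequence (d := fun i j => \int[mu]_x `|phi i x - phi j x|%:E)) => e e0 t _.
exact: (@rellich_step D e (fun j => phi (t j))).
Qed.

End rellich.

(** * Almost everywhere limits, and approximation in H *)

Section series.
Context {R : realType}.
Local Open Scope ereal_scope.

Lemma nneseries_cvg0 (f : (\bar R)^nat) : (forall k, 0 <= f k) ->
  \sum_(k <oo) f k < +oo -> f k @[k --> \oo] --> 0.
Proof.
move=> f0 foo; have h := nneseries_tail_cvg foo (fun k _ => f0 k).
apply: (squeeze_cvge _ (cvg_cst 0) h).
near=> k; rewrite f0/= (nneseries_split k 1); last by move=> *; exact: f0.
rewrite addn1 big_nat1 leeDl//.
by apply: nneseries_ge0.
Unshelve. all: by end_near.
Qed.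

(** The integral of the sum is the sum of the integrals, at most 2. *)
Lemma ae_nneseries_lty d (T : measurableType d) (mu : {measure set T -> \bar R}) (g : nat -> T -> \bar R) :
  (forall k, measurable_fun setT (g k)) -> (forall k x, 0 <= g k x) ->
  (forall k, \int[mu]_x g k x <= (2^-1 ^+ k)%:E) ->
  {ae mu, forall x, \sum_(k <oo) g k x < +oo}.
Proof.
move=> mg g0 gle.
have mS : measurable_fun setT (fun x => \sum_(k <oo) g k x).
  exact: ge0_emeasurable_sum.
have S0 x : 0 <= \sum_(k <oo) g k x by apply: nneseries_ge0 => k _ _; exact: g0.
have iS : mu.-integrable setT (fun x => \sum_(k <oo) g k x).
  apply/integrableP; split => //.
  under eq_integral => x _ do rewrite gee0_abs//.
  rewrite integral_nneseries//.
  apply: (@le_lt_trans _ _ (\sum_(k <oo) (2 / (2 ^ k.+1)%:R)%:E)); last first.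
    by apply: (le_lt_trans (epsilon_trick0 _ _)); rewrite ?ltry.
  apply: lee_nneseries => [k _ _|k _]; first exact: integral_ge0.
  rewrite (le_trans (gle k))// lee_fin natrX exprS exprVn invfM mulrA divff//.
  by rewrite mul1r.
apply: filterS (integrable_ae measurableT iS) => x /(_ I).
by rewrite ge0_fin_numE.
Qed.

Lemma ae_cvg0 d (T : measurableType d) (mu : {measure set T -> \bar R}) (g : nat -> T -> \bar R) :
  (forall k, measurable_fun setT (g k)) -> (forall k x, 0 <= g k x) ->
  (forall k, \int[mu]_x g k x <= (2^-1 ^+ k)%:E) ->
  {ae mu, forall x, g k x @[k --> \oo] --> 0}.
Proof.
move=> mg g0 gle; apply: filterS (ae_nneseries_lty mg g0 gle) => x.
exact: nneseries_cvg0.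
Qed.

Lemma EFin_cvg0 (f : nat -> R) (l : R) :
  (`|f k - l|%R)%:E @[k --> \oo] --> 0 -> f k @[k --> \oo] --> l.
Proof.
move=> /fine_cvgP[_ h]; apply/cvgrPdist_le => e e0.
move/cvgrPdist_le : h => /(_ _ e0); apply: filterS => k /=.
by rewrite sub0r normrN normr_id distrC.
Qed.

End series.

Section approximation.
Context {R : realType}.
Local Notation leb := (@lebesgue_measure R).
Local Notation mR := (measurableTypeR R).
Local Notation m2 := (leb \x leb)%E.
Variables (n : nat) (n1 : (1 < n)%N) (alpha : R) (alpha0 : 0 < alpha).
Let n0 : (0 < n)%N := ltnW n1.
Local Notation RN := 'rV[R]_(n + n).
Local Notation mu := (@ball_measure R (n + n)).
Local Notation psi_ phi := (psi_of n0 phi).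
Local Notation dz_ phi := (dz_of n0 phi).

Lemma continuous_ball_bounded (g : RN -> R) : continuous g ->
  exists M : R, forall x, enorm x <= 1 -> `|g x| <= M.
Proof.
move=> cg.
have cK : compact [set v : RN | forall i, `[-1, 1]%classic (v ord0 i)].
  by apply: (@rV_compact R _ (fun=> `[-1, 1]%classic)) => i; exact: segment_compact.
have /compact_bounded[M [_ HM]] := continuous_compact (continuous_subspaceT cg) cK.
exists (M + 1) => x x1; apply: (HM (M + 1)); first by rewrite ltrDl.
exists x => // i /=; rewrite in_itv/= -ler_norml.
exact: (le_trans (le_coord_enorm x i)).
Qed.

(** The weight |x|^-alpha is bounded on the support of a test function, which
stays away from the origin. *)
Lemma Hsq_test_lty (phi : RN -> R) : H_test phi -> (Hsq alpha phi (gradient phi) < +oo)%E.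
Proof.
move=> tphi.
have [M HM] := continuous_ball_bounded (test_continuous tphi).
have /choice[Mi HMi] : forall i, exists Mi : R, forall x : RN, enorm x <= 1 -> `|gradient phi x ord0 i| <= Mi.
  move=> i; apply: (@continuous_ball_bounded (fun x => gradient phi x ord0 i)).
  exact: gradient_continuous.
have [d d0 supp] := test_profile_supp n0 tphi.
pose B := \sum_(i < n + n) Mi i ^+ 2 + M ^+ 2 / d `^ alpha.
have dB0 : 0 <= B by rewrite addr_ge0 ?sumr_ge0// ?divr_ge0 ?sqr_ge0 ?powR_ge0// => i _; exact: sqr_ge0.
apply: (@le_lt_trans _ _ (\int[mu]_x B%:E)%E); last first.
  by rewrite rint_cst// lte_mul_pinfty// ?lee_fin//; exact: ball_finite.
apply: ae_ge0_le_integral => //.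
- by move=> x _; rewrite lee_fin Hsq_density_ge0.
- apply/measurable_EFinP; apply: measurable_Hsq_density; [exact: measurable_test|exact: measurable_gradient].
apply: filterS2 (ball_ae_enorm n1) (ball_ae_z_gt0 n1) => x /andP[x0 x1] [s0 t0] _.
have sq (a b : R) : `|a| <= b -> a ^+ 2 <= b ^+ 2.
  by move=> ab; rewrite -[X in X <= _]real_normK ?num_real// lerXn2r// nnegrE (le_trans _ ab).
rewrite lee_fin /B; apply: lerD.
  by rewrite enorm_sqr; apply: ler_sum => i _; apply: sq; apply: HMi; exact: ltW.
have [xd|dx] := leP (enorm x) d.
  rewrite (phi_psi n0 tphi s0) supp ?xd// ?(ltW x0)// expr0n mul0r.
  by rewrite divr_ge0 ?sqr_ge0 ?powR_ge0.
apply: ler_pM; rewrite ?invr_ge0 ?sqr_ge0 ?powR_ge0//.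
  by apply: sq; apply: HM; exact: ltW.
rewrite lef_pV2 ?posrE ?powR_gt0// ge0_ler_powR ?nnegrE ?ltW//.
Qed.

(** From (a - b)^2 <= 2 a^2 + 2 b^2, which replaces the triangle inequality of
the norm at the cost of a constant. *)
Lemma Hsq_sub (u v : RN -> R) (G K : RN -> RN) :
  measurable_fun setT u -> measurable_fun setT v ->
  measurable_fun setT G -> measurable_fun setT K ->
  (Hsq alpha (u \- v)%R (G \- K)%R <= 2%:E * Hsq alpha u G + 2%:E * Hsq alpha v K)%E.
Proof.
move=> mu_ mv mG mK; rewrite /Hsq.
have mU := measurable_Hsq_density alpha mu_ mG.
have mV := measurable_Hsq_density alpha mv mK.
have mm : measurable_fun setT (fun x => enorm ((G \- K) x) ^+ 2 + (u \- v) x ^+ 2 / enorm x `^ alpha).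
  by apply: measurable_Hsq_density; [exact: measurable_funB|exact: measurable_subrV].
have U0 x : 0 <= enorm (G x) ^+ 2 + u x ^+ 2 / enorm x `^ alpha by exact: Hsq_density_ge0.
have V0 x : 0 <= enorm (K x) ^+ 2 + v x ^+ 2 / enorm x `^ alpha by exact: Hsq_density_ge0.
rewrite -!rintZ// -rintD//; last 4 first.
- exact: measurable_funM.
- exact: measurable_funM.
- by move=> x _; rewrite mulr_ge0.
- by move=> x _; rewrite mulr_ge0.
apply: rint_le => //.
- by apply: measurable_funD; exact: measurable_funM.
- by move=> x _; exact: Hsq_density_ge0.
move=> x _; have sq (a b : R) : (a - b) ^+ 2 <= 2 * a ^+ 2 + 2 * b ^+ 2.
  by have := sqr_ge0 (a + b); rewrite !expr2; lra.
have h1 : enorm ((G \- K) x) ^+ 2 <= 2 * enorm (G x) ^+ 2 + 2 * enorm (K x) ^+ 2.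
  rewrite !enorm_sqr !mulr_sumr -big_split/=; apply: ler_sum => i _.
  by rewrite !mxE; exact: sq.
have h2 : (u x - v x) ^+ 2 / enorm x `^ alpha <=
   2 * (u x ^+ 2 / enorm x `^ alpha) + 2 * (v x ^+ 2 / enorm x `^ alpha).
  rewrite (_ : 2 * (u x ^+ 2 / enorm x `^ alpha) + 2 * (v x ^+ 2 / enorm x `^ alpha) =
    (2 * u x ^+ 2 + 2 * v x ^+ 2) / enorm x `^ alpha); last by ring.
  by rewrite ler_wpM2r ?invr_ge0 ?powR_ge0.
rewrite /=; move: h1 h2; lra.
Qed.

Lemma Hsq_distC (u v : RN -> R) (G K : RN -> RN) :
  Hsq alpha (u \- v) (G \- K) = Hsq alpha (v \- u) (K \- G).
Proof.
have sq (a b : R) : (a - b) ^+ 2 = (b - a) ^+ 2 by rewrite -sqrrN opprB.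
apply: eq_integral => x _; congr (_%:E); rewrite /= !enorm_sqr (sq (u x)); congr (_ + _).
by apply: eq_bigr => i _; rewrite !mxE sq.
Qed.

Local Open Scope ereal_scope.

Lemma H_grad_approx (u : RN -> R) (e : R) : H_space alpha u -> (0 < e)%R ->
  measurable_fun setT (H_grad alpha u) /\
  exists2 phi, H_test phi & Hsq alpha (phi \- u)%R (gradient phi \- H_grad alpha u)%R <= e%:E.
Proof.
move=> [mu_ Gu] e0.
have [mG [phi tphi cphi]] : H_gradient alpha u (H_grad alpha u) by exact: xgetPex.
split => //.
(* a norm at most m <= 1 has a square at most m *)
pose m : R := Num.min 1%R e; have m0 : (0 < m)%R by rewrite lt_min ltr01.
have /fine_cvgP[fA /cvgrPdist_le/(_ _ m0)] := cphi.
move=> /(filterI fA)[k _ /(_ k (leqnn k))[/= fk]].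
rewrite sub0r normrN ger0_norm ?fine_ge0 ?poweR_ge0// => h; exists (phi k) => //.
have hh : H_pair_norm alpha (phi k \- u)%R (gradient (phi k) \- H_grad alpha u)%R <= m%:E.
  by rewrite -[leLHS]fineK// lee_fin.
apply: (le_trans (Hsq_le hh)); rewrite lee_fin expr2.
apply: (@le_trans _ _ (1 * m)%R); first by rewrite ler_wpM2r ?(ltW m0)// ge_min lexx.
by rewrite mul1r ge_min lexx orbT.
Qed.

Lemma Hsq_H_grad_lty (u : RN -> R) : H_space alpha u -> Hsq alpha u (H_grad alpha u) < +oo.
Proof.
move=> Hu; have [mG [phi tphi He]] := H_grad_approx Hu (@ltr01 R).
have mphi := measurable_test tphi; have mgrad := measurable_gradient tphi.
have [mu_ _] := Hu.
have uE : (phi \- (phi \- u))%R = u by apply/funext => x /=; rewrite subKr.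
have GE : (gradient phi \- (gradient phi \- H_grad alpha u))%R = H_grad alpha u.
  by apply/funext => x /=; rewrite subKr.
rewrite -[X in Hsq _ X _]uE -[X in Hsq _ _ X]GE.
apply: (le_lt_trans (Hsq_sub _ _ _ _)) => //.
- exact: measurable_funB.
- exact: measurable_subrV.
apply: lte_add_pinfty; apply: lte_mul_pinfty => //; first exact: Hsq_test_lty.
by apply: le_lt_trans He _; rewrite ltry.
Qed.

Lemma Hsq_near (u phi : RN -> R) (D : R) : H_space alpha u ->
  measurable_fun setT (H_grad alpha u) -> H_test phi ->
  Hsq alpha u (H_grad alpha u) <= D%:E ->
  Hsq alpha (phi \- u)%R (gradient phi \- H_grad alpha u)%R <= 1%:E ->
  Hsq alpha phi (gradient phi) <= (2 * D + 2)%:E.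
Proof.
move=> [mu_ _] mG tphi uD pu.
have mphi := measurable_test tphi; have mgrad := measurable_gradient tphi.
have pE : (u \- (u \- phi))%R = phi by apply/funext => x /=; rewrite subKr.
have GE : (H_grad alpha u \- (H_grad alpha u \- gradient phi))%R = gradient phi.
  by apply/funext => x /=; rewrite subKr.
rewrite -[X in Hsq _ X _]pE -[X in Hsq _ _ X]GE.
apply: (le_trans (Hsq_sub _ _ _ _)) => //.
- exact: measurable_funB.
- exact: measurable_subrV.
have -> : (2 * D + 2)%:E = 2%:E * D%:E + 2%:E * 1%:E :> \bar R by rewrite -!EFinM -EFinD mulr1.
by apply: leeD; rewrite lee_wpmul2l// Hsq_distC.
Qed.

(** From 2 |w| <= d + w^2 / d, the ball having finite measure. *)
Lemma L1_small (t : R) : (0 < t)%R -> exists2 e : R, (0 < e)%R &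
  forall w : RN -> R, measurable_fun setT w -> \int[mu]_x (w x ^+ 2)%:E <= e%:E ->
    \int[mu]_x `|w x|%:E <= t%:E.
Proof.
move=> t0; pose m := fine (mu setT).
have mfin : mu setT = m%:E by rewrite fineK// ge0_fin_numE//; exact: ball_finite.
have m0 : (0 <= m)%R by exact: fine_ge0.
pose d := (t / (2 * (m + 1)))%R.
have d0 : (0 < d)%R by rewrite divr_gt0// mulr_gt0// ltr_wpDl.
exists (d * t / 2)%R => [|w mw we]; first by rewrite divr_gt0// mulr_gt0.
have mw2 : measurable_fun setT (fun x => d^-1 * w x ^+ 2)%R.
  by apply: measurable_funM => //; exact: measurable_funX.
have w20 x : (0 <= d^-1 * w x ^+ 2)%R by rewrite mulr_ge0 ?invr_ge0 ?(ltW d0)// sqr_ge0.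
apply: (@le_trans _ _ (\int[mu]_x (d + d^-1 * w x ^+ 2)%:E)).
  apply: rint_le => //.
  - exact: measurableT_comp.
  - exact: measurable_funD.
  move=> x _; rewrite -[X in (_ <= _ + _ * X)%R]real_normK ?num_real//.
  set y := (`|w x|)%R.
  have y0 : (0 <= y)%R by exact: normr_ge0.
  have q : (0 <= d^-1 * (y - d) ^+ 2)%R by rewrite mulr_ge0 ?invr_ge0 ?(ltW d0)// sqr_ge0.
  have qE : (d^-1 * (y - d) ^+ 2 = d + d^-1 * y ^+ 2 - 2 * y)%R by field; rewrite gt_eqF.
  by move: q; rewrite qE; lra.
rewrite rintD//; last by move=> x _; exact: ltW.
rewrite rint_cst// rintZ//; last 3 first.
- exact: measurable_funX.
- by rewrite invr_ge0 ltW.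
- by move=> x _; exact: sqr_ge0.
apply: (@le_trans _ _ (d%:E * m%:E + d^-1%:E * (d * t / 2)%:E)).
  by rewrite mfin; apply: leeD2l; rewrite lee_wpmul2l// lee_fin invr_ge0 ltW.
rewrite -!EFinM -EFinD lee_fin.
have -> : (d^-1 * (d * t / 2) = t / 2)%R by field; rewrite gt_eqF.
have : (d * m <= t / 2)%R; last lra.
rewrite /d mulrAC ler_pdivrMr ?mulr_gt0 ?ltr_wpDl//; nra.
Qed.

End approximation.

(** * Monotonicity in the angle and power bounds for test functions *)

Section fatou_ae.
Context d (T : measurableType d) (R : realType) (mu : {measure set T -> \bar R}).
Local Open Scope ereal_scope.

Lemma fatou_bound (f : nat -> T -> \bar R) (h : T -> \bar R) (B : \bar R) :
  (forall k, measurable_fun setT (f k)) -> (forall k x, 0 <= f k x) ->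
  measurable_fun setT h -> (forall x, 0 <= h x) ->
  {ae mu, forall x, f k x @[k --> \oo] --> h x} ->
  (forall k, \int[mu]_x f k x <= B) -> \int[mu]_x h x <= B.
Proof.
move=> mf f0 mh h0 fh fB.
have le_einf (u : (\bar R)^nat) : (forall k, u k <= B) -> limn_einf u <= B.
  move=> uB; rewrite limn_einf_lim; apply: lime_le; first exact: is_cvg_einfs.
  apply: nearW => k; apply: le_trans (uB k); apply: ereal_inf_lbound.
  by exists k => /=.
apply: le_trans (le_einf _ fB).
apply: le_trans (fatou mu measurableT mf (fun k x _ => f0 k x)).
have einfE x : limn_einf (f^~ x) = - limn_esup (fun k => - f k x).
  by rewrite -limn_einfN; congr limn_einf; apply/funext => k /=; rewrite oppeK.
apply: ae_ge0_le_integral => //.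
- move=> x _; rewrite limn_einf_lim; apply: lime_ge; first exact: is_cvg_einfs.
  by apply: nearW => k; apply: le_ereal_inf_tmp => _ [m _ <-]; exact: f0.
- under eq_fun do rewrite einfE.
  apply: measurableT_comp => //; apply: measurable_fun_limn_esup => k.
  exact: measurableT_comp.
by apply: filterS fh => x /cvg_limn_einf_sup[-> _].
Qed.

End fatou_ae.

Section scalar_inequalities.
Context {R : realType}.
Implicit Types x y r : R.

Lemma powR_addn_le (p x y : R) : 0 <= p -> 0 <= x -> 0 <= y ->
  (x + y) `^ p <= 2 `^ p * (x `^ p + y `^ p).
Proof.
move=> p0 x0 y0.
wlog xy : x y x0 y0 / x <= y.
  move=> H; have [xy|/ltW yx] := leP x y; first exact: H.
  by rewrite addrC [X in _ * X]addrC; exact: H.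
apply: (@le_trans _ _ ((2 * y) `^ p)).
  by apply: ge0_ler_powR; rewrite ?nnegrE ?addr_ge0 ?mulr_ge0//; lra.
by rewrite powRM// ler_wpM2l ?powR_ge0// lerDr powR_ge0.
Qed.

Lemma expr_addn_le (m : nat) x y : 0 <= x -> 0 <= y ->
  (x + y) ^+ m <= 2 ^+ m * (x ^+ m + y ^+ m).
Proof.
by move=> x0 y0; rewrite -!powR_mulrn ?addr_ge0//; exact: powR_addn_le.
Qed.

(** Let w = y^2 r^(N-2) and t = p / 2 - 1, so that y^p = y^2 w^t r^(-(N-2) t).
Then w^t <= 1 + w^(q-1) because t <= q - 1, and r^(-(N-2) t) <= r^(-alpha) because
(N - 2) t <= alpha; equality in the latter defines the critical exponent. *)
Lemma power_interpolation (N alpha p y r : R) (q : nat) : (0 < q)%N -> 2 <= N -> 0 <= alpha ->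
  0 < r -> r <= 1 -> 0 <= y -> 2 <= p -> p <= (2 * q)%:R -> (N - 2) * (p / 2 - 1) <= alpha ->
  y `^ p <= y ^+ 2 / r `^ alpha + y ^+ (2 * q) * r `^ (q.-1%:R * (N - 2) - alpha).
Proof.
move=> q0 N2 a0 r0 r1 y0 p2 pq pa.
have [->|yn] := eqVneq y 0.
  rewrite powR0; last by rewrite gt_eqF// (lt_le_trans _ p2).
  by rewrite expr0n/= mul0r add0r mulr_ge0 ?powR_ge0// exprn_ge0.
have {yn}y0 : 0 < y by rewrite lt_neqAle eq_sym yn.
pose t := p / 2 - 1; have t0 : 0 <= t by rewrite /t; lra.
have tq : t <= q.-1%:R.
  by move: pq; rewrite natrM -(prednK q0) -natr1 /t; lra.
pose w := y ^+ 2 * r `^ (N - 2).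
have w0 : 0 < w by rewrite mulr_gt0 ?exprn_gt0 ?powR_gt0.
have wt : w `^ t <= 1 + w ^+ q.-1.
  have [w1|/ltW w1] := leP w 1.
    by rewrite (le_trans (powR_le1 (ltW w0) w1 t0))// lerDl exprn_ge0// ltW.
  rewrite (@le_trans _ _ (w ^+ q.-1)) ?lerDr// -powR_mulrn ?(ltW w0)//.
  exact: ler_powR.
have yE : y `^ p = y ^+ 2 * (w `^ t * r `^ (- ((N - 2) * t))).
  rewrite /w powRM ?sqr_ge0 ?powR_ge0// -powRrM -mulrA -powRD ?(gt_eqF r0) ?implybT//.
  rewrite subrr powRr0 mulr1 -powR_mulrn ?(ltW y0)// -powRrM -powRD ?(gt_eqF y0) ?implybT//.
  by congr (_ `^ _); rewrite /t; lra.
have rE : r `^ (- ((N - 2) * t)) <= r `^ (- alpha).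
  by apply: ger_powR; rewrite ?r0// lerN2.
rewrite yE -powRN.
have -> : y ^+ (2 * q) * r `^ (q.-1%:R * (N - 2) - alpha) = y ^+ 2 * (w ^+ q.-1 * r `^ (- alpha)).
  rewrite powRD ?(gt_eqF r0) ?implybT// /w exprMn -exprM -[in (2 * q)%N](prednK q0).
  rewrite mulnS exprD -!mulrA; congr (_ * (_ * _)).
  by rewrite [q.-1%:R * _]mulrC powRrM powR_mulrn ?powR_ge0.
rewrite -mulrDr ler_wpM2l ?sqr_ge0// -{1}[r `^ (- alpha)]mul1r -mulrDl.
by apply: ler_pM; rewrite ?powR_ge0.
Qed.

End scalar_inequalities.

Section K_plus_bound.
Context {R : realType}.
Local Notation leb := (@lebesgue_measure R).
Local Notation mR := (measurableTypeR R).
Local Notation m2 := (leb \x leb)%E.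
Variables (n : nat) (n1 : (1 < n)%N) (alpha : R) (alpha0 : 0 < alpha).
Let n0 : (0 < n)%N := ltnW n1.
Local Notation RN := 'rV[R]_(n + n).
Local Notation mu := (@ball_measure R (n + n)).
Local Notation psi_ phi := (psi_of n0 phi).
Local Notation dz_ phi := (dz_of n0 phi).
Local Open Scope ereal_scope.

Definition neg_dz (phi : RN -> R) (p : mR * mR) : R := Num.max (- dz_ phi p.1 p.2)%R 0%R.

(** A bound for the decrease of the profile when z grows from a to 1. *)
Definition zdrop (phi : RN -> R) (a : R) (r : mR) : \bar R :=
  \int[leb]_(s in `[a, 1%R[) (neg_dz phi (r, s))%:E.

Lemma neg_dz_ge0 phi p : (0 <= neg_dz phi p)%R.
Proof. by rewrite /neg_dz le_max lexx orbT. Qed.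

Lemma zdrop_ge0 phi a r : 0 <= zdrop phi a r.
Proof. by apply: rint_ge0 => s _; exact: neg_dz_ge0. Qed.

Section one_test.
Variables (phi : RN -> R) (tphi : H_test phi).

Lemma measurable_neg_dz : measurable_fun setT (neg_dz phi).
Proof.
apply: measurable_maxr => //; apply: measurableT_comp => //.
exact: profile_mz (test_profile n0 tphi).
Qed.

Lemma measurable_zdrop a : measurable_fun setT (zdrop phi a).
Proof.
apply: (@measurable_tonelliX1 R _ (fun p => (neg_dz phi p)%:E)).
- exact: (@measurable_itv R).
- by apply/measurable_EFinP; exact: measurable_neg_dz.
- by move=> p; rewrite lee_fin neg_dz_ge0.
Qed.

(** Between z and z' a function loses at most the integral of the negative part
of its derivative. *)
Lemma zdrop_bound (a r z z' : R) : (a <= z)%R -> (z <= z')%R -> (z' < 1)%R ->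
  (Num.max (psi_ phi r z) 0%R)%:E <= `|psi_ phi r z'|%:E + zdrop phi a r.
Proof.
move=> az zz z1; have P := test_profile n0 tphi.
have mr : measurable_fun setT (fun s : mR => neg_dz phi (r, s)).
  exact: (measurableT_comp measurable_neg_dz (measurable_pair1 r)).
pose B := \int[leb]_(s in `[z, z']) (neg_dz phi (r, s))%:E.
have Bz : B <= zdrop phi a r.
  apply: rint_subset => //; try exact: (@measurable_itv R).
    by move=> s _; exact: neg_dz_ge0.
  move=> s /=; rewrite !in_itv/= => /andP[zs sz].
  by rewrite (le_trans az)//= (le_lt_trans sz).
apply: (le_trans _ (leeD2l _ Bz)).
have FE : \int[leb]_(s in `[z, z']) (dz_ phi r s)%:E = (psi_ phi r z' - psi_ phi r z)%:E.
  exact: (@FTC_global R (psi_ phi r) (dz_ phi r) z z' zz (profile_dz P r) (@profile_cz _ _ _ _ P r)).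
have BE : \int[leb]_(s in `[z, z']) (fun s => (dz_ phi r s)%:E)^\- s = B.
  by apply: eq_integral => s _; rewrite funenegE /neg_dz -EFinN EFin_max.
rewrite integralE BE in FE.
have A0 : 0 <= \int[leb]_(s in `[z, z']) (fun s => (dz_ phi r s)%:E)^\+ s.
  by apply: integral_ge0 => s _; exact: funepos_ge0.
have B0 : 0 <= B by apply: rint_ge0 => s _; exact: neg_dz_ge0.
set A := \int[leb]_(s in _) _ in A0 FE.
clear - FE A0 B0.
case: B A FE A0 B0 => [b| |] [A'| |] //=; rewrite ?leey//.
rewrite !lee_fin => -[FE] A0 B0; rewrite ge_max; apply/andP; split.
  by have := ler_norm (psi_ phi r z'); lra.
by rewrite addr_ge0.
Qed.

End one_test.

Lemma theta_lt_pi4 (x : RN) : (0 < s_coord x)%R -> (0 < t_coord x)%R ->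
  (t_coord x / s_coord x < 1)%R -> (0 < theta x < pi / 4)%R.
Proof.
move=> s0 t0 z1; rewrite /theta -atan1 -[X in (X < _)%R && _]atan0.
by apply/andP; split; apply: lt_atan => //; rewrite divr_gt0.
Qed.

(** Where theta < pi/4 the angular derivative of [u] is nonnegative, so the size of a
negative angular derivative of [phi] is at most the difference of the two,
which the difference of the gradients bounds because dx/dtheta has norm r < 1.
The derivative in z is smaller, by the factor 1 + z^2. *)
Lemma neg_dz_le (u phi : RN -> R) : K_plus alpha u -> H_test phi ->
  {ae mu, forall x, (t_coord x / s_coord x < 1)%R ->
    (neg_dz phi (rz_coord x) <= enorm (gradient phi x - H_grad alpha u x))%R}.
Proof.
move=> [_ _ _ uth] tphi.
apply: filterS3 uth (ball_ae_enorm n1) (ball_ae_z_gt0 n1) => x uth /andP[x0 x1] [s0 t0] z1.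
have {uth} := uth (theta_lt_pi4 s0 t0 z1).
have := dz_grad n0 tphi s0 t0; have := enorm_dx_dtheta s0 t0.
set z := (t_coord x / s_coord x)%R in z1 *; set r := enorm x in x0 x1 *.
move=> nx dzE uth; rewrite /neg_dz ge_max enorm_ge0 andbT /=.
rewrite -/z -/r; set d := dz_ phi r z in dzE *.
have [d0|d0] := leP 0%R d; first by rewrite (@le_trans _ _ 0%R) ?oppr_le0// enorm_ge0.
have z2 : (0 <= z ^+ 2)%R by exact: sqr_ge0.
pose S := (\sum_(i < n + n) (gradient phi x - H_grad alpha u x) ord0 i * dx_dtheta x ord0 i)%R.
have SE : S = (grad_dot phi x (dx_dtheta x) - u_theta alpha u x)%R.
  by rewrite /S /grad_dot /u_theta -sumrB; apply: eq_bigr => i _; rewrite !mxE mulrBl.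
have dS : (- d <= `|S|)%R.
  by rewrite -normrN; apply: le_trans (ler_norm _); rewrite SE -dzE; nra.
apply: (le_trans dS); rewrite -(@ler_pXn2r _ 2) ?nnegrE ?enorm_ge0//.
rewrite real_normK ?num_real//; apply: (le_trans (cauchy_schwarz _ _)).
rewrite nx -[leRHS]mulr1 ler_wpM2l ?sqr_ge0// exprn_ile1// ltW//.
Qed.

(** The negative part of d phi / dz is small in L^1 by [neg_dz_le], and for z >= a
the angular weight is bounded below, so the same holds for its integral in z.
The drop, a function of r, is integrated over the cone z <= 1 so as to be read
as a function on the ball, where almost everywhere limits are taken. *)
Lemma zdrop_small (a t : R) : (0 < a)%R -> (a < 1)%R -> (0 < t)%R ->
  exists2 e : R, (0 < e)%R & forall u phi : RN -> R, K_plus alpha u -> H_test phi ->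
    Hsq alpha (phi \- u)%R (gradient phi \- H_grad alpha u)%R <= e%:E ->
    \int[mu]_x ((fun p : mR * mR => zdrop phi a p.1) \_ (setT `*` `]0%R, 1%R]) (rz_coord x)) <= t%:E.
Proof.
move=> a0 a1 t0.
pose c : R := (a ^+ n.-1 / (1 + 1 ^+ 2) ^+ n)%R.
have c0 : (0 < c)%R by rewrite divr_gt0 ?exprn_gt0 ?one_plus_sqr_gt0.
have [C C0 CE] := @ball_polar R n n1.
have [e e0 He] := L1_small n (mulr_gt0 t0 c0).
exists e => // u phi Ku tphi Hpu.
have [Hu _ _ _] := Ku; have [mG _] := H_grad_approx Hu (@ltr01 R).
have mgrad := measurable_gradient tphi.
have mneg := measurable_neg_dz tphi.
have mzd := measurable_zdrop tphi a.
have mI : measurable (`]0%R, 1%R]%classic : set mR) by exact: (@measurable_itv R).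
have mJ : measurable (`[a, 1%R[%classic : set mR) by exact: (@measurable_itv R).
have mTI : measurable ([set: mR] `*` (`]0%R, 1%R]%classic : set mR)) by exact: measurableX.
have mTJ : measurable ([set: mR] `*` (`[a, 1%R[%classic : set mR)) by exact: measurableX.
have mzd1 : measurable_fun setT (fun p : mR * mR => zdrop phi a p.1).
  by apply: (measurableT_comp mzd); exact: measurable_fst.
pose g := (fun p : mR * mR => zdrop phi a p.1) \_ (setT `*` `]0%R, 1%R]).
have mg : measurable_fun setT g.
  by apply/(measurable_restrictT _ _).1 => //; exact: measurable_funTS.
have g0 p : 0 <= g p by rewrite /g patchE; case: ifP => // _; exact: zdrop_ge0.
pose w (r : mR) : R := (ppow (n + n).-1 r * ((r : R) < 1)%R%:R)%R.
have w0 r : (0 <= w r)%R by rewrite mulr_ge0// ppow_ge0.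
have mw1 : measurable_fun setT (fun p : mR * mR => w p.1).
  apply: measurable_funM; last exact: measurable_lt1.
  apply: (measurableT_comp (f := ppow (n + n).-1 : mR -> R)); last exact: measurable_fst.
  exact: measurable_ppow.
have mw : measurable_fun setT w by exact: (measurableT_comp mw1 (measurable_pair2 (0%R : mR))).
have wE p : rzweight n p = (w p.1 * zweight n p.2)%R by rewrite /rzweight /w mulrAC.
rewrite CE//.
pose h := (fun p => (neg_dz phi p)%:E) \_ (setT `*` `[a, 1%R[).
have mh : measurable_fun setT h.
  by apply/(measurable_restrictT _ _).1 => //; apply: measurable_funTS; exact/measurable_EFinP.
have h0 p : 0 <= h p by rewrite /h patchE; case: ifP => // _; rewrite lee_fin neg_dz_ge0.
have key : \int[m2]_p (g p * (rzweight n p)%:E) <= c^-1%:E * \int[m2]_p (h p * (rzweight n p)%:E).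
  pose H (p : mR * mR) := zdrop phi a p.1 * (w p.1)%:E.
  have mH : measurable_fun setT H by apply: emeasurable_funM => //; exact/measurable_EFinP.
  have H0 p : 0 <= H p by rewrite mule_ge0 ?zdrop_ge0// lee_fin.
  apply: (@le_trans _ _ (\int[m2]_(p in setT `*` `]0%R, 1%R]) H p)).
    rewrite [leRHS]integral_mkcond; apply: ge0_le_integral => //.
    - by move=> p _; rewrite mule_ge0// lee_fin rzweight_ge0.
    - by apply: emeasurable_funM => //; apply/measurable_EFinP; exact: measurable_rzweight.
    - by apply/(measurable_restrictT _ _).1 => //; exact: measurable_funTS.
    move=> p _; rewrite /g !patchE; case: ifP => _; last by rewrite mul0e.
    rewrite lee_wpmul2l ?zdrop_ge0// lee_fin wE ler_piMr//; exact: zweight_le1.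
  have [-> _] := tonelliX measurableT mI mH H0.
  have -> : \int[leb]_r \int[leb]_(z in `]0%R, 1%R]) H (r, z) =
            \int[m2]_(p in setT `*` `[a, 1%R[) (w p.1 * neg_dz phi p)%:E.
    have mwn : measurable_fun setT (fun p : mR * mR => (w p.1 * neg_dz phi p)%:E).
      by apply/measurable_EFinP; exact: measurable_funM.
    have wn0 (p : mR * mR) : 0 <= (w p.1 * neg_dz phi p)%:E by rewrite lee_fin mulr_ge0// neg_dz_ge0.
    have [-> _] := tonelliX measurableT mJ mwn wn0.
    apply: eq_integral => r _.
    transitivity (H (r, 0%R) * leb `]0%R, 1%R]%classic); first by rewrite -integral_cst.
    have -> : leb `]0%R, 1%R]%classic = 1 by rewrite lebesgue_measure_itv/= lte_fin ltr01 oppr0 adde0.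
    rewrite mule1 /H /=.
    rewrite rintZ//; last 2 first.
    - exact: (measurableT_comp mneg (measurable_pair1 r)).
    - by move=> s _; exact: neg_dz_ge0.
    by rewrite muleC.
  apply: (@le_trans _ _ (c^-1%:E * \int[m2]_(p in setT `*` `[a, 1%R[) (neg_dz phi p * rzweight n p)%:E)).
    rewrite -rintZ//; last 3 first.
    - by apply: measurable_funM => //; exact: measurable_rzweight.
    - by rewrite invr_ge0 ltW.
    - by move=> p _; rewrite mulr_ge0 ?neg_dz_ge0 ?rzweight_ge0.
    apply: rint_le => //.
    - exact: measurable_funM.
    - by apply: measurable_funM => //; apply: measurable_funM => //; exact: measurable_rzweight.
    - by move=> p _; rewrite mulr_ge0// neg_dz_ge0.
    move=> p [_ /=]; rewrite in_itv/= => /andP[ap p1].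
    have -> : (c^-1 * (neg_dz phi p * rzweight n p) = (w p.1 * neg_dz phi p) * (zweight n p.2 * c^-1))%R.
      by rewrite wE; ring.
    have wn0 : (0 <= w p.1 * neg_dz phi p)%R by rewrite mulr_ge0// neg_dz_ge0.
    rewrite ler_peMr//.
    by rewrite ler_pdivlMr// mul1r; apply: zweight_lb => //; exact: ltW.
  rewrite lee_wpmul2l ?lee_fin ?invr_ge0 ?(ltW c0)// integral_mkcond.
  rewrite le_eqVlt; apply/orP; left; apply/eqP; apply: eq_integral => p _.
  by rewrite /h !patchE; case: ifP => _; rewrite ?mul0e// EFinM.
apply: (le_trans (lee_wpmul2l _ key)); first by rewrite lee_fin ltW.
rewrite muleCA -CE//.
apply: (@le_trans _ _ (c^-1%:E * (t * c)%:E)); last first.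
  by rewrite -EFinM lee_fin mulrCA mulVf ?mulr1// gt_eqF.
rewrite lee_wpmul2l ?lee_fin ?invr_ge0 ?(ltW c0)//.
have mdG : measurable_fun setT (gradient phi \- H_grad alpha u)%R by exact: measurable_subrV.
pose v (x : RN) := enorm ((gradient phi \- H_grad alpha u)%R x).
have mv : measurable_fun setT v by exact: (measurableT_comp (@measurable_enorm R (n + n))).
apply: (@le_trans _ _ (\int[mu]_x `|v x|%:E)); last first.
  apply: He => //; apply: (le_trans _ Hpu); apply: rint_le => //.
  - exact: measurable_funX.
  - by apply: measurable_Hsq_density => //; apply: measurable_funB;
      [exact: measurable_test|case: Hu].
  - by move=> x _; exact: sqr_ge0.
  - by move=> x _; rewrite lerDl divr_ge0 ?sqr_ge0// powR_ge0.
apply: ae_ge0_le_integral => //.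
- by apply: (measurableT_comp mh); exact: measurable_rz_coord.
- by apply/measurable_EFinP; exact: measurableT_comp.
apply: filterS (neg_dz_le Ku tphi) => x nx _; rewrite /h patchE; case: ifPn => [xJ|_]; last first.
  by change (0 <= `|v x|%:E); rewrite lee_fin.
rewrite lee_fin ger0_norm ?enorm_ge0//; apply: nx.
by move: xJ; rewrite inE => -[_ /=]; rewrite in_itv/= => /andP[].
Qed.

Section power_bound.
Variable q : nat.
Hypothesis q0 : (0 < q)%N.
Let N : R := (n + n)%:R.
Let b0 : R := (q.-1%:R * (N - 2) - alpha)%R.
Let b : R := (q.-1%:R * (N - 2) + (N - 1 - alpha))%R.

(** With |b| as the exponent, the drop to a power at least 1, times r^b, is at
most 1 whatever the sign of b. *)
Definition good_radii (phi : RN -> R) (a : R) : set mR :=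
  `]0%R, 1%R[%classic `&` [set r : mR | zdrop phi a r <= ((r : R) `^ `|b|)%:E].

(** When phi tends to u >= 0, its drops to 0 and a to 0, this tends to
r^b0 u^(2q) on the cone z <= 1. The positive part is what the one-sided
estimate [zdrop_bound] controls. *)
Definition core_power (phi : RN -> R) (a : R) : mR * mR -> \bar R :=
  (fun p : mR * mR => ((p.1 : R) `^ b0 * Num.max (psi_ phi p.1 p.2) 0 ^+ (2 * q))%:E)
    \_ (good_radii phi a `*` `[a, 1%R]).

Lemma measurable_good_radii phi a : H_test phi -> measurable (good_radii phi a).
Proof.
move=> tphi; apply: measurable_lee => //.
- by apply: measurable_funTS; exact: measurable_zdrop.
- by apply/measurable_EFinP; apply: measurable_funTS; exact: measurable_powR.
Qed.

Lemma measurable_pos_psi phi : H_test phi ->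
  measurable_fun setT (fun p : mR * mR => Num.max (psi_ phi p.1 p.2) 0%R).
Proof. by move=> tphi; apply: measurable_maxr => //; exact: profile_m (test_profile n0 tphi). Qed.

Lemma measurable_core_power phi a : H_test phi -> measurable_fun setT (core_power phi a).
Proof.
move=> tphi; apply/(measurable_restrictT _ _).1.
  by apply: measurableX; [exact: measurable_good_radii|exact: (@measurable_itv R)].
apply: measurable_funTS; apply/measurable_EFinP; apply: measurable_funM.
  exact: measurable_fst_powR.
by apply: measurable_funX; exact: measurable_pos_psi.
Qed.

Lemma core_power_ge0 phi a p : 0 <= core_power phi a p.
Proof.
rewrite /core_power patchE; case: ifP => // _.
by rewrite lee_fin mulr_ge0 ?powR_ge0// exprn_ge0// le_max lexx orbT.
Qed.

(** For z >= 1/2 the integral is part of the moment on the strip. For z < 1/2,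
[zdrop_bound] compares the value at z with those at all z' of the strip, hence
with their average; on good radii the drop only adds a constant. *)
Lemma core_power_le : exists2 C : R, (0 <= C)%R & forall (phi : RN -> R) (a K : R),
  H_test phi -> (0 < a)%R -> (a <= 2^-1)%R -> moment (psi_ phi) q b <= K%:E ->
  \int[mu]_x core_power phi a (rz_coord x) <= (C * (K + 1))%:E.
Proof.
have [C C0 CE] := @ball_polar R n n1.
pose k : R := (2 * 2 ^+ (2 * q))%R.
have k0 : (0 <= k)%R by rewrite mulr_ge0// exprn_ge0.
exists (C * (1 + k))%R; first by rewrite mulr_ge0 ?(ltW C0)// addr_ge0.
move=> phi a K tphi a0 a2 MK.
have P := test_profile n0 tphi.
have mF := measurable_core_power a tphi.
have mG := measurable_good_radii a tphi.
have mY := measurable_pos_psi tphi.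
have mI : measurable (`[a, 1%R]%classic : set mR) by exact: (@measurable_itv R).
have mS : measurable (`[2^-1%R, 1%R]%classic : set mR) by exact: (@measurable_itv R).
have mO : measurable (`]0%R, 1%R[%classic : set mR) by exact: (@measurable_itv R).
pose y (p : mR * mR) := Num.max (psi_ phi p.1 p.2) 0%R.
have y0 p : (0 <= y p)%R by rewrite le_max lexx orbT.
pose D (p : mR * mR) : R := ((p.1 : R) `^ b * `|psi_ phi p.1 p.2| ^+ (2 * q))%R.
have mD : measurable_fun setT D by exact: (measurable_moment_density P).
have D0 p : (0 <= D p)%R by exact: moment_density_ge0.
pose Y (p : mR * mR) : R := ((p.1 : R) `^ b * y p ^+ (2 * q))%R.
have mYY : measurable_fun setT Y.
  by apply: measurable_funM; [exact: measurable_fst_powR|exact: measurable_funX].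
have Y0 p : (0 <= Y p)%R by rewrite mulr_ge0 ?powR_ge0// exprn_ge0.
have YD p : (Y p <= D p)%R.
  rewrite ler_wpM2l ?powR_ge0// lerXn2r ?nnegrE ?y0//.
  by rewrite /y ge_max ler_norm normr_ge0.
pose T (r : mR) := \int[leb]_(z in `[2^-1%R, 1%R]) (D (r, z))%:E.
have EmD : measurable_fun setT (fun p => (D p)%:E) by exact/measurable_EFinP.
have ED0 p : 0 <= (D p)%:E by rewrite lee_fin.
have mT : measurable_fun setT T by exact: (measurable_tonelliX1 mS EmD ED0).
have T0 r : 0 <= T r by apply: rint_ge0.
have TM : \int[leb]_(r in `]0%R, 1%R[) T r <= K%:E.
  apply: (le_trans _ MK); rewrite /moment.
  by have [-> _] := tonelliX mO mS EmD ED0.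
rewrite CE//; last by move=> p; exact: core_power_ge0.
rewrite -mulrA EFinM; apply: lee_wpmul2l; first by rewrite lee_fin ltW.
apply: (@le_trans _ _ (\int[m2]_(p in good_radii phi a `*` `[a, 1%R]) (Y p)%:E)).
  rewrite [leRHS]integral_mkcond; apply: ge0_le_integral => //.
  - by move=> p _; rewrite mule_ge0 ?core_power_ge0// lee_fin rzweight_ge0.
  - by apply: emeasurable_funM => //; apply/measurable_EFinP; exact: measurable_rzweight.
  - apply/(measurable_restrictT _ _).1; first exact: measurableX.
    by apply: measurable_funTS; exact/measurable_EFinP.
  move=> p _; rewrite /core_power !patchE; case: ifPn => [|_]; last by rewrite mul0e.
  rewrite inE => -[[/=]]; rewrite in_itv/= => /andP[r0 r1] _ _.
  rewrite -EFinM lee_fin /Y /rzweight r1 mulr1 /ppow (max_idPl (ltW r0)).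
  have -> : ((p.1 : R) `^ b = (p.1 : R) `^ b0 * (p.1 : R) ^+ (n + n).-1)%R.
    rewrite -powR_mulrn ?(ltW r0)// -powRD ?(gt_eqF r0) ?implybT//; congr (_ `^ _)%R.
    have nn : ((n + n).-1%:R = N - 1 :> R)%R.
      by rewrite /N -(@natrB _ _ 1) ?subn1// ltn_addr// ltnW.
    by rewrite nn /b /b0; ring.
  rewrite -/(y p); set A := (_ `^ b0)%R; set W := (_ ^+ (n + n).-1)%R; set B := (y p ^+ _)%R.
  have -> : (A * B * (W * zweight n p.2) = A * W * B * zweight n p.2)%R by ring.
  rewrite ler_piMr//; last exact: zweight_le1.
  by rewrite !mulr_ge0 ?powR_ge0// exprn_ge0// ltW.
have EmY : measurable_fun setT (fun p => (Y p)%:E) by exact/measurable_EFinP.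
have EY0 p : 0 <= (Y p)%:E by rewrite lee_fin.
have [-> _] := tonelliX mG mI EmY EY0.
have mDr (r : mR) : measurable_fun setT (fun z : mR => D (r, z)).
  exact: (measurableT_comp mD (measurable_pair1 r)).
have mYr (r : mR) : measurable_fun setT (fun z : mR => Y (r, z)).
  exact: (measurableT_comp mYY (measurable_pair1 r)).
have half : leb `[2^-1%R, 1%R[%classic = (2^-1)%:E.
  rewrite lebesgue_measure_itv/= lte_fin invf_lt1// ltr1n -EFinB; congr (_%:E).
  by lra.
have mH : measurable (`[2^-1%R, 1%R[%classic : set mR) by exact: (@measurable_itv R).
(* below the strip: compare with the average over the strip *)
have below (r z : R) : good_radii phi a r -> (a <= z)%R -> (z < 2^-1)%R ->
    (Y (r, z))%:E <= k%:E * (T r + 1).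
  move=> [/= r01 gr] az z2; move: r01; rewrite in_itv/= => /andP[r0 r1].
  have pt (z' : R) : (2^-1 <= z')%R -> (z' < 1)%R ->
      (Y (r, z) <= 2 ^+ (2 * q) * (D (r, z') + 1))%R.
    move=> z2' z1'.
    have h : (y (r, z) <= `|psi_ phi r z'| + r `^ `|b|)%R.
      rewrite -lee_fin EFinD; apply: le_trans (leeD2l _ gr).
      by apply: zdrop_bound => //; rewrite (le_trans (ltW z2)).
    apply: (@le_trans _ _ (r `^ b * (`|psi_ phi r z'| + r `^ `|b|) ^+ (2 * q))%R).
      by rewrite ler_wpM2l ?powR_ge0// lerXn2r// nnegrE// addr_ge0// powR_ge0.
    apply: (@le_trans _ _ (r `^ b * (2 ^+ (2 * q) * (`|psi_ phi r z'| ^+ (2 * q) + (r `^ `|b|) ^+ (2 * q))))%R).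
      by rewrite ler_wpM2l ?powR_ge0//; apply: expr_addn_le; rewrite ?powR_ge0.
    rewrite mulrCA ler_wpM2l ?exprn_ge0// mulrDr lerD2l.
    rewrite -powR_mulrn ?powR_ge0// -powRrM -powRD ?(gt_eqF r0) ?implybT//.
    apply: powR_le1; [exact: ltW|exact: ltW|].
    have q2 : (1 <= (2 * q)%:R :> R)%R by rewrite ler1n muln_gt0.
    have := ler_norm (- b)%R; rewrite normrN => nb.
    rewrite -[X in (X <= _)%R](addrN b) lerD2l (le_trans nb)// ler_peMr//.
  have : (2^-1)%:E * (Y (r, z))%:E <= (2 ^+ (2 * q))%:E * (T r + 1).
    rewrite muleC -half -integral_cst//.
    apply: (@le_trans _ _ (\int[leb]_(z' in `[2^-1%R, 1%R[) (2 ^+ (2 * q) * (D (r, z') + 1))%:E)).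
      apply: rint_le => //.
      - by apply: measurable_funM => //; exact: measurable_funD.
      - move=> z' /=; rewrite in_itv/= => /andP[h1 h2]; exact: pt.
    rewrite rintZ//; [|exact: measurable_funD|by move=> z' _; rewrite addr_ge0].
    rewrite lee_wpmul2l ?lee_fin ?exprn_ge0// rintD//; apply: leeD.
      apply: rint_subset => //; move=> z' /=; rewrite !in_itv/= => /andP[-> /ltW ->//].
    apply: (@le_trans _ _ (1%:E * leb `[2^-1%R, 1%R[%classic)); first by rewrite -rint_cst.
    by rewrite half mul1e lee_fin invf_le1// ler1n.
  have -> : k%:E = (2 : R)%:E * (2 ^+ (2 * q))%:E by rewrite -EFinM.
  have two0 : 0 <= (2 : R)%:E by rewrite lee_fin.
  move=> h; have := lee_wpmul2l two0 h.
  have E1 : (2 : R)%:E * (2^-1)%:E = 1 :> \bar R by rewrite -EFinM divff.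
  by rewrite muleA E1 mul1e muleA.
have inner (r : R) : good_radii phi a r ->
    \int[leb]_(z in `[a, 1%R]) (Y (r, z))%:E <= (1 + k)%:E * T r + k%:E.
  move=> gr.
  pose S (z : mR) : \bar R := ((fun z : mR => (D (r, z))%:E) \_ `[2^-1%R, 1%R]) z + k%:E * (T r + 1).
  have mSr : measurable_fun setT ((fun z : mR => (D (r, z))%:E) \_ `[2^-1%R, 1%R]).
    apply/(measurable_restrictT _ _).1; first exact: mS.
    by apply: measurable_funTS; apply/measurable_EFinP; exact: mDr.
  have Sr0 z : 0 <= ((fun z : mR => (D (r, z))%:E) \_ `[2^-1%R, 1%R]) z.
    by rewrite patchE; case: ifP => // _; rewrite lee_fin.
  have kT0 : 0 <= k%:E * (T r + 1) by rewrite mule_ge0 ?lee_fin// adde_ge0.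
  apply: (@le_trans _ _ (\int[leb]_(z in `[a, 1%R]) S z)).
    apply: ge0_le_integral => //.
    - by apply: measurable_fun_EFin.
    - by apply: measurable_funTS; apply: emeasurable_funD.
    move=> z /=; rewrite in_itv/= => /andP[az z1]; rewrite /S patchE.
    have [z2|z2] := ltP z 2^-1%R.
      rewrite memNset ?add0e; first exact: below.
      by rewrite /= in_itv/= leNgt z2.
    rewrite mem_set; last by rewrite /= in_itv/= z2.
    by apply: (le_trans _ (leeDl _ kT0)); rewrite lee_fin.
  rewrite ge0_integralD//; last exact: measurable_funTS.
  apply: (@le_trans _ _ (T r + k%:E * (T r + 1))).
    apply: leeD.
      rewrite -integral_mkcondr; apply: rint_subset => //.
      exact: measurableI.
    have la : leb `[a, 1%R]%classic <= 1.
      rewrite lebesgue_measure_itv/= lte_fin; case: ifP => // _.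
      by rewrite -EFinB lee_fin gerBl ltW.
    apply: (@le_trans _ _ (k%:E * (T r + 1) * leb `[a, 1%R]%classic)).
      by rewrite le_eqVlt; apply/orP; left; apply/eqP; exact: (integral_cst _ mI).
    by rewrite -[leRHS]mule1 lee_wpmul2l.
  by rewrite ge0_muleDr// mule1 EFinD ge0_muleDl ?lee_fin// mul1e addeA.
apply: (@le_trans _ _ (\int[leb]_(r in good_radii phi a) ((1 + k)%:E * T r + k%:E))).
  apply: ge0_le_integral => //.
  - by move=> r _; apply: rint_ge0.
  - by apply: measurable_funTS; exact: (measurable_tonelliX1 mI EmY EY0).
  - by apply: measurable_funTS; apply: emeasurable_funD => //; apply: measurable_funeM.
apply: (@le_trans _ _ (\int[leb]_(r in `]0%R, 1%R[) ((1 + k)%:E * T r + k%:E))).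
  apply: ge0_subset_integral => //.
  - by apply: measurable_funTS; apply: emeasurable_funD => //; apply: measurable_funeM.
  - by move=> r _; rewrite adde_ge0// ?mule_ge0// lee_fin ?addr_ge0.
  - by move=> r [].
rewrite ge0_integralD//; last 2 first.
- by move=> r _; rewrite mule_ge0// lee_fin addr_ge0.
- by apply: measurable_funTS; apply: measurable_funeM.
rewrite ge0_integralZl//; last 2 first.
- exact: measurable_funTS.
- by rewrite lee_fin addr_ge0.
have -> : ((1 + k) * (K + 1))%:E = (1 + k)%:E * K%:E + (1 + k)%:E :> \bar R.
  by rewrite -EFinM -EFinD; congr (_%:E); ring.
apply: leeD; first by rewrite lee_wpmul2l// lee_fin addr_ge0.
have -> : \int[leb]_(r in `]0%R, 1%R[) k%:E = k%:E.
  have lO : leb `]0%R, 1%R[%classic = 1 by rewrite lebesgue_measure_itv/= lte_fin ltr01 oppr0 adde0.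
  by rewrite -[RHS]mule1 -lO -rint_cst.
by rewrite lee_fin lerDr.
Qed.

End power_bound.

End K_plus_bound.

(** * The critical power bound on K_+ *)

Section swap.
Context {R : realType}.
Variable n : nat.
Local Notation RN := 'rV[R]_(n + n).
Local Notation mu := (@ball_measure R (n + n)).
Local Open Scope ereal_scope.

Lemma enorm_swap (x : RN) : enorm (swap_st x) = enorm x.
Proof. by rewrite /swap_st enorm_row_mx addrC -enorm_row_mx hsubmxK. Qed.

Lemma s_coord_swap (x : RN) : s_coord (swap_st x) = t_coord x.
Proof. by rewrite /s_coord /swap_st row_mxKl. Qed.

Lemma t_coord_swap (x : RN) : t_coord (swap_st x) = s_coord x.
Proof. by rewrite /t_coord /swap_st row_mxKr. Qed.

Lemma measurable_swap : measurable_fun setT (@swap_st R n).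
Proof.
apply: measurable_fun_rVP => i; rewrite -(splitK i).
case: (fintype.split i) => j /=.
  rewrite (_ : (fun x => _) = (fun x : RN => x ord0 (rshift n j))); last first.
    by apply/funext => x; rewrite /swap_st row_mxEl mxE.
  exact: measurable_rV_coord.
rewrite (_ : (fun x => _) = (fun x : RN => x ord0 (lshift n j))); last first.
  by apply/funext => x; rewrite /swap_st row_mxEr mxE.
exact: measurable_rV_coord.
Qed.

(** Exchanging the two blocks of coordinates is exchanging the order of
integration. *)
Lemma ball_swap (f : RN -> \bar R) : measurable_fun setT f -> (forall x, 0 <= f x) ->
  \int[mu]_x f (swap_st x) = \int[mu]_x f x.
Proof.
move=> mf f0.
have mB := @measurable_unit_ball R (n + n).
have mfs : measurable_fun setT (fun x : RN => f (swap_st x)).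
  by apply: (measurableT_comp mf); exact: measurable_swap.
rewrite /ball_measure !ge0_integral_mrestr// integral_mkcond [RHS]integral_mkcond.
pose g := f \_ (@unit_ball R (n + n)).
have mg : measurable_fun setT g.
  by apply/(measurable_restrictT _ _).1 => //; exact: measurable_funTS.
have g0 x : 0 <= g x by rewrite /g patchE; case: ifP.
rewrite -/g; transitivity (\int[lebesgue_rV (n + n)]_x g (swap_st x)).
  apply: eq_integral => x _; rewrite /g !patchE; congr (if _ then _ else _).
  by apply/idP/idP; rewrite !inE /unit_ball/= enorm_swap.
have mF : measurable_fun setT (fun p : 'rV[R]_n * 'rV[R]_n => g (row_mx p.1 p.2)).
  exact: (measurableT_comp mg (@measurable_row_mx R n n)).
have E1 := ge0_integral_rVD (measurableT_comp mg measurable_swap) (fun x => g0 (swap_st x)).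
have E2 := ge0_integral_rVD mg g0.
have E3 := @fubini_tonelli _ _ _ _ _ (lebesgue_rV n) (lebesgue_rV n) _ mF (fun p => g0 (row_mx p.1 p.2)).
apply: (etrans E1); apply/esym; apply: (etrans E2); apply: (etrans E3).
apply: eq_integral => x _; apply: eq_integral => y _.
by rewrite /= /swap_st row_mxKl row_mxKr.
Qed.

End swap.

Section limits.
Context {R : realType}.

Lemma cvg_max0 (f : nat -> R) (l : R) : 0 <= l -> f k @[k --> \oo] --> l ->
  Num.max (f k) 0 @[k --> \oo] --> l.
Proof.
move=> l0 fl; apply/cvgrPdist_le => e e0.
move/cvgrPdist_le : fl => /(_ _ e0); apply: filterS => k; apply: le_trans.
have [fk|fk] := leP 0 (f k) => //.
rewrite subr0 !ger0_norm//; last by rewrite subr_ge0 (le_trans (ltW fk)).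
by rewrite lerDl oppr_ge0 ltW.
Qed.

Lemma cvg_exprn (m : nat) (f : nat -> R) (l : R) : f k @[k --> \oo] --> l ->
  f k ^+ m @[k --> \oo] --> l ^+ m.
Proof.
by move=> fl; exact: (cvg_comp _ _ fl (@exprn_continuous R m l)).
Qed.

End limits.

Section K_plus_power.
Context {R : realType}.
Local Notation leb := (@lebesgue_measure R).
Local Notation mR := (measurableTypeR R).
Local Notation m2 := (leb \x leb)%E.
Variables (n : nat) (n1 : (1 < n)%N) (alpha : R) (alpha2 : 2 < alpha).
Let n0 : (0 < n)%N := ltnW n1.
Let alpha0 : 0 < alpha := lt_trans (ltr0n R 2) alpha2.
Local Notation RN := 'rV[R]_(n + n).
Local Notation mu := (@ball_measure R (n + n)).
Local Notation psi_ phi := (psi_of n0 phi).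
Local Notation N := ((n + n)%:R : R).

Definition low_cone : set RN := [set x | t_coord x <= s_coord x].

Lemma measurable_low_cone : measurable low_cone.
Proof.
have /(_ measurableT [set true] I) := measurable_fun_ler (@measurable_t_coord R n) (@measurable_s_coord R n).
by congr measurable; apply/seteqP; split => [x [_ h]|x h]; [exact: h|split].
Qed.

Local Open Scope ereal_scope.

(** Approximate u by test functions fast enough for phi_k to tend to u and for
their drops to tend to 0 almost everywhere. Almost every radius is then good for
large k, so that the functions [core_power] tend to the integrand, and Fatou's
lemma transfers their uniform bound. *)
Lemma low_cone_power_bound (q : nat) (D : R) : (0 < q)%N -> exists B : R,
  forall u : RN -> R, K_plus alpha u -> Hsq alpha u (H_grad alpha u) <= D%:E ->
  \int[mu]_(x in low_cone)
     (enorm x `^ (q.-1%:R * (N - 2) - alpha) * u x ^+ (2 * q))%:E <= B%:E.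
Proof.
move=> q0; set b0 := (_ - alpha)%R.
have [Ks Ks0 KsE] := strip_energy_le n1 alpha.
have [K KE] := gn_bound N (ltW alpha2) (Ks * (2 * D + 2)) q0.
have [C C0 CE] := core_power_le n1 alpha q0.
exists (C * (K + 1))%R => u Ku uD.
have [Hu u_ge0 _ _] := Ku; have [mu_ _] := Hu.
have [mG _] := H_grad_approx Hu (@ltr01 R).
pose a (k : nat) : R := (k.+2%:R^-1)%R.
have a0 k : (0 < a k)%R by rewrite invr_gt0.
have a2 k : (a k <= 2^-1)%R by rewrite lef_pV2 ?posrE// ler_nat.
have a1 k : (a k < 1)%R by rewrite invf_lt1// ltr1n.
(* the drop over a k <= z < 1, read as a function on the plane *)
pose zd (phi : RN -> R) k := (fun p : mR * mR => zdrop n1 phi (a k) p.1) \_ (setT `*` `]0%R, 1%R]).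
have mTI : measurable ([set: mR] `*` (`]0%R, 1%R]%classic : set mR)).
  by apply: measurableX => //; exact: (@measurable_itv R).
have zd0 phi k p : 0 <= zd phi k p.
  by rewrite /zd patchE; case: ifP => // _; exact: zdrop_ge0.
have /choice[phi Hphi] : forall k, exists phi : RN -> R,
    [/\ H_test phi, Hsq alpha (phi \- u)%R (gradient phi \- H_grad alpha u)%R <= 1%:E,
      \int[mu]_x `|phi x - u x|%:E <= (2^-1 ^+ k)%:E &
      \int[mu]_x zd phi k (rz_coord x) <= (2^-1 ^+ k)%:E].
  move=> k; have h0 : (0 < 2^-1 ^+ k :> R)%R by rewrite exprn_gt0// invr_gt0.
  have [e1 e10 He1] := zdrop_small n1 alpha (a0 k) (a1 k) h0.
  have [e2 e20 He2] := L1_small n h0.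
  have e0 : (0 < Num.min 1%R (Num.min e1 e2))%R by rewrite !lt_min ltr01 e10.
  have [_ [phi tphi He]] := H_grad_approx Hu e0.
  have mdG : measurable_fun setT (gradient phi \- H_grad alpha u)%R.
    by apply: measurable_subrV => //; exact: measurable_gradient.
  have md : measurable_fun setT (phi \- u)%R.
    by apply: measurable_funB => //; exact: measurable_test.
  exists phi; split => //.
  - by apply: (le_trans He); rewrite lee_fin ge_min lexx.
  - apply: (He2 (phi \- u)%R) => //; apply: (le_trans (L2_le_Hsq n1 alpha0 md mdG)).
    by apply: (le_trans He); rewrite lee_fin !ge_min lexx !orbT.
  - apply: (He1 u) => //; apply: (le_trans He).
    by rewrite lee_fin !ge_min lexx !orbT.
have tphi k : H_test (phi k) by have [] := Hphi k.
have mphi k : measurable_fun setT (phi k) by exact: measurable_test.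
have ae1 : {ae mu, forall x, phi k x @[k --> \oo] --> u x}.
  have h := @ae_cvg0 R _ _ mu (fun k x => `|phi k x - u x|%:E) _ _ _.
  apply: filterS (h _ _ _) => [x|k|k x|k].
  - exact: EFin_cvg0.
  - by apply/measurable_EFinP; apply: measurableT_comp => //; exact: measurable_funB.
  - by rewrite lee_fin.
  - by have [] := Hphi k.
have ae2 : {ae mu, forall x, zd (phi k) k (rz_coord x) @[k --> \oo] --> 0}.
  apply: ae_cvg0 => [k|k x|k].
  - apply: (measurableT_comp (f := zd (phi k) k)); last exact: measurable_rz_coord.
    apply/(measurable_restrictT _ _).1 => //; apply: measurable_funTS.
    by apply: (measurableT_comp (measurable_zdrop n1 (tphi k) (a k))); exact: measurable_fst.
  - exact: zd0.
  - by have [] := Hphi k.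
have mh : measurable_fun setT (fun x => enorm x `^ b0 * u x ^+ (2 * q))%R.
  apply: measurable_funM; last exact: measurable_funX.
  apply: (measurableT_comp (f := fun y : R => (y `^ b0)%R)); first exact: measurable_powR.
  exact: measurable_enorm.
rewrite integral_mkcond.
apply: (@fatou_bound _ _ _ mu (fun k x => core_power n1 alpha q (phi k) (a k) (rz_coord x))).
- move=> k; apply: (measurableT_comp (measurable_core_power n1 alpha q (a k) (tphi k))).
  exact: measurable_rz_coord.
- by move=> k x; exact: core_power_ge0.
- apply/(measurable_restrictT _ _).1; first exact: measurable_low_cone.
  by apply: measurable_funTS; exact/measurable_EFinP.
- move=> x; rewrite patchE; case: ifP => // _.
  by rewrite lee_fin mulr_ge0 ?powR_ge0// exprM exprn_ge0// sqr_ge0.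
- apply: filterS2 (filterI ae1 ae2) (filterI (ball_ae_enorm n1) (filterI (ball_ae_z_gt0 n1) u_ge0)).
  move=> x [cphi czd] [/andP[x0 x1] [[s0 t0] ux]].
  pose z := (t_coord x / s_coord x)%R.
  have z0 : (0 < z)%R by rewrite divr_gt0.
  rewrite patchE; case: ifPn; rewrite ?inE ?notin_setE => xl.
    have z1 : (z <= 1)%R by rewrite ler_pdivrMr// mul1r.
    have czd' : zdrop n1 (phi k) (a k) (enorm x) @[k --> \oo] --> 0.
      apply: cvg_trans czd; apply: near_eq_cvg; apply: nearW => k.
      by rewrite /zd patchE mem_set//=; split => //=; rewrite in_itv/= -/z z0.
    have cpow : (enorm x `^ b0 * Num.max (phi k x) 0 ^+ (2 * q))%:E @[k --> \oo] -->
        (enorm x `^ b0 * u x ^+ (2 * q))%:E.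
      apply: cvg_EFin; first exact: nearW.
      apply: cvgM; first exact: cvg_cst.
      exact: cvg_exprn (cvg_max0 ux cphi).
    apply: cvg_trans cpow; apply: near_eq_cvg.
    have r0 : (0 < enorm x `^ `|(q.-1%:R * (N - 2) + (N - 1 - alpha))|)%R by exact: powR_gt0.
    have /fine_cvgP[ffin /cvgrPdist_le/(_ _ r0) fsmall] := czd'.
    have ak : \forall k \near \oo, (a k <= z)%R.
      exists (Num.truncn z^-1) => // k /= hk.
      have zi0 : (0 < z^-1)%R by rewrite invr_gt0.
      have /andP[_ hz] := truncn_itv (ltW zi0).
      rewrite /a -[leRHS]invrK lef_pV2 ?posrE//.
      rewrite (le_trans (ltW hz))// ler_nat; exact: leqW.
    move: ffin fsmall ak; apply: filterS3 => k /= ff fs az.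
    rewrite /core_power patchE mem_set/=.
      by rewrite -(phi_psi n0 (tphi k) s0).
    split; rewrite /= ?in_itv/= -/z ?az ?z1//; split => /=; first by rewrite in_itv/= x0.
    move: fs; rewrite sub0r normrN ger0_norm ?fine_ge0 ?zdrop_ge0// => fs.
    by rewrite -[leLHS]fineK// lee_fin.
  apply: cvg_near_cst; apply: nearW => k.
  rewrite /core_power patchE memNset// => -[_ /=]; rewrite in_itv/= -/z => /andP[_ z1].
  by apply: xl; move: z1; rewrite ler_pdivrMr// mul1r.
move=> k; apply: CE => //.
apply: (KE _ _ _ (test_profile n0 (tphi k))).
apply: (le_trans (KsE _ (tphi k))); rewrite EFinM lee_wpmul2l ?lee_fin ?(ltW Ks0)//.
by apply: (Hsq_near Hu mG (tphi k) uD); have [] := Hphi k.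
Qed.

(** On the cone t <= s, interpolate between the weighted square and a weighted
moment of order 2 q >= p. The symmetry between s and t maps the complement into
the cone. *)
Lemma K_plus_power_bound (p D : R) : (2 <= p)%R -> ((N - 2) * (p / 2 - 1) <= alpha)%R ->
  exists B : R, forall u : RN -> R, K_plus alpha u ->
    Hsq alpha u (H_grad alpha u) <= D%:E -> \int[mu]_x (`|u x| `^ p)%:E <= B%:E.
Proof.
move=> p2 pa.
pose q := (Num.truncn p).+1.
have pq : (p <= (2 * q)%:R)%R.
  have /andP[_ /ltW h] := truncn_itv (le_trans (ler0n R 2) p2).
  by rewrite (le_trans h)// ler_nat /q mul2n -addnn leq_addr.
have [B BE] := low_cone_power_bound D (ltn0Sn _ : (0 < q)%N).
exists (2 * (D + B))%R => u Ku uD.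
have [Hu _ u_swap _] := Ku; have [mu_ _] := Hu.
have [mG _] := H_grad_approx Hu (@ltr01 R).
pose h (x : RN) : R := (`|u x| `^ p)%R.
have mh : measurable_fun setT h.
  apply: (measurableT_comp (f := fun y : R => (y `^ p)%R)); first exact: measurable_powR.
  exact: measurableT_comp.
have h0 x : (0 <= h x)%R by exact: powR_ge0.
have mL := measurable_low_cone.
have low : \int[mu]_(x in low_cone) (h x)%:E <= (D + B)%:E.
  have N2 : (2 <= N)%R by rewrite ler_nat (leq_trans n1)// leq_addr.
  set b0 := (q.-1%:R * (N - 2) - alpha)%R.
  have mf1 : measurable_fun setT (fun x => u x ^+ 2 / enorm x `^ alpha)%R.
    apply: measurable_funM; first exact: measurable_funX.
    apply: (measurableT_comp measurable_invr).
    apply: (measurableT_comp (f := fun y : R => (y `^ alpha)%R)); first exact: measurable_powR.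
    exact: measurable_enorm.
  have mf2 : measurable_fun setT (fun x => enorm x `^ b0 * u x ^+ (2 * q))%R.
    apply: measurable_funM; last exact: measurable_funX.
    apply: (measurableT_comp (f := fun y : R => (y `^ b0)%R)); first exact: measurable_powR.
    exact: measurable_enorm.
  have f10 x : (0 <= u x ^+ 2 / enorm x `^ alpha)%R by rewrite divr_ge0 ?sqr_ge0 ?powR_ge0.
  have f20 x : (0 <= enorm x `^ b0 * u x ^+ (2 * q))%R.
    by rewrite mulr_ge0 ?powR_ge0// exprM exprn_ge0// sqr_ge0.
  apply: (@le_trans _ _ (\int[mu]_(x in low_cone)
     (u x ^+ 2 / enorm x `^ alpha + enorm x `^ b0 * u x ^+ (2 * q))%:E)).
    apply: ae_ge0_le_integral => //.
    - by move=> x _; rewrite lee_fin.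
    - exact: measurable_fun_EFin.
    - by move=> x _; rewrite lee_fin addr_ge0.
    - by apply: measurable_fun_EFin; exact: measurable_funD.
    apply: filterS (ball_ae_enorm n1) => x /andP[x0 x1] _; rewrite lee_fin.
    rewrite [X in (_ <= _ + X)%R]mulrC.
    have -> : (u x ^+ 2 = `|u x| ^+ 2)%R by rewrite real_normK// num_real.
    have -> : (u x ^+ (2 * q) = `|u x| ^+ (2 * q))%R by rewrite !exprM real_normK// num_real.
    by apply: power_interpolation => //; exact: ltW.
  rewrite rintD// EFinD; apply: leeD; last exact: BE.
  apply: (le_trans _ uD); apply: (@le_trans _ _ (\int[mu]_x (u x ^+ 2 / enorm x `^ alpha)%:E)).
    exact: rint_subset.
  apply: rint_le => //; first exact: measurable_Hsq_density.
  by move=> x _; rewrite lerDr sqr_ge0.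
have high : \int[mu]_(x in ~` low_cone) (h x)%:E <= (D + B)%:E.
  have mLs : measurable (swap_st @^-1` low_cone : set RN).
    by rewrite -[X in measurable X]setTI; exact: measurable_swap.
  apply: (@le_trans _ _ (\int[mu]_(x in (swap_st @^-1` low_cone)) (h x)%:E)).
    apply: rint_subset => //; first exact: measurableC.
    move=> x /=; rewrite /low_cone/= s_coord_swap t_coord_swap => /negP.
    by rewrite -ltNge => /ltW.
  apply: (le_trans _ low); rewrite integral_mkcond [leRHS]integral_mkcond.
  rewrite -[leRHS]ball_swap.
  - apply: ae_ge0_le_integral => //.
    + by move=> x _; rewrite patchE; case: ifP => // _; rewrite lee_fin.
    + by apply/(measurable_restrictT _ _).1 => //; apply: measurable_fun_EFin.
    + by move=> x _; rewrite patchE; case: ifP => // _; rewrite lee_fin.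
    + apply: (measurableT_comp (f := (fun x => (h x)%:E) \_ low_cone)); last exact: measurable_swap.
      by apply/(measurable_restrictT _ _).1 => //; apply: measurable_fun_EFin.
    apply: filterS u_swap => x ux _; rewrite !patchE /h ux.
    by rewrite (_ : (x \in swap_st @^-1` low_cone) = (swap_st x \in low_cone)).
  - by apply/(measurable_restrictT _ _).1 => //; apply: measurable_fun_EFin.
  - by move=> x; rewrite patchE; case: ifP => // _; rewrite lee_fin.
rewrite -(setUv low_cone) ge0_integral_setU//; last 3 first.
- exact: measurableC.
- by apply: measurable_funTS; exact/measurable_EFinP.
- exact/disj_setPCl.
have -> : (2 * (D + B))%:E = (D + B)%:E + (D + B)%:E :> \bar R.
  by rewrite -EFinD; congr (_%:E); ring.
exact: leeD.
Qed.

End K_plus_power.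

(** * From L^1 to L^p *)

Section powers.
Context {R : realType}.
Implicit Types (p q y : R).

(** Below a threshold T, y^p <= T^(p-1) y; above it, y^p <= T^(p-q) y^q, and T is
chosen so that T^(p-q) = e. *)
Lemma powR_interpolate p q (e : R) : 1 <= p -> p < q -> 0 < e ->
  exists2 C : R, 0 <= C & forall y, 0 <= y -> y `^ p <= C * y + e * y `^ q.
Proof.
move=> p1 pq e0; have qp0 : 0 < q - p by rewrite subr_gt0.
pose T := e `^ (- (q - p)^-1); have T0 : 0 < T by exact: powR_gt0.
have Te : T `^ (p - q) = e.
  rewrite -powRrM -(opprB q p) mulrNN mulVf ?powRr1 ?(ltW e0)//.
  by rewrite gt_eqF.
exists (T `^ (p - 1)) => [|y y0]; first exact: powR_ge0.
have [->|yn] := eqVneq y 0.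
  by rewrite powR0 ?gt_eqF ?(lt_le_trans _ p1)// mulr0 add0r mulr_ge0 ?powR_ge0 ?ltW.
have {yn}y0 : 0 < y by rewrite lt_neqAle eq_sym yn.
have [yT|/ltW Ty] := leP y T.
  have -> : y `^ p = y `^ (p - 1) * y.
    by rewrite -[X in _ * X](powRr1 (ltW y0)) -powRD ?(gt_eqF y0) ?implybT// subrK.
  rewrite (@le_trans _ _ (T `^ (p - 1) * y))//.
    rewrite ler_wpM2r ?(ltW y0)//; apply: ge0_ler_powR; rewrite ?nnegrE ?subr_ge0//.
    - exact: ltW.
    - exact: ltW.
  by rewrite lerDl mulr_ge0 ?powR_ge0// ltW.
have -> : y `^ p = y `^ (p - q) * y `^ q.
  by rewrite -powRD ?(gt_eqF y0) ?implybT// subrK.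
rewrite (@le_trans _ _ (e * y `^ q))//; last by rewrite lerDr mulr_ge0 ?powR_ge0// ltW.
rewrite ler_wpM2r ?powR_ge0// -Te.
by apply: powR_interval_le => //; rewrite Ty andbT subr_le0 (ltW pq) orbT.
Qed.

(** At l > 0 the power is differentiable; at l = 0 one uses y^p <= y for
y <= 1. *)
Lemma cvg_powR p (f : nat -> R) (l : R) : 1 <= p -> (forall k, 0 <= f k) -> 0 <= l ->
  f k @[k --> \oo] --> l -> f k `^ p @[k --> \oo] --> l `^ p.
Proof.
move=> p1 f0 l0 fl; have p0 : 0 < p := lt_le_trans ltr01 p1.
have [l00|ln] := eqVneq l 0; last first.
  have lp : 0 < l by rewrite lt_neqAle eq_sym ln.
  have c : {for l, continuous (fun y => y `^ p)}.
    apply/differentiable_continuous/derivable1_diffP.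
    by have [] := is_derive1_powR p lp.
  exact: (cvg_comp _ _ fl c).
rewrite l00 powR0 ?gt_eqF//; rewrite l00 in fl.
apply/cvgrPdist_le => e e0.
have m0 : 0 < Num.min 1 e by rewrite lt_min ltr01.
move/cvgrPdist_le : fl => /(_ _ m0); apply: filterS => k.
rewrite !sub0r !normrN !ger0_norm ?powR_ge0// le_min => /andP[f1 fe].
apply: le_trans fe; have [->|fn] := eqVneq (f k) 0; first by rewrite powR0// gt_eqF.
rewrite -[leRHS]powRr1//; apply: ger_powR => //.
by rewrite f1 andbT lt_neqAle eq_sym fn f0.
Qed.

Lemma EFin_powR_normE p y : (`|y%:E| `^ p)%E = (`|y| `^ p)%:E.
Proof. by rewrite abse_EFin poweR_EFin. Qed.

Local Open Scope ereal_scope.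

Lemma ge0_cvg0 (f : (\bar R)^nat) : (forall k, 0 <= f k) ->
  (forall e : R, (0 < e)%R -> \forall k \near \oo, f k <= e%:E) -> f k @[k --> \oo] --> 0.
Proof.
move=> f0 fe; apply/fine_cvgP; split.
  by apply: filterS (fe 1%R ltr01) => k fk; rewrite ge0_fin_numE// (le_lt_trans fk)// ltry.
apply/cvgrPdist_le => e e0; apply: filterS (fe e e0) => k fk.
rewrite sub0r normrN ger0_norm ?fine_ge0// -lee_fin fineK//.
by rewrite ge0_fin_numE// (le_lt_trans fk)// ltry.
Qed.

End powers.

Section Lp.
Context d (T : measurableType d) (R : realType) (mu : {measure set T -> \bar R}).
Implicit Types (p q : R).
Local Open Scope ereal_scope.

Lemma LnormE p (f : T -> R) :
  'N[mu]_(p%:E)[EFin \o f] = (\int[mu]_x (`|f x| `^ p)%:E) `^ p^-1.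
Proof. by rewrite unlock; congr (_ `^ _); apply: eq_integral => x _; exact: EFin_powR_normE. Qed.

Lemma mem_Lfun p (f : T -> R) : measurable_fun setT f ->
  \int[mu]_x (`|f x| `^ p)%:E < +oo -> f \in Lfun mu p%:E.
Proof.
move=> mf fp; rewrite inE; apply/andP; split; rewrite inE//=.
by rewrite /finite_norm LnormE; exact: poweR_lty.
Qed.

Lemma measurable_powR_norm p (f : T -> R) : measurable_fun setT f ->
  measurable_fun setT (fun x => `|f x| `^ p)%R.
Proof.
move=> mf; apply: (measurableT_comp (f := fun y : R => (y `^ p)%R)); first exact: measurable_powR.
exact: measurableT_comp.
Qed.

(** By [powR_interpolate] the L^p integral is at most a small multiple of the
bounded L^q integral plus a large multiple of the L^1 integral, which tends to
0. *)
Lemma Lnorm_cvg0 p q (B : R) (f : nat -> T -> R) : (1 <= p)%R -> (p < q)%R ->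
  (forall k, measurable_fun setT (f k)) ->
  (forall k, \int[mu]_x (`|f k x| `^ q)%:E <= B%:E) ->
  \int[mu]_x `|f k x|%:E @[k --> \oo] --> 0 ->
  'N[mu]_(p%:E)[EFin \o f k] @[k --> \oo] --> 0.
Proof.
move=> p1 pq mf fB f1; have p0 : (0 < p)%R := lt_le_trans ltr01 p1.
apply: ge0_cvg0 => [k|e e0]; first exact: Lnorm_ge0.
have B0 : (0 <= B)%R by rewrite -lee_fin; apply: le_trans (fB 0%N); apply: rint_ge0 => x _; exact: powR_ge0.
pose t := (e `^ p)%R; have t0 : (0 < t)%R by exact: powR_gt0.
pose eta := (t / (2 * (B + 1)))%R.
have B1 : (0 < B + 1)%R by rewrite ltr_wpDl.
have eta0 : (0 < eta)%R by rewrite divr_gt0// mulr_gt0.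
have [C C0 CE] := powR_interpolate p1 pq eta0.
have s0 : (0 < t / (2 * (C + 1)))%R by rewrite divr_gt0// mulr_gt0// ltr_wpDl.
have /fine_cvgP[ffin /cvgrPdist_le/(_ _ s0) fs] := f1.
apply: filterS2 ffin fs => k fk; rewrite sub0r normrN ger0_norm; last first.
  by apply: fine_ge0; apply: integral_ge0.
rewrite -lee_fin fineK// => fs.
rewrite LnormE.
have key : \int[mu]_x (`|f k x| `^ p)%:E <= t%:E.
  have mq := measurable_powR_norm q (mf k).
  have mn : measurable_fun setT (fun x => `|f k x|%R : R) by exact: measurableT_comp.
  apply: (@le_trans _ _ (\int[mu]_x (C * `|f k x| + eta * `|f k x| `^ q)%:E)).
    apply: rint_le => //.
    - exact: measurable_powR_norm.
    - by apply: measurable_funD; apply: measurable_funM.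
    - by move=> x _; exact: CE.
  rewrite rintD//; last 4 first.
  - exact: measurable_funM.
  - exact: measurable_funM.
  - by move=> x _; rewrite mulr_ge0.
  - by move=> x _; rewrite mulr_ge0 ?powR_ge0 ?ltW.
  rewrite !rintZ//; last exact: ltW.
  apply: (@le_trans _ _ (C%:E * (t / (2 * (C + 1)))%:E + eta%:E * B%:E)).
    by apply: leeD; rewrite lee_wpmul2l// lee_fin// ltW.
  rewrite -!EFinM -EFinD lee_fin.
  have h1 : (C * (t / (2 * (C + 1))) <= t / 2)%R.
    rewrite mulrA ler_pdivrMr ?mulr_gt0 ?ltr_wpDl//; nra.
  have h2 : (eta * B <= t / 2)%R.
    rewrite /eta mulrAC ler_pdivrMr ?mulr_gt0//; nra.
  by move: h1 h2; lra.
apply: (@le_trans _ _ (t%:E `^ p^-1)).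
  apply: gt0_ler_poweR; rewrite ?invr_ge0 ?(ltW p0)// in_itv/= ?leey ?andbT ?lee_fin ?(ltW t0)//.
  by apply: rint_ge0 => x _; exact: powR_ge0.
by rewrite poweR_EFin /t -powRrM divff ?gt_eqF// powRr1// ltW.
Qed.

Lemma powR_norm_sub_le q (B : R) (f g : T -> R) : (0 <= q)%R ->
  measurable_fun setT f -> measurable_fun setT g ->
  \int[mu]_x (`|f x| `^ q)%:E <= B%:E -> \int[mu]_x (`|g x| `^ q)%:E <= B%:E ->
  \int[mu]_x (`|f x - g x| `^ q)%:E <= (2 `^ q * (B + B))%:E.
Proof.
move=> q0 mf mg fB gB.
have mfq := measurable_powR_norm q mf; have mgq := measurable_powR_norm q mg.
apply: (@le_trans _ _ (\int[mu]_x (2 `^ q * (`|f x| `^ q + `|g x| `^ q))%:E)).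
  apply: rint_le => //.
  - by apply: measurable_powR_norm; exact: measurable_funB.
  - by apply: measurable_funM => //; exact: measurable_funD.
  move=> x _; apply: le_trans (powR_addn_le q0 (normr_ge0 _) (normr_ge0 _)).
  by apply: ge0_ler_powR; rewrite ?nnegrE ?addr_ge0// ler_normB.
rewrite rintZ//; last exact: measurable_funD.
rewrite EFinM lee_wpmul2l ?lee_fin ?powR_ge0// rintD//.
by rewrite EFinD; exact: (leeD fB gB).
Qed.

Lemma summable_diff_cvg (a : nat -> R) :
  \sum_(k <oo) `|a k.+1 - a k|%:E < +oo -> cvgn a.
Proof.
move=> aoo; pose S := \sum_(k <oo) `|a k.+1 - a k|%:E.
have Sfin : S \is a fin_num.
  by rewrite ge0_fin_numE//; apply: nneseries_ge0 => k _ _; rewrite lee_fin.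
pose b k := (\sum_(0 <= i < k) `|a i.+1 - a i|)%R.
have cb : cvgn b.
  apply: nondecreasing_is_cvgn.
    by apply/nondecreasing_seqP => k; rewrite /b big_nat_recr//= lerDl.
  exists (fine S) => _ [k _ <-]; rewrite -lee_fin fineK// /b -sumEFin.
  by apply: nneseries_lim_ge => j _ _; rewrite lee_fin.
have sc : cvgn (series (telescope a)) by apply: normed_cvg; exact: cb.
have -> : a = (fun k => a 0%N + series (telescope a) k)%R.
  by apply/funext => k; exact: eq_sum_telescope.
by apply: is_cvgD => //; exact: is_cvg_cst.
Qed.

(** The sum of the differences of consecutive terms has a finite integral, hence
is finite almost everywhere. The limit is written as a limsup, which is defined
and measurable everywhere. *)
Lemma L1_cauchy_limit (f : nat -> T -> R) :
  (forall k, measurable_fun setT (f k)) ->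
  (forall k i j, (k <= i)%N -> (k <= j)%N -> \int[mu]_x `|f i x - f j x|%:E <= (2^-1 ^+ k)%:E) ->
  exists v : T -> R, [/\ measurable_fun setT v,
    {ae mu, forall x, f k x @[k --> \oo] --> v x} &
    forall k, \int[mu]_x `|f k x - v x|%:E <= (2^-1 ^+ k)%:E].
Proof.
move=> mf fC.
have md i j : measurable_fun setT (fun x => `|f i x - f j x|%R : R).
  by apply: measurableT_comp => //; exact: measurable_funB.
pose v (x : T) := fine (limn_esup (fun k => (f k x)%:E)).
have mv : measurable_fun setT v.
  apply: (measurableT_comp (f := fine)) => //; apply: measurable_fun_limn_esup => k.
  exact/measurable_EFinP.
have fv : {ae mu, forall x, f k x @[k --> \oo] --> v x}.
  have h := @ae_nneseries_lty R _ _ mu (fun k x => `|f k.+1 x - f k x|%:E).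
  apply: filterS (h _ _ _) => [x fx|k|k x|k].
  - have /cvg_ex[l fl] := summable_diff_cvg fx.
    have -> : v x = l; last exact: fl.
    have c : (f k x)%:E @[k --> \oo] --> l%:E by apply: cvg_EFin => //; exact: nearW.
    by rewrite /v; have [_ ->] := cvg_limn_einf_sup c.
  - exact/measurable_EFinP.
  - by rewrite lee_fin.
  - exact: fC.
exists v; split => // k.
apply: (@fatou_bound _ _ _ mu (fun j x => `|f k x - f (j + k)%N x|%:E)).
- by move=> j; exact/measurable_EFinP.
- by move=> j x; rewrite lee_fin.
- by apply/measurable_EFinP; apply: measurableT_comp => //; exact: measurable_funB.
- by move=> x; rewrite lee_fin.
- apply: filterS fv => x fx; apply: cvg_EFin; first exact: nearW.
  apply: cvg_norm; apply: cvgB; first exact: cvg_cst.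
  by move: fx; rewrite -(cvg_shiftn k).
- by move=> j; apply: fC => //; exact: leq_addl.
Qed.

End Lp.

Section assembly.
Context {R : realType}.
Variables (n : nat) (n1 : (1 < n)%N) (alpha : R) (alpha2 : 2 < alpha).
Let alpha0 : 0 < alpha := lt_trans (ltr0n R 2) alpha2.
Local Notation RN := 'rV[R]_(n + n).
Local Notation mu := (@ball_measure R (n + n)).
Local Notation N := ((n + n)%:R : R).
Variables (p q : R).
Hypotheses (p1 : 1 <= p) (pq : p < q) (q2 : 2 <= q) (q_crit : (N - 2) * (q / 2 - 1) <= alpha).
Local Open Scope ereal_scope.

(** |f|^p <= 1 + |f|^q, and the ball has finite measure. *)
Lemma Lfun_of_power (f : RN -> R) (B : R) : measurable_fun setT f ->
  \int[mu]_x (`|f x| `^ q)%:E <= B%:E -> f \in Lfun mu p%:E.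
Proof.
move=> mf fB; apply: mem_Lfun => //.
have mq := measurable_powR_norm q mf.
apply: (@le_lt_trans _ _ (\int[mu]_x (1 + `|f x| `^ q)%:E)).
  apply: rint_le => //.
  - exact: measurable_powR_norm.
  - exact: measurable_funD.
  move=> x _; have [f1|/ltW f1] := leP `|f x|%R 1%R.
    by rewrite (@le_trans _ _ 1%R)// ?lerDl ?powR_ge0// powR_le1// (le_trans _ p1).
  by rewrite (@le_trans _ _ (`|f x| `^ q)%R) ?lerDr// ler_powR// ltW.
rewrite rintD//.
rewrite rint_cst// mul1e; apply: lte_add_pinfty; first exact: ball_finite.
by apply: le_lt_trans fB _; rewrite ltry.
Qed.

Lemma K_plus_Lfun (u : RN -> R) : K_plus alpha u -> u \in Lfun mu p%:E.
Proof.
move=> Ku; have [Hu _ _ _] := Ku; have [mu_ _] := Hu.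
have fin := Hsq_H_grad_lty n1 alpha0 Hu.
have [B BE] := K_plus_power_bound n1 alpha2 (fine (Hsq alpha u (H_grad alpha u))) q2 q_crit.
apply: (@Lfun_of_power u B) => //; apply: BE => //.
by rewrite fineK// ge0_fin_numE// Hsq_ge0.
Qed.

(** Replace u_k by a test function phi_k at L^1 distance at most 2^-k. A
subsequence of phi_k is L^1-Cauchy, its limit v is also that of u_k, and Fatou's
lemma extends to v the L^q bound of the u_k; then [Lnorm_cvg0] applies. *)
Lemma K_plus_compact (u : nat -> RN -> R) (M : R) : (forall k, K_plus alpha (u k)) ->
  (forall k, H_norm alpha (u k) <= M%:E) ->
  exists s : nat -> nat, exists v : RN -> R,
    [/\ {homo s : i j / (i < j)%N}, v \in Lfun mu p%:E &
      'N[mu]_(p%:E)[EFin \o (u (s k) \- v)%R] @[k --> \oo] --> 0].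
Proof.
move=> Ku uM; pose D := (M ^+ 2)%R.
have uD k : Hsq alpha (u k) (H_grad alpha (u k)) <= D%:E by exact: Hsq_le (uM k).
have Hu k : H_space alpha (u k) by case: (Ku k).
have mu_ k : measurable_fun setT (u k) by case: (Hu k).
have /choice[phi Hphi] : forall k, exists phi : RN -> R,
    [/\ H_test phi, Hsq alpha phi (gradient phi) <= (2 * D + 2)%:E &
      \int[mu]_x `|u k x - phi x|%:E <= (2^-1 ^+ k)%:E].
  move=> k; have h0 : (0 < 2^-1 ^+ k :> R)%R by rewrite exprn_gt0// invr_gt0.
  have [e e0 He] := L1_small n h0.
  have m0 : (0 < Num.min 1%R e)%R by rewrite lt_min ltr01.
  have [mG [phi tphi Hp]] := H_grad_approx (Hu k) m0.
  have mphi := measurable_test tphi.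
  exists phi; split => //.
    apply: (Hsq_near (Hu k) mG tphi (uD k)); apply: (le_trans Hp).
    by rewrite lee_fin ge_min lexx.
  have mdG : measurable_fun setT (H_grad alpha (u k) \- gradient phi)%R.
    by apply: measurable_subrV => //; exact: measurable_gradient.
  have md : measurable_fun setT (u k \- phi)%R by exact: measurable_funB.
  apply: (He (u k \- phi)%R) => //; apply: (le_trans (L2_le_Hsq n1 alpha0 md mdG)).
  by rewrite Hsq_distC; apply: (le_trans Hp); rewrite lee_fin ge_min lexx orbT.
have tphi k : H_test (phi k) by case: (Hphi k).
have mphi k : measurable_fun setT (phi k) by exact: measurable_test.
have [s sincr sC] := rellich n1 alpha0 tphi (fun k => let: And3 _ h _ := Hphi k in h).
have [v [mv cphi vC]] := L1_cauchy_limit (fun k => mphi (s k)) sC.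
have s_ge k : (k <= s k)%N.
  by elim: k => // k IH; apply: (leq_ltn_trans IH); exact: sincr.
have up k : \int[mu]_x `|u (s k) x - phi (s k) x|%:E <= (2^-1 ^+ k)%:E.
  have [_ _ h] := Hphi (s k); apply: (le_trans h); rewrite lee_fin.
  by apply: ler_wiXn2l => //; rewrite ?invr_ge0// invf_le1// ler1n.
have [B BE] := K_plus_power_bound n1 alpha2 D q2 q_crit.
have uB k : \int[mu]_x (`|u (s k) x| `^ q)%:E <= B%:E by apply: BE.
have q1 : (1 <= q)%R by rewrite (le_trans p1)// ltW.
have vB : \int[mu]_x (`|v x| `^ q)%:E <= B%:E.
  apply: (@fatou_bound _ _ _ mu (fun k x => (`|u (s k) x| `^ q)%:E)) => //.
  - by move=> k; apply/measurable_EFinP; exact: measurable_powR_norm.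
  - by apply/measurable_EFinP; exact: measurable_powR_norm.
  have h := @ae_cvg0 R _ _ mu (fun k x => `|u (s k) x - phi (s k) x|%:E).
  apply: filterS2 cphi (h _ _ _) => [x px ux|k|k x|k].
  - apply: cvg_EFin; first exact: nearW.
    apply: cvg_powR => //; apply: cvg_norm.
    have d0 : (u (s k) x - phi (s k) x)%R @[k --> \oo] --> (0 : R)%R.
      apply: EFin_cvg0; apply: cvg_trans ux; apply: near_eq_cvg; apply: nearW => k.
      by rewrite subr0.
    have h1 := cvgD d0 px; rewrite add0r in h1.
    rewrite (_ : (fun k => u (s k) x) = (fun k => (u (s k) x - phi (s k) x) + phi (s k) x)%R); last first.
      by apply/funext => k; rewrite subrK.
    exact: h1.
  - by apply/measurable_EFinP; apply: measurableT_comp => //; exact: measurable_funB.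
  - by rewrite lee_fin.
  - exact: up.
exists s, v; split => //; first exact: Lfun_of_power mv vB.
apply: (@Lnorm_cvg0 _ _ _ mu p q (2 `^ q * (B + B)) (fun k => (u (s k) \- v)%R)) => //.
- by move=> k; exact: measurable_funB.
- by move=> k; apply: powR_norm_sub_le => //; rewrite (le_trans _ q1).
apply: ge0_cvg0 => [k|e e0]; first exact: integral_ge0.
have h2 : (2 * 2^-1 ^+ k : R)%R @[k --> \oo] --> (0 : R)%R.
  rewrite -[X in _ --> X](mulr0 (2%R : R)); apply: cvgMr; apply: cvg_expr.
  by rewrite ger0_norm ?invr_ge0// invf_lt1// ltr1n.
move/cvgrPdist_le : h2 => /(_ _ e0); apply: filterS => k.
rewrite sub0r normrN ger0_norm; last by rewrite mulr_ge0// exprn_ge0// invr_ge0.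
move=> ke; apply: (@le_trans _ _ (2 * 2^-1 ^+ k)%:E); last by rewrite lee_fin.
have m1 : measurable_fun setT (fun x => `|u (s k) x - phi (s k) x|%R : R).
  by apply: measurableT_comp => //; exact: measurable_funB.
have m2 : measurable_fun setT (fun x => `|phi (s k) x - v x|%R : R).
  by apply: measurableT_comp => //; exact: measurable_funB.
apply: (@le_trans _ _ (\int[mu]_x (`|u (s k) x - phi (s k) x| + `|phi (s k) x - v x|)%:E)).
  apply: rint_le => //.
  - by apply: measurableT_comp => //; exact: measurable_funB.
  - exact: measurable_funD.
  by move=> x _; rewrite /= -[X in (`|X| <= _)%R](subrKA (phi (s k) x)) ler_normD.
rewrite rintD// mulrDl mul1r EFinD; apply: leeD; first exact: up.
exact: vC.
Qed.

End assembly.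

Theorem lemma7p4 (R : realType) (N n : nat) (alpha p : R)
  (hN3 : (3 <= N)%N) (hN : N = (2 * n)%N)
  (halpha : 2 < alpha)
  (hp1 : 1 <= p)
  (hp : p < (2 * N%:R + 2 * alpha - 4) / (N%:R - 2)) :
  (forall u : 'rV[R]_(n + n) -> R,
     K_plus alpha u -> u \in Lfun (ball_measure (n + n)) p%:E) /\
  (forall u : nat -> 'rV[R]_(n + n) -> R,
     (forall k, K_plus alpha (u k)) ->
     (exists M : R, forall k, (H_norm alpha (u k) <= M%:E)%E) ->
     exists sigma : nat -> nat, exists v : 'rV[R]_(n + n) -> R,
       [/\ {homo sigma : i j / (i < j)%N},
           v \in Lfun (ball_measure (n + n)) p%:E &
           ('N[ball_measure (n + n)]_(p%:E)[EFin \o (u (sigma k) \- v)%R])%E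
             @[k --> \oo] --> 0%E]).
Proof.
have n1 : (1 < n)%N by move: hN3; rewrite hN; lia.
have NE : N%:R = (n + n)%:R :> R by rewrite hN mul2n addnn.
pose q : R := (2 * N%:R + 2 * alpha - 4) / (N%:R - 2).
have N4 : 4 <= (n + n)%:R :> R by rewrite ler_nat addnn -mul2n (leq_mul2l 2 2).
have N20 : 0 < N%:R - 2 :> R by rewrite NE; lra.
have qE : (N%:R - 2) * q = 2 * N%:R + 2 * alpha - 4 by rewrite mulrC divfK// gt_eqF.
have q2 : 2 <= q by rewrite ler_pdivlMr//; lra.
have q_crit : ((n + n)%:R - 2) * (q / 2 - 1) <= alpha.
  by rewrite -NE mulrBr mulrA qE mulr1; lra.
split=> [u|u Ku [M uM]]; first exact: (K_plus_Lfun n1 halpha hp1 hp q2 q_crit).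
exact: (K_plus_compact n1 halpha hp1 hp q2 q_crit Ku uM).
Qed.
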